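(* Let $S$ be a non-decreasing function on $[0,\infty)$ with $S(x)=0$ for $x<0$ such that $\mathcal{L}\{\mathrm{d}S;s\}=\int_{0^-}^\infty e^{-sx}\,\mathrm{d}S(x)$ converges for $\Re e\, s>\alpha$, where $\alpha>0$. Suppose there are a closed null set $E\subset\mathbb{R}$ and constants $r_0,r_1,\dots,r_N\in\mathbb{R}$, $\theta_1,\dots,\theta_N\in\mathbb{R}$, $t_1,\dots,t_N>0$ such that: (I) the analytic function $$\mathcal{L}\{\mathrm{d}S;s\}-\frac{r_0}{s-\alpha}-\sum_{n=1}^Nr_n\left(\frac{e^{i\theta_n}}{s-\alpha-it_n}+\frac{e^{-i\theta_n}}{s-\alpha+it_n}\right)$$ admits local pseudofunction boundary behavior on the open subset $\alpha+i(\mathbb{R}\setminus E)$ of the line $\Re e\, s=\alpha$; (II) $E\cap\{0,t_1,\dots,t_N\}=\emptyset$; and (III) for every $t\in E$ there is $M_t>0$ with $\sup_{x>0}\left|\int_0^xe^{-\alpha u-itu}\,\mathrm{d}S(u)\right|<M_t$. Then, as $x\to\infty$, $$S(x)=e^{\alpha x}\left(\frac{r_0}{\alpha}+2\sum_{n=1}^N\frac{r_n\cos(t_nx+\theta_n-\arctan(t_n/\alpha))}{\sqrt{\alpha^2+t_n^2}}+o(1)\right).$$ Conversely, if $S$ has this asymptotic behavior, then the function in (I) has local pseudofunction boundary behavior on the whole line $\Re e\, s=\alpha$.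
   Context: Fourier transform $\hat\varphi(t)=\int e^{-itx}\varphi(x)\,\mathrm{d}x$. A tempered distribution $f$ is a pseudofunction if $\hat f\in L^\infty$ and $\hat f(x)\to0$ as $|x|\to\infty$; a distribution on an open $U$ is a local pseudofunction on $U$ if near each point of $U$ it coincides with a pseudofunction. An analytic $F$ on $\Re e\, s>\alpha$ has local pseudofunction boundary behavior on $\alpha+iU$ ($U\subseteq\mathbb{R}$ open) if $F(\sigma+it)$ converges in $\mathcal{D}'(U)$ as $\sigma\to\alpha^+$ to a local pseudofunction on $U$. *)

(* Defs.v *)
From HB Require Import structures.
From mathcomp Require Import all_boot all_order all_algebra.
From mathcomp Require Import all_classical all_reals all_analysis.
From mathcomp Require Import complex.
Import Order.TTheory GRing.Theory Num.Theory.
Import numFieldNormedType.Exports.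

Set Implicit Arguments.
Unset Strict Implicit.
Unset Printing Implicit Defensive.

Local Open Scope classical_set_scope.
Local Open Scope ring_scope.

Section Defs.
Context {R : realType}.
Local Notation C := R[i].

Definition cnorm (z : C) : R := Normc.normc z.

Definition RtoC (x : R) : C := Complex x 0.

Definition cexpi (y : R) : C := Complex (cos y) (sin y).

Definition cexp (z : C) : C := RtoC (expR (complex.Re z)) * cexpi (complex.Im z).

Definition cint (f : R -> C) : C :=
  Complex (Rintegral (@lebesgue_measure R) setT (fun x => complex.Re (f x)))
          (Rintegral (@lebesgue_measure R) setT (fun x => complex.Im (f x))).

Definition cderiv (f : R -> C) : R -> C :=
  fun x => Complex (derive1 (fun y => complex.Re (f y)) x) (derive1 (fun y => complex.Im (f y)) x).

Fixpoint cderivn (n : nat) (f : R -> C) : R -> C :=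
  match n with 0%N => f | n'.+1 => cderiv (cderivn n' f) end.

Definition csmooth (f : R -> C) : Prop :=
  forall (n : nat) (x : R),
    derivable (fun y => complex.Re (cderivn n f y)) x 1 /\
    derivable (fun y => complex.Im (cderivn n f y)) x 1.

Definition schwartz (f : R -> C) : Prop :=
  csmooth f /\
  forall j k : nat, exists M : R, forall x : R, `|x| ^+ k * cnorm (cderivn j f x) <= M.

Definition test_fun (U : set R) (f : R -> C) : Prop :=
  csmooth f /\
  exists K : set R, [/\ compact K, K `<=` U & forall x, ~ K x -> f x = 0].

(** distributions on the open set U: linear functionals on D(U)
    continuous for the usual inductive limit topology *)
Definition distribution (U : set R) (T : (R -> C) -> C) : Prop :=
  (forall (f g : R -> C) (a : C), test_fun U f -> test_fun U g ->
     T (fun x => a * f x + g x) = a * T f + T g) /\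
  (forall K : set R, compact K -> K `<=` U ->
     exists (c : R) (N : nat), forall (f : R -> C) (M : R),
       test_fun U f -> (forall x, ~ K x -> f x = 0) ->
       (forall (j : nat) (x : R), (j <= N)%N -> cnorm (cderivn j f x) <= M) ->
       cnorm (T f) <= c * M).

Definition tempered (T : (R -> C) -> C) : Prop :=
  (forall (f g : R -> C) (a : C), schwartz f -> schwartz g ->
     T (fun x => a * f x + g x) = a * T f + T g) /\
  (exists (c : R) (N : nat), forall (f : R -> C) (M : R),
     schwartz f ->
     (forall (j k : nat) (x : R), (j <= N)%N -> (k <= N)%N ->
        `|x| ^+ k * cnorm (cderivn j f x) <= M) ->
     cnorm (T f) <= c * M).

Definition fourier (f : R -> C) : R -> C :=
  fun t => cint (fun x => cexpi (- (t * x)) * f x).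

(** pseudofunction: tempered distribution T whose Fourier transform
    (defined by <\hat T, f> = <T, \hat f>) is an L^infty function G with
    G(x) -> 0 as |x| -> oo *)
Definition pseudofunction (T : (R -> C) -> C) : Prop :=
  tempered T /\
  exists G : R -> C,
    [/\ measurable_fun setT (fun x => complex.Re (G x)),
        measurable_fun setT (fun x => complex.Im (G x))
      & (exists B : R, forall x, cnorm (G x) <= B)] /\
    [/\ (cnorm (G x) @[x --> +oo] --> (0 : R)),
        (cnorm (G x) @[x --> -oo] --> (0 : R)) &
        forall f, schwartz f -> T (fourier f) = cint (fun x => G x * f x)].

Definition local_pseudofunction (U : set R) (T : (R -> C) -> C) : Prop :=
  distribution U T /\
  forall t0 : R, U t0 ->
    exists V : set R, [/\ open V, V t0, V `<=` U &
      exists P : (R -> C) -> C, pseudofunction P /\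
        forall f, test_fun V f -> T f = P f].

(** F (analytic on Re s > a) has local pseudofunction boundary behaviour
    on a + iU : F(sigma + i t) converges in D'(U) as sigma -> a^+ to a
    local pseudofunction on U *)
Definition lpf_boundary (F : C -> C) (a : R) (U : set R) : Prop :=
  exists g : (R -> C) -> C,
    local_pseudofunction U g /\
    forall f, test_fun U f ->
      forall e : R, 0 < e -> exists d : R, 0 < d /\
        forall sigma : R, a < sigma < a + d ->
          cnorm (cint (fun t => F (Complex sigma t) * f t) - g f) < e.

Definition is_RS (f : R -> C) (g : R -> R) (a b : R) (I : C) : Prop :=
  forall e : R, 0 < e -> exists d : R, 0 < d /\
    forall (n : nat) (x xi : nat -> R),
      x 0%N = a -> x n = b ->
      (forall i : nat, (i < n)%N -> x i <= xi i <= x i.+1 /\ x i.+1 - x i < d) ->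
      cnorm (\sum_(i < n) f (xi i) * RtoC (g (x i.+1) - g (x i)) - I) < e.

(** l = L{dS; s} = \int_{0^-}^oo e^{-su} dS(u) (improper integral),
    for S vanishing on (-oo,0): \int_{0^-}^X = \int_{-1}^X *)
Definition is_LS (S : R -> R) (s l : C) : Prop :=
  forall e : R, 0 < e -> exists X0 : R, forall X : R, X0 <= X ->
    exists I : C, is_RS (fun u => cexp (- (s * RtoC u))) S (-1) X I /\
                  cnorm (I - l) < e.

Definition LS_remainder (L : C -> C) (alpha r0 : R) (N : nat)
  (r theta t : 'I_N -> R) : C -> C :=
  fun s => L s - RtoC r0 / (s - RtoC alpha)
           - \sum_(n < N) RtoC (r n) *
               (cexpi (theta n) / (s - Complex alpha (t n))
                + cexpi (- theta n) / (s - Complex alpha (- t n))).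

Definition S_asymptotics (S : R -> R) (alpha r0 : R) (N : nat)
  (r theta t : 'I_N -> R) : Prop :=
  (S x * expR (- (alpha * x))
   - (r0 / alpha
      + 2 * \sum_(n < N) r n * cos (t n * x + theta n - atan (t n / alpha))
                         / Num.sqrt (alpha ^+ 2 + t n ^+ 2)))
    @[x --> +oo] --> (0 : R).

End Defs.

(* Main.v *)
(** Integrating by parts, [L{dS;s}] is [s] times the Laplace transform of [S].  Let
    [m] be the main term of the asymptotics and [e x = S x * exp(-alpha x) - m x]
    for [x > 0].  The subtracted polar part is [s] times the transform of
    [exp(alpha x) m x], up to an additive constant [c], so that the function in (I)
    is [F(alpha + s) = (alpha + s) * (int e(x) exp(-s x) dx) + c].  With
    [q(t) = (alpha + it) f(t)], the boundary value of [F] tested on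
    [exp(iyt) f(t)] is [int e(x + y) q^(x) dx + c f^(-y)], [^] being the Fourier
    transform; call [q] good if the integral tends to [0] as [y] tends to infinity.

    Direct part.  Choosing [q] supported near [0] with [q^ >= 0], the behaviour at
    [0] and the monotonicity of [S] bound [e].  Every [q] supported near a point
    outside [E] (or outside [-E], by conjugation) is good, because the Fourier
    transform of a pseudofunction vanishes at infinity.  At the remaining points,
    (III) bounds the integrals of [e(x) exp(-itx)] over [0,X]; a Baire category
    argument and the nullity of [E] then show that every test function is good.
    Since [e] is slowly decreasing, testing it against concentrated nonnegative
    kernels [q^] gives [e(x) -> 0].

    Converse.  If [e(x) -> 0], the above formula at [y = 0] defines the boundary
    distribution; multiplied by a cutoff [ch] it has the Fourier transform
    [u |-> int e(x) p^(x + u) dx + c ch^(u)] with [p(t) = (alpha + it) ch(t)], which is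
    bounded and vanishes at infinity. *)

Require Import Defs.
From HB Require Import structures.
From mathcomp Require Import all_boot all_order all_algebra.
From mathcomp Require Import all_classical all_reals all_analysis.
From mathcomp Require Import measurable_realfun lebesgue_integral_under.
From mathcomp Require Import complex ring lra.
Import Order.TTheory GRing.Theory Num.Theory.
Import numFieldNormedType.Exports.
Local Open Scope classical_set_scope.
Local Open Scope ring_scope.

Set Implicit Arguments.
Unset Strict Implicit.
Unset Printing Implicit Defensive.

(** * Integrals on the line *)

(** Three obstacles shape the direct part. Before [e] is known to be bounded, the limit at the line
    cannot be taken under the integral; the first bound is therefore obtained at a positive distance
    from the line, with a kernel whose transform is nonnegative both before and after division by
    [alpha + it]. This division preserves test functions because [alpha > 0] keeps the factor away
    from zero. Next, the constants in (III) depend on the point without any uniformity; but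
    truncated transforms are continuous, so the sets where they are all at most [n] are closed, as a
    category argument requires. Near such a point, integration by parts bounds the mollified
    transform independently of the scale of mollification, so that its contribution is controlled by
    measure alone. Finally, (III) concerns [dS] and passes to [e] only away from the frequencies of
    [m], namely [0] and both signs of each [t_n], whereas (II) excludes one sign only. Since [e] is
    real, goodness is symmetric, and [E] may be replaced by its intersection with [-E]. *)

Section RealIntegrals.
Context {R : realType}.
Local Notation mu := (@lebesgue_measure R).

(** Integrability is everywhere obtained from domination by this weight. *)
Definition wt (x : R) : R := (1 + x ^+ 2)^-1.

Lemma wt_gt0 x : 0 < wt x.
Proof. by rewrite /wt invr_gt0 ltr_pwDl// sqr_ge0. Qed.

Lemma wt_ge0 x : 0 <= wt x.
Proof. exact/ltW/wt_gt0. Qed.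

Lemma wt_le1 x : wt x <= 1.
Proof. by rewrite /wt invf_le1 ?lerDl ?sqr_ge0// ltr_pwDl// sqr_ge0. Qed.

Lemma wtE x : wt x * (1 + x ^+ 2) = 1.
Proof. by rewrite /wt mulVf// gt_eqF// ltr_pwDl// sqr_ge0. Qed.

Lemma continuous_wt : continuous (wt : R -> R).
Proof. move=> x; exact: (@continuous_oneDsqrV R). Qed.

Lemma measurable_wt : measurable_fun [set: R] (wt : R -> R).
Proof. by apply: continuous_measurable_fun; exact: continuous_wt. Qed.

Definition rint (f : R -> R) : R := Rintegral mu setT f.
Definition rI (f : R -> R) := mu.-integrable setT (EFin \o f).

Lemma integral_wt : (\int[mu]_x (wt x)%:E = (pi : R)%:E)%E.
Proof.
rewrite (@ge0_symfun_integralT R wt); last first.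
- by move=> x; rewrite /wt /= sqrrN.
- exact: continuous_wt.
- exact: wt_ge0.
rewrite -set_itvcy (@integral0y_oneDsqr R) -EFinM.
by congr EFin; lra.
Qed.

Lemma rI_wt : rI wt.
Proof.
apply/integrableP; split; first by apply/measurable_EFinP; exact: measurable_wt.
under eq_integral do rewrite /= ger0_norm ?wt_ge0//.
by rewrite integral_wt ltry.
Qed.

Lemma rint_wt_gt0 : 0 < rint wt.
Proof. by rewrite /rint /Rintegral integral_wt pi_gt0. Qed.

Lemma rI_dom (f : R -> R) (C : R) : measurable_fun setT f ->
  (forall x, `|f x| <= C * wt x) -> rI f.
Proof.
move=> mf fC; apply: (@le_integrable _ _ _ mu _ _ _ (EFin \o (fun x => C * wt x))) => //.
- exact/measurable_EFinP.
- move=> x _ /=; rewrite lee_fin (le_trans (fC x)) ?ler_norm//.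
- by apply: (@eq_integrable _ _ _ mu setT _ (fun x => C%:E * (wt x)%:E)%E) => //; apply: integrableZl => //; exact: rI_wt.
Qed.

Lemma measurable_EFin (f : R -> R) : measurable_fun [set: R] f ->
  measurable_fun [set: measurableTypeR R] (fun x => (f x)%:E).
Proof. by move=> mf; apply/measurable_EFinP. Qed.

Lemma measurable_fun_affine (a b : R) :
  measurable_fun setT ((fun x : R => a * x + b) : measurableTypeR R -> measurableTypeR R).
Proof. by apply: measurable_funD => //; apply: measurable_funM. Qed.

(** Change of variables is done on measures: an integral of [f (a * x + b)] is an integral of [f]
    against the scaled image of Lebesgue measure, which remains to be identified. *)
Lemma affine_pushforward (a b : R) :
  exists M : {measure set (measurableTypeR R) -> \bar R},
    (forall A, M A = `|a|%:E * mu ((fun x : R => (a * x + b)%R) @^-1` A))%E /\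
    (forall f : R -> \bar R, measurable_fun [set: R] f -> (forall x, 0 <= f x)%E ->
      \int[M]_x f x = `|a|%:E * \int[mu]_x f (a * x + b)%R)%E.
Proof.
have na : 0 <= `|a| by [].
pose na' := NngNum na.
pose P : {measure set (measurableTypeR R) -> \bar R} :=
  measure_function_pushforward__canonical__measure_function_Measure mu
    (measurable_fun_affine a b).
exists (mscale na' P : {measure set (measurableTypeR R) -> \bar R}).
split => // f mf f0.
rewrite ge0_integral_mscale//.
by rewrite (ge0_integral_pushforward (@measurable_fun_affine a b)).
Qed.

(** Uniqueness of Lebesgue measure reduces this to half-open intervals; a negative slope only moves
    the closed end to the other side, without changing the length. *)
Lemma affine_measure (a b : R) (A : set R) : a != 0 -> measurable A ->
  (`|a|%:E * mu ((fun x : R => (a * x + b)%R) @^-1` A) = mu A)%E.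
Proof.
move=> a0 mA.
have [M [ME _]] := affine_pushforward a b.
rewrite -ME; apply/esym/(@lebesgue_measure_unique R M) => //.
move=> _ [[c d]] _ <- /=.
rewrite ME.
case: (ltP 0 a) => a_sg.
  have -> : (fun x : R => a * x + b) @^-1` `]c, d] = `](c - b) / a, (d - b) / a]%classic.
    apply/seteqP; split => x /=; rewrite !in_itv /=.
      by rewrite ltr_pdivrMr// ler_pdivlMr// [x * a]mulrC ltrBlDr lerBrDr.
    by rewrite ltr_pdivrMr// ler_pdivlMr// [x * a]mulrC ltrBlDr lerBrDr.
  rewrite !lebesgue_measure_itv /= !lte_fin ltr_pM2r ?invr_gt0// ltrD2r.
  case: ifP => _; last by rewrite mule0.
  rewrite -EFinD -EFinM gtr0_norm//; congr EFin; field.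
  by rewrite gt_eqF.
have {}a_sg : a < 0 by rewrite lt_neqAle a0.
have -> : (fun x : R => a * x + b) @^-1` `]c, d] = `[(d - b) / a, (c - b) / a[%classic.
  apply/seteqP; split => x /=; rewrite !in_itv /=.
    by rewrite ltr_ndivlMr// ler_ndivrMr// [x * a]mulrC ltrBlDr lerBrDr andbC.
  by rewrite ltr_ndivlMr// ler_ndivrMr// [x * a]mulrC ltrBlDr lerBrDr andbC.
rewrite !lebesgue_measure_itv /= !lte_fin ltr_nM2r ?invr_lt0// ltrD2r.
case: ifP => _; last by rewrite mule0.
rewrite -EFinD -EFinM ltr0_norm//; congr EFin; field.
by rewrite lt_eqF.
Qed.

Lemma affine_ge0_integral (a b : R) (f : R -> \bar R) : a != 0 ->
  measurable_fun [set: R] f -> (forall x, 0 <= f x)%E ->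
  (`|a|%:E * \int[mu]_x f (a * x + b)%R = \int[mu]_x f x)%E.
Proof.
move=> a0 mf f0.
have [M [ME]] := affine_pushforward a b.
move=> /(_ f mf f0) <-.
by apply: eq_measure_integral => //= A mA _; rewrite ME affine_measure.
Qed.

Lemma measurable_affine (a b : R) (f : R -> R) :
  measurable_fun setT f -> measurable_fun setT (fun x => f (a * x + b)).
Proof.
move=> mf; apply: (measurableT_comp mf).
by apply: measurable_funD => //; apply: measurable_funM.
Qed.

Lemma rI_affine (a b : R) (f : R -> R) : a != 0 -> rI f ->
  rI (fun x => f (a * x + b)).
Proof.
move=> a0 /integrableP[mf fi]; apply/integrableP; split.
  by apply: measurable_EFin; apply: measurable_affine; apply/measurable_EFinP.
have := @affine_ge0_integral a b (fun x => `|(f x)%:E|)%E a0.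
move=> /(_ (measurableT_comp _ mf)) h.
have /= {}h := h (@abse_measurable _ _) (fun x => abse_ge0 _).
rewrite -h in fi.
have : (0 < `|a|%:E)%E by rewrite lte_fin normr_gt0.
move=> a_gt0; rewrite ltey; apply/eqP => fy.
by move: fi; rewrite fy gt0_muley.
Qed.

Lemma rint_affine (a b : R) (f : R -> R) : a != 0 -> rI f ->
  `|a| * rint (fun x => f (a * x + b)) = rint f.
Proof.
move=> a0 fi; have fi' := rI_affine b a0 fi.
have /integrableP[mf _] := fi.
rewrite /rint /Rintegral [in RHS]integralE [in LHS]integralE.
have mf' : measurable_fun [set: R] (EFin \o f) by [].
have hp := affine_ge0_integral b a0 (measurable_funepos mf') (funepos_ge0 _).
have hn := affine_ge0_integral b a0 (measurable_funeneg mf') (funeneg_ge0 _).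
rewrite -[X in _ = fine (X - _)]hp -[X in _ = fine (_ - X)]hn.
have ip := integrable_funepos measurableT fi'.
have in_ := integrable_funeneg measurableT fi'.
have h1 := integral_fune_fin_num measurableT ip.
have h2 := integral_fune_fin_num measurableT in_.
have cp : (fun x : R => (EFin \o f)^\+ (a * x + b)%R)%E = ((EFin \o (fun x => f (a * x + b)%R))^\+)%E.
  by apply/funext => x; rewrite !funeposE.
have cn : (fun x : R => (EFin \o f)^\- (a * x + b)%R)%E = ((EFin \o (fun x => f (a * x + b)%R))^\-)%E.
  by apply/funext => x; rewrite !funenegE.
rewrite cp cn -muleBr//; last by apply: fin_num_adde_defl; rewrite // fin_numN.
rewrite fineM//.
by rewrite fin_numB; apply/andP; split.
Qed.

Lemma rintD f g : rI f -> rI g -> rint (fun x => f x + g x) = rint f + rint g.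
Proof. by move=> fi gi; rewrite /rint RintegralD. Qed.

Lemma rintZ c f : rI f -> rint (fun x => c * f x) = c * rint f.
Proof. by move=> fi; rewrite /rint RintegralZl. Qed.

Lemma rID f g : rI f -> rI g -> rI (fun x => f x + g x).
Proof. exact: integrableD. Qed.

Lemma rIZ c f : rI f -> rI (fun x => c * f x).
Proof. exact: integrableZl. Qed.

Lemma le_rint f g : rI f -> rI g -> (forall x, f x <= g x) -> rint f <= rint g.
Proof. by move=> fi gi fg; apply: le_Rintegral. Qed.

Lemma rint_bound f g : rI f -> rI g -> (forall x, `|f x| <= g x) -> `|rint f| <= rint g.
Proof.
move=> fi gi fg; rewrite /rint.
apply: (le_trans (le_normr_Rintegral measurableT fi)).
apply: le_Rintegral => //.
exact: integrable_norm.
Qed.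

Lemma rint_DCT (f_ : nat -> R -> R) (f g : R -> R) :
  (forall n, measurable_fun setT (f_ n)) -> measurable_fun setT f ->
  (forall x, f_ n x @[n --> \oo] --> f x) -> rI g ->
  (forall n x, `|f_ n x| <= g x) ->
  rint (f_ n) @[n --> \oo] --> rint f.
Proof.
move=> mf_ mf cf ig fg.
have [fi _ h] : [/\ mu.-integrable setT (EFin \o f),
  (\int[mu]_x `|(f_ n x)%:E - (f x)%:E|)%E @[n --> \oo] --> 0%E &
  (\int[mu]_x (f_ n x)%:E)%E @[n --> \oo] --> (\int[mu]_x (f x)%:E)%E].
  apply: (@dominated_convergence _ _ _ mu setT measurableT
    (fun n x => (f_ n x)%:E) (EFin \o f) (EFin \o g)) => //.
  - by move=> n; exact: measurable_EFin.
  - exact: measurable_EFin.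
  - by apply: aeW => x _; apply: cvg_EFin; [exact: nearW|exact: cf].
  - by apply: aeW => x n _ /=; rewrite lee_fin.
apply: fine_cvg.
by rewrite fineK //; exact: integral_fune_fin_num.
Qed.

Section Fubini.
Variable F : R * R -> R.
Hypothesis mF : measurable_fun [set: R * R] F.
Variable C : R.
Hypothesis FC : forall x y, `|F (x, y)| <= C * (wt x * wt y).

Lemma measurable_fst_slice x : measurable_fun setT (fun y : R => F (x, y)).
Proof. by apply: (measurableT_comp mF); exact: measurable_pair1. Qed.

Lemma measurable_snd_slice y : measurable_fun setT (fun x : R => F (x, y)).
Proof. by apply: (measurableT_comp mF); exact: measurable_pair2. Qed.

Lemma rI_fst_slice x : rI (fun y : R => F (x, y)).
Proof.
apply: (@rI_dom _ (C * wt x)); first exact: measurable_fst_slice.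
by move=> y; rewrite -mulrA.
Qed.

Lemma rI_snd_slice y : rI (fun x : R => F (x, y)).
Proof.
apply: (@rI_dom _ (C * wt y)); first exact: measurable_snd_slice.
by move=> x; rewrite -mulrA [wt y * _]mulrC.
Qed.

(** Tonelli for [|F|]: the inner integral is at most [C * rint wt * wt x]. A product majorant of
    this kind is what is checked whenever integrals are exchanged. *)
Lemma integrable_wt2 : (mu \x mu)%E.-integrable setT (EFin \o F).
Proof.
have mE : measurable_fun [set: measurableTypeR R * measurableTypeR R] (EFin \o F).
  exact/measurable_EFinP.
apply: (iffRL (integrable12ltyP mu mu mE)).
apply: (@le_lt_trans _ _ (\int[mu]_x ((C * rint wt) * wt x)%:E)%E).
  apply: ge0_le_integral => //.
  - by move=> x _; apply: integral_ge0.
  - apply: (@measurable_fun_fubini_tonelli_F _ _ _ _ _ mu (fun z => `|(F z)%:E|)%E) => //.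
    exact: measurableT_comp.
  - apply: measurable_EFin; apply: measurable_funM => //; exact: measurable_wt.
  move=> x _.
  have -> : (C * rint wt * wt x)%:E = (\int[mu]_y (C * (wt x * wt y))%:E)%E.
    under eq_integral do rewrite mulrA EFinM.
    rewrite integralZl//; last exact: rI_wt.
    rewrite /rint /Rintegral integral_wt /= -EFinM; congr EFin; ring.
  apply: ge0_le_integral => //.
  - by apply: measurable_EFin; apply: measurableT_comp => //; exact: measurable_fst_slice.
  - apply: measurable_EFin; do 2 apply: measurable_funM => //; exact: measurable_wt.
  - by move=> y _; rewrite lee_fin.
have h := rIZ (C * rint wt) rI_wt.
by have /= := integral_fune_fin_num measurableT h; rewrite fin_numE ltey => /andP[].
Qed.

Lemma rint_fst_slice x : (rint (fun y => F (x, y)))%:E = (\int[mu]_y (F (x, y))%:E)%E.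
Proof. by rewrite /rint /Rintegral fineK//; apply: integral_fune_fin_num => //; exact: rI_fst_slice. Qed.

Lemma rint_snd_slice y : (rint (fun x => F (x, y)))%:E = (\int[mu]_x (F (x, y))%:E)%E.
Proof. by rewrite /rint /Rintegral fineK//; apply: integral_fune_fin_num => //; exact: rI_snd_slice. Qed.

Lemma measurable_rint_fst : measurable_fun setT (fun x => rint (fun y => F (x, y))).
Proof.
apply/measurable_EFinP.
rewrite (_ : _ \o _ = (fun x => \int[mu]_y (EFin \o F) (x, y))%E); last first.
  by apply/funext => x /=; exact: rint_fst_slice.
exact: (measurable_fubini_F integrable_wt2).
Qed.

Lemma measurable_rint_snd : measurable_fun setT (fun y => rint (fun x => F (x, y))).
Proof.
apply/measurable_EFinP.
rewrite (_ : _ \o _ = (fun y => \int[mu]_x (EFin \o F) (x, y))%E); last first.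
  by apply/funext => x /=; exact: rint_snd_slice.
exact: (measurable_fubini_G integrable_wt2).
Qed.

Lemma rint_Fubini :
  rint (fun x => rint (fun y => F (x, y))) = rint (fun y => rint (fun x => F (x, y))).
Proof.
rewrite {1}/rint {1}[in RHS]/rint /Rintegral; congr fine.
under eq_integral do rewrite rint_fst_slice.
under [RHS]eq_integral do rewrite rint_snd_slice.
exact: (Fubini integrable_wt2).
Qed.

End Fubini.

End RealIntegrals.

(** * Complex arithmetic and limits *)

Section ComplexNumbers.
Context {R : realType}.
Local Notation C := R[i].
Local Notation Re := complex.Re.
Local Notation Im := complex.Im.

Lemma complex_eq (z w : C) : Re z = Re w -> Im z = Im w -> z = w.
Proof. by case: z => a b; case: w => c d /= -> ->. Qed.

Lemma cReD (z w : C) : Re (z + w) = Re z + Re w.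
Proof. by case: z => a b; case: w. Qed.
Lemma cImD (z w : C) : Im (z + w) = Im z + Im w.
Proof. by case: z => a b; case: w. Qed.
Lemma cReN (z : C) : Re (- z) = - Re z.
Proof. by case: z. Qed.
Lemma cImN (z : C) : Im (- z) = - Im z.
Proof. by case: z. Qed.
Lemma cReM (z w : C) : Re (z * w) = Re z * Re w - Im z * Im w.
Proof. by case: z => a b; case: w. Qed.
Lemma cImM (z w : C) : Im (z * w) = Re z * Im w + Im z * Re w.
Proof. by case: z => a b; case: w. Qed.
Definition ReImE := (cReD, cImD, cReN, cImN, cReM, cImM).

Lemma cnormM (z w : C) : cnorm (z * w) = cnorm z * cnorm w.
Proof. exact: Normc.normcM. Qed.
Lemma cnormD (z w : C) : cnorm (z + w) <= cnorm z + cnorm w.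
Proof. exact: le_normcD. Qed.
Lemma cnormN (z : C) : cnorm (- z) = cnorm z.
Proof. exact: normcN. Qed.
Lemma cnormV (z : C) : cnorm z^-1 = (cnorm z)^-1.
Proof. exact: Normc.normcV. Qed.
Lemma cnorm0 : cnorm (0 : C) = 0.
Proof. exact: Normc.normc0. Qed.
Lemma cnorm_eq0 (z : C) : cnorm z = 0 -> z = 0.
Proof. exact: Normc.eq0_normc. Qed.
Lemma cnorm_ge0 (z : C) : 0 <= cnorm z.
Proof. by case: z => a b; rewrite /cnorm /=; exact: sqrtr_ge0. Qed.
Lemma cnorm_gt0 (z : C) : z != 0 -> 0 < cnorm z.
Proof.
move=> z0; rewrite lt_neqAle cnorm_ge0 andbT eq_sym.
by apply: contra z0 => /eqP/cnorm_eq0 ->.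
Qed.
Lemma cnormB (z w : C) : cnorm (z - w) <= cnorm z + cnorm w.
Proof. by rewrite -(cnormN w); exact: cnormD. Qed.

Lemma cnorm_Re (z : C) : `|Re z| <= cnorm z.
Proof.
case: z => a b; rewrite /cnorm /= -(sqrtr_sqr a) ler_wsqrtr//.
by rewrite lerDl sqr_ge0.
Qed.
Lemma cnorm_Im (z : C) : `|Im z| <= cnorm z.
Proof.
case: z => a b; rewrite /cnorm /= -(sqrtr_sqr b) ler_wsqrtr//.
by rewrite lerDr sqr_ge0.
Qed.
Lemma cnorm_leReIm (z : C) : cnorm z <= `|Re z| + `|Im z|.
Proof.
case: z => a b; rewrite /cnorm /=.
rewrite -(@ler_pXn2r _ 2) ?nnegrE ?addr_ge0 ?sqrtr_ge0//.
rewrite sqr_sqrtr ?addr_ge0 ?sqr_ge0// sqrrD !real_normK ?num_real//.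
by rewrite lerD2r lerDl mulrn_wge0// mulr_ge0.
Qed.

Lemma RtoCD (x y : R) : RtoC (x + y) = RtoC x + RtoC y.
Proof. by apply: complex_eq; rewrite ?ReImE /= ?addr0. Qed.
Lemma RtoCN (x : R) : RtoC (- x) = - RtoC x.
Proof. by apply: complex_eq; rewrite ?ReImE /= ?oppr0. Qed.
Lemma RtoCB (x y : R) : RtoC (x - y) = RtoC x - RtoC y.
Proof. by rewrite RtoCD RtoCN. Qed.
Lemma RtoCM (x y : R) : RtoC (x * y) = RtoC x * RtoC y.
Proof. by apply: complex_eq; rewrite ?ReImE /= ?(mulr0,mul0r,addr0,subr0). Qed.
Lemma RtoC0 : RtoC 0 = 0 :> C. Proof. by []. Qed.
Lemma RtoC1 : RtoC 1 = 1 :> C. Proof. by []. Qed.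
Lemma RtoC_eq0 (x : R) : (RtoC x == 0) = (x == 0).
Proof. by rewrite eq_complex /= eqxx andbT. Qed.
Lemma RtoCV (x : R) : RtoC x^-1 = (RtoC x)^-1.
Proof.
have [->|x0] := eqVneq x 0; first by rewrite invr0 RtoC0 invr0.
by apply: (mulIf (x:=RtoC x)); rewrite ?RtoC_eq0// -RtoCM !mulVf// RtoC_eq0.
Qed.
Lemma cnorm_RtoC (x : R) : cnorm (RtoC x) = `|x|.
Proof. by rewrite /cnorm /RtoC /= expr0n addr0 sqrtr_sqr. Qed.

Lemma cexpiD (x y : R) : cexpi (x + y) = cexpi x * cexpi y.
Proof.
apply: complex_eq; rewrite ?ReImE /= ?cosD ?sinD//.
by rewrite addrC [X in X + _]mulrC addrC; congr (_ + _); rewrite mulrC.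
Qed.
Lemma cexpi0 : cexpi 0 = 1 :> C.
Proof. by rewrite /cexpi cos0 sin0. Qed.
Lemma cexpiNM (x : R) : cexpi (- x) * cexpi x = 1.
Proof. by rewrite -cexpiD addNr cexpi0. Qed.
Lemma cnorm_cexpi (x : R) : cnorm (cexpi x) = 1.
Proof. by rewrite /cnorm /cexpi /= cos2Dsin2 sqrtr1. Qed.
Definition cconj (z : C) : C := Complex (Re z) (- Im z).
Lemma cconjM (z w : C) : cconj (z * w) = cconj z * cconj w.
Proof. by apply: complex_eq; rewrite /cconj ?ReImE /=; ring. Qed.
Lemma cconj_cexpi (x : R) : cconj (cexpi x) = cexpi (- x).
Proof. by rewrite /cconj /cexpi /= cosN sinN. Qed.
Lemma cconj_RtoC (x : R) : cconj (RtoC x) = RtoC x.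
Proof. by rewrite /cconj /RtoC /= oppr0. Qed.
Lemma cnorm_cconj (z : C) : cnorm (cconj z) = cnorm z.
Proof. by case: z => a b; rewrite /cnorm /cconj /= sqrrN. Qed.
Lemma cconj0 : cconj 0 = 0.
Proof. by apply: complex_eq; rewrite /= ?oppr0. Qed.
Lemma mul_cconj (z : C) : cconj z * z = RtoC (cnorm z ^+ 2).
Proof.
case: z => a b; rewrite /cnorm /= sqr_sqrtr ?addr_ge0 ?sqr_ge0//.
by apply: complex_eq; rewrite ?ReImE /=; ring.
Qed.

(** Stated through the real number [cnorm], so that squeezing and comparison are done on real
    sequences. *)
Definition ccvg (u : nat -> C) (l : C) := cnorm (u n - l) @[n --> \oo] --> (0 : R).

Lemma ccvgP (u : nat -> C) l : ccvg u l <->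
  (Re (u n) @[n --> \oo] --> Re l) /\ (Im (u n) @[n --> \oo] --> Im l).
Proof.
split=> [h|[h1 h2]].
  split; apply/cvgrPdist_le => e e0; move/cvgrPdist_le: h => /(_ e e0);
  apply: filterS => n; rewrite sub0r normrN ger0_norm ?cnorm_ge0// => h;
  rewrite distrC; apply: le_trans h.
    by rewrite -cReN -cReD cnorm_Re.
  by rewrite -cImN -cImD cnorm_Im.
have h : `|Re (u n) - Re l| + `|Im (u n) - Im l| @[n --> \oo] --> (0 : R).
  rewrite -[0 in X in _ --> X]addr0; apply: cvgD.
    by apply/norm_cvg0P; rewrite -(subrr (Re l)); apply: cvgB => //; exact: cvg_cst.
  by apply/norm_cvg0P; rewrite -(subrr (Im l)); apply: cvgB => //; exact: cvg_cst.
apply: (squeeze_cvgr _ _ h); last exact: cvg_cst.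
apply: nearW => n; rewrite cnorm_ge0 /= (le_trans (cnorm_leReIm _))//.
by rewrite !ReImE.
Qed.

End ComplexNumbers.

Section ComplexMeasurability.
Context {R : realType} d (T : measurableType d).
Local Notation C := R[i].
Local Notation Re := complex.Re.
Local Notation Im := complex.Im.

Definition cM (f : T -> C) :=
  measurable_fun setT (fun x => Re (f x)) /\ measurable_fun setT (fun x => Im (f x)).

Lemma cM_eq (f g : T -> C) : f =1 g -> cM f -> cM g.
Proof. by move=> /funext ->. Qed.
Lemma cM_cst (c : C) : cM (fun _ => c).
Proof. by split; exact: measurable_cst. Qed.
Lemma cM_D f g : cM f -> cM g -> cM (fun x => f x + g x).
Proof.
move=> [f1 f2] [g1 g2]; split.
  by under eq_fun do rewrite cReD; exact: measurable_funD.
by under eq_fun do rewrite cImD; exact: measurable_funD.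
Qed.
Lemma cM_N f : cM f -> cM (fun x => - f x).
Proof.
move=> [f1 f2]; split.
  by under eq_fun do rewrite cReN; exact: measurableT_comp.
by under eq_fun do rewrite cImN; exact: measurableT_comp.
Qed.
Lemma cM_M f g : cM f -> cM g -> cM (fun x => f x * g x).
Proof.
move=> [f1 f2] [g1 g2]; split.
  by under eq_fun do rewrite cReM; apply: measurable_funB; exact: measurable_funM.
by under eq_fun do rewrite cImM; apply: measurable_funD; exact: measurable_funM.
Qed.
Lemma cM_RtoC (f : T -> R) : measurable_fun setT f -> cM (fun x => RtoC (f x)).
Proof. by move=> mf; split => //; exact: measurable_cst. Qed.
Lemma cM_cexpi (f : T -> R) : measurable_fun setT f -> cM (fun x => cexpi (f x)).
Proof.
move=> mf; split => /=; apply: measurableT_comp => //; apply: continuous_measurable_fun.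
  exact: continuous_cos.
exact: continuous_sin.
Qed.
Lemma cM_cconj f : cM f -> cM (fun x => cconj (f x)).
Proof. by move=> [f1 f2]; split => //=; exact: measurableT_comp. Qed.
End ComplexMeasurability.

(** * Integrals of complex-valued functions *)

Section ComplexIntegrals.
Context {R : realType}.
Local Notation C := R[i].
Local Notation Re := complex.Re.
Local Notation Im := complex.Im.

Lemma cM_comp (d : measure_display) (T : measurableType d) (f : R -> C) (g : T -> R) :
  cM f -> measurable_fun setT g -> cM (fun x => f (g x)).
Proof. by move=> [f1 f2] mg; split; [apply: (measurableT_comp f1)|apply: (measurableT_comp f2)]. Qed.

Lemma cM_affine (a b : R) (f : R -> C) : cM f -> cM (fun x => f (a * x + b)).
Proof. by move=> mf; apply: cM_comp => //; exact: measurable_fun_affine. Qed.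

Lemma cM_continuous (f : R -> C) : continuous (fun x => Re (f x)) ->
  continuous (fun x => Im (f x)) -> cM f.
Proof. by move=> f1 f2; split; apply: continuous_measurable_fun. Qed.

Definition cI (f : R -> C) := rI (fun x => Re (f x)) /\ rI (fun x => Im (f x)).

Lemma cintE (f : R -> C) :
  cint f = Complex (rint (fun x => Re (f x))) (rint (fun x => Im (f x))).
Proof. by []. Qed.

Lemma eq_cint (f g : R -> C) : f =1 g -> cint f = cint g.
Proof. by move=> /funext ->. Qed.

Lemma cI_dom (f : R -> C) (g : R -> R) : cM f -> rI g ->
  (forall x, cnorm (f x) <= g x) -> cI f.
Proof.
move=> [f1 f2] ig fg; split.
  apply: (@le_integrable _ _ _ (@lebesgue_measure R) _ _ _ (EFin \o g)) => //.
    exact: measurable_EFin.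
  move=> x _ /=; rewrite lee_fin (le_trans (cnorm_Re _))// (le_trans (fg x))//.
  exact: ler_norm.
apply: (@le_integrable _ _ _ (@lebesgue_measure R) _ _ _ (EFin \o g)) => //.
  exact: measurable_EFin.
move=> x _ /=; rewrite lee_fin (le_trans (cnorm_Im _))// (le_trans (fg x))//.
exact: ler_norm.
Qed.

Lemma cI_W (f : R -> C) (c : R) : cM f -> (forall x, cnorm (f x) <= c * wt x) -> cI f.
Proof. by move=> mf fc; apply: (cI_dom mf _ fc); apply: rIZ; exact: rI_wt. Qed.

Lemma cI_D f g : cI f -> cI g -> cI (fun x => f x + g x).
Proof.
move=> [f1 f2] [g1 g2]; split.
  by under eq_fun do rewrite cReD; exact: rID.
by under eq_fun do rewrite cImD; exact: rID.
Qed.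

Lemma cintD f g : cI f -> cI g -> cint (fun x => f x + g x) = cint f + cint g.
Proof.
move=> [f1 f2] [g1 g2]; rewrite !cintE; apply: complex_eq; rewrite ?cReD ?cImD /=.
  by under eq_fun do rewrite cReD; exact: rintD.
by under eq_fun do rewrite cImD; exact: rintD.
Qed.

Lemma cI_Z c f : cI f -> cI (fun x => c * f x).
Proof.
move=> [f1 f2]; split.
  under eq_fun do rewrite cReM -mulNr; apply: rID; exact: rIZ.
under eq_fun do rewrite cImM; apply: rID; exact: rIZ.
Qed.

Lemma cintZ c f : cI f -> cint (fun x => c * f x) = c * cint f.
Proof.
move=> [f1 f2]; rewrite !cintE; apply: complex_eq; rewrite ?cReM ?cImM /=.
  under eq_fun do rewrite cReM -mulNr; rewrite rintD; try exact: rIZ.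
  by rewrite !rintZ// mulNr.
under eq_fun do rewrite cImM; rewrite rintD; try exact: rIZ.
by rewrite !rintZ.
Qed.

Lemma cI_N f : cI f -> cI (fun x => - f x).
Proof. by move=> fi; under eq_fun do rewrite -mulN1r; exact: cI_Z. Qed.

Lemma cintN f : cI f -> cint (fun x => - f x) = - cint f.
Proof. by move=> fi; under eq_cint do rewrite -mulN1r; rewrite cintZ// mulN1r. Qed.

Lemma cintB f g : cI f -> cI g -> cint (fun x => f x - g x) = cint f - cint g.
Proof. by move=> fi gi; rewrite cintD ?cintN//; exact: cI_N. Qed.

Lemma cint0 : cint (fun _ : R => 0 : C) = 0.
Proof. have h0 : cI (fun _ : R => 0 : C).
  by apply: (@cI_W _ 0) => [|x]; [exact: cM_cst|rewrite cnorm0 mul0r].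
by rewrite -[RHS](mul0r (cint (fun=> 0))) -cintZ//; apply: eq_cint => x; rewrite mul0r. Qed.

(** The factor [2] comes from bounding real and imaginary parts separately. *)
Lemma cint_le (f : R -> C) (g : R -> R) : cM f -> rI g ->
  (forall x, cnorm (f x) <= g x) -> cnorm (cint f) <= 2 * rint g.
Proof.
move=> mf ig fg; have [f1 f2] := cI_dom mf ig fg.
rewrite (le_trans (cnorm_leReIm _))//= -!/(rint _) mulrDl !mul1r lerD//.
  by apply: rint_bound => // x; rewrite (le_trans (cnorm_Re _)).
by apply: rint_bound => // x; rewrite (le_trans (cnorm_Im _)).
Qed.

Lemma cint_leW (f : R -> C) (c : R) : cM f -> (forall x, cnorm (f x) <= c * wt x) ->
  cnorm (cint f) <= 2 * c * rint wt.
Proof.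
move=> mf fc; rewrite (le_trans (cint_le mf (rIZ c rI_wt) fc))//.
by rewrite rintZ ?mulrA//; exact: rI_wt.
Qed.

Lemma cint_DCT (f_ : nat -> R -> C) (f : R -> C) (c : R) :
  (forall n, cM (f_ n)) -> cM f -> (forall x, ccvg (fun n => f_ n x) (f x)) ->
  (forall n x, cnorm (f_ n x) <= c * wt x) -> ccvg (fun n => cint (f_ n)) (cint f).
Proof.
move=> mf_ [f1 f2] cf fc; apply/ccvgP; split => /=.
  apply: (rint_DCT (g := fun x => c * wt x)) => //.
  - by move=> n; have [] := mf_ n.
  - by move=> x; have /ccvgP[] := cf x.
  - by apply: rIZ; exact: rI_wt.
  - by move=> n x; rewrite (le_trans (cnorm_Re _)).
apply: (rint_DCT (g := fun x => c * wt x)) => //.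
- by move=> n; have [] := mf_ n.
- by move=> x; have /ccvgP[] := cf x.
- by apply: rIZ; exact: rI_wt.
- by move=> n x; rewrite (le_trans (cnorm_Im _)).
Qed.

Lemma cint_affine (a b : R) (f : R -> C) : a != 0 -> cI f ->
  RtoC `|a| * cint (fun x => f (a * x + b)) = cint f.
Proof.
move=> a0 [f1 f2]; rewrite !cintE; apply: complex_eq; rewrite ?cReM ?cImM /=.
  by rewrite mul0r subr0 (rint_affine b a0 f1).
by rewrite mul0r addr0 (rint_affine b a0 f2).
Qed.

Lemma cI_affine (a b : R) (f : R -> C) : a != 0 -> cI f -> cI (fun x => f (a * x + b)).
Proof. by move=> a0 [f1 f2]; split; [exact: (rI_affine b a0 f1)|exact: (rI_affine b a0 f2)]. Qed.

Lemma cint_shift (b : R) (f : R -> C) : cI f -> cint (fun x => f (x + b)) = cint f.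
Proof.
move=> fi; rewrite -(@cint_affine 1 b f)// ?oner_eq0// normr1 mul1r.
by apply: eq_cint => x; rewrite mul1r.
Qed.

Lemma cI_shift (b : R) (f : R -> C) : cI f -> cI (fun x => f (x + b)).
Proof.
move=> fi; have := @cI_affine 1 b f; rewrite oner_eq0 => /(_ isT fi).
by under eq_fun do rewrite mul1r.
Qed.

Lemma cint_cconj (f : R -> C) : cI f -> cint (fun x => cconj (f x)) = cconj (cint f).
Proof.
move=> [f1 f2]; rewrite !cintE; apply: complex_eq => //=.
by rewrite -mulN1r -rintZ//; congr rint; apply/funext => x; rewrite mulN1r.
Qed.

Section Fubini.
Variable F : R -> R -> C.
Hypothesis mF : cM (fun z : R * R => F z.1 z.2).
Variable c : R.
Hypothesis Fc : forall x y, cnorm (F x y) <= c * (wt x * wt y).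

Let FRe (z : R * R) := Re (F z.1 z.2).
Let FIm (z : R * R) := Im (F z.1 z.2).
Let FReC x y : `|FRe (x, y)| <= c * (wt x * wt y).
Proof. by rewrite (le_trans (cnorm_Re _)). Qed.
Let FImC x y : `|FIm (x, y)| <= c * (wt x * wt y).
Proof. by rewrite (le_trans (cnorm_Im _)). Qed.

Lemma cint_Fubini :
  cint (fun x => cint (fun y => F x y)) = cint (fun y => cint (fun x => F x y)).
Proof.
have [m1 m2] := mF; apply: complex_eq => /=.
  exact: (@rint_Fubini R FRe m1 c FReC).
exact: (@rint_Fubini R FIm m2 c FImC).
Qed.

Lemma cM_cint_fst : cM (fun x => cint (fun y => F x y)).
Proof.
have [m1 m2] := mF; split => /=.
  exact: (@measurable_rint_fst R FRe m1 c FReC).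
exact: (@measurable_rint_fst R FIm m2 c FImC).
Qed.

Lemma cM_cint_snd : cM (fun y => cint (fun x => F x y)).
Proof.
have [m1 m2] := mF; split => /=.
  exact: (@measurable_rint_snd R FRe m1 c FReC).
exact: (@measurable_rint_snd R FIm m2 c FImC).
Qed.
End Fubini.

End ComplexIntegrals.

(** * Smooth functions *)

Section SmoothFunctions.
Context {R : realType}.
Local Notation C := R[i].
Local Notation Re := complex.Re.
Local Notation Im := complex.Im.

Definition ci : C := Complex 0 1.

Lemma cnorm_ci : cnorm ci = 1.
Proof. by rewrite /cnorm /ci /= expr0n expr1n add0r sqrtr1. Qed.

(** A relation rather than the operator [cderiv]: a derivative comes together with the proof that it
    exists, so the rules of calculus need no side conditions. *)
Definition hasd (f g : R -> C) := forall x : R,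
  is_derive x 1 (fun y => Re (f y)) (Re (g x)) /\
  is_derive x 1 (fun y => Im (f y)) (Im (g x)).

Lemma hasd_eq (f f' g g' : R -> C) : f =1 f' -> g =1 g' -> hasd f g -> hasd f' g'.
Proof. by move=> /funext <- /funext <-. Qed.

Lemma hasd_cst (c : C) : hasd (fun=> c) (fun=> 0).
Proof. by move=> x; split; exact: is_derive_cst. Qed.

Lemma hasd_D f f' g g' : hasd f f' -> hasd g g' ->
  hasd (fun x => f x + g x) (fun x => f' x + g' x).
Proof.
move=> hf hg x; have [f1 f2] := hf x; have [g1 g2] := hg x; split.
  by under eq_fun do rewrite cReD; rewrite cReD; exact: is_deriveD.
by under eq_fun do rewrite cImD; rewrite cImD; exact: is_deriveD.
Qed.

Lemma hasd_M f f' g g' : hasd f f' -> hasd g g' ->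
  hasd (fun x => f x * g x) (fun x => f' x * g x + f x * g' x).
Proof.
move=> hf hg x; have [f1 f2] := hf x; have [g1 g2] := hg x; split.
  under eq_fun do rewrite cReM.
  apply: is_derive_eq; rewrite !ReImE /GRing.scale /=; ring.
under eq_fun do rewrite cImM.
apply: is_derive_eq; rewrite !ReImE /GRing.scale /=; ring.
Qed.

Lemma hasd_Z c f f' : hasd f f' -> hasd (fun x => c * f x) (fun x => c * f' x).
Proof.
move=> hf; apply: (hasd_eq _ _ (hasd_M (hasd_cst c) hf)) => // x.
by rewrite mul0r add0r.
Qed.

Lemma hasd_RtoC (f f' : R -> R) : (forall x : R, is_derive x 1 f (f' x)) ->
  hasd (fun x => RtoC (f x)) (fun x => RtoC (f' x)).
Proof. by move=> hf x; split => //=; exact: is_derive_cst. Qed.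

Lemma hasd_affine (a b : R) f f' : hasd f f' ->
  hasd (fun x => f (a * x + b)) (fun x => RtoC a * f' (a * x + b)).
Proof.
move=> hf x; have [f1 f2] := hf (a * x + b).
have h : is_derive x 1 (fun x => a * x + b) a.
  by apply: is_derive_eq; rewrite /GRing.scale /= mulr1 addr0.
rewrite !ReImE /= !mul0r subr0 addr0; split; rewrite (mulrC a (_ (f' _))).
  exact: (@is_derive1_comp R (fun y => Re (f y)) (fun x => a * x + b) x _ _ f1 h).
exact: (@is_derive1_comp R (fun y => Im (f y)) (fun x => a * x + b) x _ _ f2 h).
Qed.

Lemma hasd_cconj f f' : hasd f f' -> hasd (fun x => cconj (f x)) (fun x => cconj (f' x)).
Proof. by move=> hf x; have [f1 f2] := hf x; split => //=; exact: is_deriveN. Qed.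

Lemma hasd_cexpi : hasd (@cexpi R) (fun x => ci * cexpi x).
Proof.
move=> x; split => /=; rewrite !(mul0r, mul1r, add0r, addr0, sub0r).
  exact: is_derive_cos.
exact: is_derive_sin.
Qed.

Lemma hasd_cexpi_lin (a : R) :
  hasd (fun x => cexpi (a * x)) (fun x => RtoC a * ci * cexpi (a * x)).
Proof.
by apply: (hasd_eq _ _ (hasd_affine a 0 hasd_cexpi)) => x; rewrite addr0// mulrA.
Qed.

Lemma hasd_expR (a : R) :
  hasd (fun x => RtoC (expR (a * x))) (fun x => RtoC a * RtoC (expR (a * x))).
Proof.
have h : hasd (fun x => RtoC (expR x)) (fun x => RtoC (expR x)).
  by apply: hasd_RtoC => x; exact: is_derive_expR.
by apply: (hasd_eq _ _ (hasd_affine a 0 h)) => x; rewrite addr0.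
Qed.

Lemma hasd_id : hasd (@RtoC R) (fun=> 1).
Proof. by apply: (hasd_RtoC (f := id) (f' := fun=> 1)) => x; exact: is_derive_id. Qed.

Lemma hasd_derivable f f' : hasd f f' -> forall x,
  derivable (fun y => Re (f y)) x 1 /\ derivable (fun y => Im (f y)) x 1.
Proof. by move=> hf x; have [[? _] [? _]] := hf x. Qed.

Lemma hasd_cderiv f f' : hasd f f' -> cderiv f = f'.
Proof.
move=> hf; apply/funext => x; have [f1 f2] := hf x.
by apply: complex_eq; rewrite /cderiv /= derive1E derive_val.
Qed.

Lemma hasd_continuous f f' : hasd f f' ->
  continuous (fun x => Re (f x)) /\ continuous (fun x => Im (f x)).
Proof.
by move=> /hasd_derivable hf; split => x;
  apply/differentiable_continuous/derivable1_diffP; have [] := hf x.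
Qed.

Lemma hasd_cM f f' : hasd f f' -> cM f.
Proof. by move=> /hasd_continuous[? ?]; exact: cM_continuous. Qed.

(** A chain of [n] successive derivatives given as witnesses: closure under products, affine
    substitution and conjugation is then an induction on [n]. [csmoothE] relates it to [csmooth]. *)
Fixpoint Cn (n : nat) (f : R -> C) : Prop :=
  match n with 0%N => True | n'.+1 => exists2 g, hasd f g & Cn n' g end.

Lemma CnS n f : Cn n.+1 f -> Cn n f.
Proof.
elim: n f => //= n IH f [g fg gn]; exists g => //; exact: IH.
Qed.

Lemma Cn_eq n f g : f =1 g -> Cn n f -> Cn n g.
Proof. by move=> /funext ->. Qed.

Lemma Cn_cst n c : Cn n (fun=> c).
Proof. elim: n c => //= n IH c; exists (fun=> 0) => //; exact: hasd_cst. Qed.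

Lemma Cn_D n f g : Cn n f -> Cn n g -> Cn n (fun x => f x + g x).
Proof.
elim: n f g => //= n IH f g [f' hf Cf] [g' hg Cg].
by exists (fun x => f' x + g' x); [exact: hasd_D|exact: IH].
Qed.

Lemma Cn_M n f g : Cn n f -> Cn n g -> Cn n (fun x => f x * g x).
Proof.
elim: n f g => // n IH f g Cf Cg.
have [f' hf Cf'] := Cf; have [g' hg Cg'] := Cg.
exists (fun x => f' x * g x + f x * g' x); first exact: hasd_M.
by apply: Cn_D; apply: IH => //; exact: CnS.
Qed.

Lemma Cn_affine n a b f : Cn n f -> Cn n (fun x => f (a * x + b)).
Proof.
elim: n f => //= n IH f [f' hf Cf].
exists (fun x => RtoC a * f' (a * x + b)); first exact: hasd_affine.
by apply: Cn_M; [exact: Cn_cst|exact: IH].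
Qed.

Lemma Cn_cconj n f : Cn n f -> Cn n (fun x => cconj (f x)).
Proof.
elim: n f => //= n IH f [f' hf Cf].
by exists (fun x => cconj (f' x)); [exact: hasd_cconj|exact: IH].
Qed.

Definition smooth f := forall n, Cn n f.

Lemma smoothP f : smooth f <-> exists2 f', hasd f f' & smooth f'.
Proof.
split=> [sf|[f' hf sf'] [|n]]; last 2 first.
- by [].
- by exists f'.
have [f' hf _] := sf 1%N; exists f' => // n.
have [g hg Cg] := sf n.+1.
(* Derivatives are unique, so the witnesses obtained at different orders coincide. *)
by rewrite -(hasd_cderiv hf) (hasd_cderiv hg).
Qed.

Lemma smooth_eq f g : f =1 g -> smooth f -> smooth g.
Proof. by move=> /funext ->. Qed.
Lemma smooth_cst c : smooth (fun=> c).
Proof. by move=> n; exact: Cn_cst. Qed.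
Lemma smooth_D f g : smooth f -> smooth g -> smooth (fun x => f x + g x).
Proof. by move=> sf sg n; exact: Cn_D. Qed.
Lemma smooth_M f g : smooth f -> smooth g -> smooth (fun x => f x * g x).
Proof. by move=> sf sg n; exact: Cn_M. Qed.
Lemma smooth_affine a b f : smooth f -> smooth (fun x => f (a * x + b)).
Proof. by move=> sf n; exact: Cn_affine. Qed.
Lemma smooth_cconj f : smooth f -> smooth (fun x => cconj (f x)).
Proof. by move=> sf n; exact: Cn_cconj. Qed.
Lemma smooth_id : smooth (@RtoC R).
Proof. by apply/smoothP; exists (fun=> 1); [exact: hasd_id|exact: smooth_cst]. Qed.
Lemma smooth_cexpi a : smooth (fun x => cexpi (a * x)).
Proof.
move=> n; elim: n => // n IH; exists (fun x => RtoC a * ci * cexpi (a * x)).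
  exact: hasd_cexpi_lin.
by apply: Cn_M => //; exact: Cn_cst.
Qed.

Lemma smooth_cM f : smooth f -> cM f.
Proof. by move=> /smoothP[f' /hasd_cM]. Qed.

Lemma cderivnS n (f : R -> C) : cderivn n.+1 f = cderivn n (cderiv f).
Proof. by elim: n => //= n <-. Qed.

Lemma csmoothE f : csmooth f <-> smooth f.
Proof.
split=> [sf n|sf n x].
  elim: n f sf => // n IH f sf; exists (cderiv f).
    move=> x; have [d1 d2] := sf 0%N x.
    by split; apply: DeriveDef => //=; rewrite derive1E.
  by apply: IH => m x; rewrite -cderivnS; exact: sf.
have {}sf := sf n.+1.
elim: n f sf => [|n IH] f [f' hf Cf]; first exact: (hasd_derivable hf x).
by rewrite cderivnS (hasd_cderiv hf); exact: IH.
Qed.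

Lemma hasd_inv_line (a : R) : 0 < a ->
  hasd (fun t => (Complex a t)^-1) (fun t => - ci * ((Complex a t)^-1 * (Complex a t)^-1)).
Proof.
move=> a0.
have d0 (x : R) : a ^+ 2 + x ^+ 2 != 0.
  by rewrite gt_eqF// ltr_pwDl ?sqr_ge0// exprn_gt0.
have dd (x : R) : is_derive x 1 (fun t => (a ^+ 2 + t ^+ 2)^-1) (- (2 * x) / (a ^+ 2 + x ^+ 2) ^+ 2).
  have h : is_derive x 1 (fun t => a ^+ 2 + t ^+ 2) (2 * x).
    apply: is_derive_eq; rewrite /GRing.scale /=; ring.
  have [h1 h2] := h.
  apply: DeriveDef; first exact: derivableV.
  by rewrite deriveV// h2 /GRing.scale /= mulNr mulrC mulNr.
have e (t : R) : (Complex a t)^-1 = Complex (a * (a ^+ 2 + t ^+ 2)^-1) (- (t * (a ^+ 2 + t ^+ 2)^-1)).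
  by apply: complex_eq => /=; rewrite ?mulNr.
move=> x; split.
  under eq_fun do rewrite e /=.
  rewrite e; apply: is_derive_eq; rewrite !ReImE /GRing.scale /=.
  by field; exact: d0.
under eq_fun do rewrite e /=.
rewrite e; apply: is_derive_eq; rewrite !ReImE /GRing.scale /=.
by field; exact: d0.
Qed.

(** Allows test functions to be divided by the factor [s] restricted to the line of convergence. *)
Lemma smooth_inv_line (a : R) : 0 < a -> smooth (fun t => (Complex a t)^-1).
Proof.
move=> a0 n; elim: n => // n IH.
exists (fun t => - ci * ((Complex a t)^-1 * (Complex a t)^-1)); first exact: hasd_inv_line.
by apply: Cn_M; [exact: Cn_cst|exact: Cn_M].
Qed.

End SmoothFunctions.

(** * Smooth functions of compact support *)

Section Bump.
Context {R : realType}.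
Local Notation C := R[i].

(** The powers of [x^-1] are included so that the family is stable: the derivative of one member is
    a combination of two others, and smoothness follows for all of them at once. *)
Definition flat (k : nat) (x : R) : R :=
  if 0 < x then x^-1 ^+ k * expR (- x^-1) else 0.

(** For positive [m], raise [u / m <= expR (u / m)] to the power [m]. *)
Lemma exprn_le_expR (m : nat) : exists2 c : R, 0 <= c & forall u : R, 0 < u -> u ^+ m <= c * expR u.
Proof.
case: m => [|m].
  by exists 1 => // u u0; rewrite expr0 mul1r (le_trans _ (expR_ge1Dx _))// lerDl ltW.
exists (m.+1%:R ^+ m.+1); first by rewrite exprn_ge0.
move=> u u0; rewrite -ler_pdivrMl ?exprn_gt0// -exprVn -exprMn.
rewrite -[X in expR X](@mulVKf _ m.+1%:R)// ?pnatr_eq0//.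
rewrite expRM_natl ler_pXn2r ?nnegrE ?expR_ge0//; last by rewrite mulr_ge0 ?invr_ge0// ltW.
by rewrite (le_trans _ (expR_ge1Dx _))// lerDr.
Qed.

(** A quadratic bound makes the difference quotient at [0] tend to [0]; it is [exprn_le_expR] of
    order [k + 2] at [x^-1]. *)
Lemma flat_bound k : exists2 c, 0 <= c & forall x : R, `|flat k x| <= c * x ^+ 2.
Proof.
have [c c0 hc] := exprn_le_expR k.+2; exists c => // x.
rewrite /flat; case: ifPn => x0; last by rewrite normr0 mulr_ge0 ?sqr_ge0.
rewrite ger0_norm; last by rewrite mulr_ge0 ?expR_ge0// exprn_ge0// invr_ge0 ltW.
have u0 : 0 < x^-1 by rewrite invr_gt0.
rewrite -ler_pdivrMr ?exprn_gt0// expRN ler_pdivrMr ?exprn_gt0//.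
rewrite ler_pdivrMr ?expR_gt0//.
rewrite -mulrA [x ^+ 2 * _]mulrC mulrA -ler_pdivrMr ?exprn_gt0//.
rewrite (le_trans _ (hc _ u0))//.
by rewrite -[k.+2]addn2 exprD [X in _ <= _ * X]exprVn.
Qed.

Lemma is_derive_flat k (x : R) : is_derive x 1 (flat k) (flat k.+2 x - k%:R * flat k.+1 x).
Proof.
have [x0|x0|->] := ltgtP x 0.
- apply: (@near_eq_is_derive _ _ _ (cst 0)).
    near=> y; rewrite /flat ltNge ltW//=; near: y; exact: lt_nbhsl.
  rewrite /flat ltNge (ltW x0) /= mulr0 subr0; exact: is_derive_cst.
- apply: (@near_eq_is_derive _ _ _ (fun y : R => y^-1 ^+ k * expR (- y^-1))).
    near=> y; rewrite /flat ifT//; near: y; exact: lt_nbhsr.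
  have hV : is_derive x 1 (fun y : R => y^-1) (- x^-1 ^+ 2).
    apply: DeriveDef; first by apply: derivableV => //; rewrite gt_eqF.
    by rewrite deriveV ?gt_eqF// derive_id /GRing.scale /= mulr1 exprVn.
  rewrite /flat x0.
  have hE : is_derive x 1 (fun y => expR (- y^-1)) (x^-1 ^+ 2 * expR (- x^-1)).
    rewrite mulrC; apply: is_derive1_comp.
    by apply: is_derive_eq; rewrite opprK.
  have hP : is_derive x 1 (fun y : R => y^-1 ^+ k) (- (k%:R * x^-1 ^+ k.+1)).
    have := is_deriveX k hV; rewrite exprfctE.
    move/is_derive_eq; apply; rewrite /GRing.scale /=.
    by case: (k) => [|j]; rewrite /= ?mulr0n ?exprS; ring.
  apply: is_derive_eq; rewrite /GRing.scale /= !exprS; ring.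
have f0 j : flat j 0 = 0 by rewrite /flat ltxx.
rewrite !f0 mulr0 subr0.
have [c c0 hc] := flat_bound k.
have cv : h^-1 *: (flat k (h *: 1 + 0) - flat k 0) @[h --> 0^'] --> (0 : R).
  apply/norm_cvg0P.
  have hb : c * `|h| @[h --> (0:R)^'] --> (0 : R).
    rewrite -[0 in X in _ --> X](mulr0 c); apply: cvgM; first exact: cvg_cst.
    rewrite -[0 in X in _ --> X](@normr0 R R); apply: cvg_norm.
    by apply: cvg_within.
  apply: (squeeze_cvgr _ _ hb); last exact: cvg_cst.
  near=> h; rewrite normr_ge0 /= f0 subr0 addr0 /GRing.scale /= mulr1 normrM.
  have h0 : h != 0 by near: h; exact: nbhs_dnbhs_neq.
  rewrite normfV ler_pdivrMl ?normr_gt0// (le_trans (hc h))//.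
  by rewrite [leRHS]mulrCA -normrM -expr2 ger0_norm ?sqr_ge0.
apply: DeriveDef; first by apply/cvg_ex; exists 0.
exact/cvg_lim.
Unshelve. all: by end_near.
Qed.

Lemma smooth_flat k : smooth (fun x => RtoC (flat k x)).
Proof.
move=> n; elim: n k => // n IH k.
exists (fun x => RtoC (flat k.+2 x - k%:R * flat k.+1 x)).
  by apply: hasd_RtoC => x; exact: is_derive_flat.
apply: (@Cn_eq _ _ (fun x => RtoC (flat k.+2 x) + RtoC (- k%:R) * RtoC (flat k.+1 x))).
  by move=> x; rewrite -RtoCM -RtoCD mulNr.
by apply: Cn_D => //; apply: Cn_M => //; exact: Cn_cst.
Qed.

Definition mollifier (x : R) : R := flat 0 (1 + x) * flat 0 (1 - x).

Lemma flat0_ge0 x : 0 <= flat 0 x.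
Proof. by rewrite /flat; case: ifP => // _; rewrite expr0 mul1r expR_ge0. Qed.

Lemma flat0_gt0 x : 0 < x -> 0 < flat 0 x.
Proof. by rewrite /flat => ->; rewrite expr0 mul1r expR_gt0. Qed.

Lemma mollifier0_gt0 : 0 < mollifier 0.
Proof. by rewrite mulr_gt0 ?flat0_gt0 ?addr0 ?subr0. Qed.

Lemma mollifier_eq0 x : 1 <= `|x| -> mollifier x = 0.
Proof.
rewrite ler_normr => /orP[x1|x1]; rewrite /mollifier /flat.
  by rewrite [X in _ * (if X then _ else _)]ltNge subr_le0 x1 mulr0.
by rewrite ltNge (_ : 1 + x <= 0) ?mul0r// -(opprK x) subr_le0.
Qed.

Lemma smooth_mollifier : smooth (fun x => RtoC (mollifier x)).
Proof.
apply: (@smooth_eq _ (fun x => RtoC (flat 0 (1 * x + 1)) * RtoC (flat 0 (-1 * x + 1)))).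
  by move=> x; rewrite -RtoCM /mollifier mul1r mulN1r ![_ + 1]addrC.
by apply: smooth_M; apply: (smooth_affine _ _ (smooth_flat 0)).
Qed.

End Bump.

(** * Test functions and integration over intervals *)

Section TestFunctions.
Context {R : realType}.
Local Notation C := R[i].
Local Notation Re := complex.Re.
Local Notation Im := complex.Im.
Local Notation mu := (@lebesgue_measure R).

Definition cW (f : R -> C) := cM f /\ exists c : R, forall x, cnorm (f x) <= c * wt x.

Lemma cW_cI f : cW f -> cI f.
Proof. by move=> [mf [c fc]]; exact: (cI_W mf fc). Qed.

Lemma wt_bound_ge0 (f : R -> C) c : (forall x, cnorm (f x) <= c * wt x) -> 0 <= c.
Proof.
move=> /(_ 0) h; rewrite -(pmulr_lge0 _ (wt_gt0 0)).
exact: le_trans (cnorm_ge0 _) h.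
Qed.

Lemma cW_bounded f c : (forall x : R, cnorm (f x) <= c * wt x) -> forall x, cnorm (f x) <= c.
Proof.
move=> fc x; rewrite (le_trans (fc x))// ler_piMr ?wt_le1//.
exact: wt_bound_ge0 fc.
Qed.

Lemma cW_bM (b : R) f g : cM g -> (forall x, cnorm (g x) <= b) -> cW f ->
  cW (fun x => g x * f x).
Proof.
move=> mg gb [mf [c fc]]; split; first exact: cM_M.
exists (b * c) => x; rewrite cnormM -mulrA ler_pM ?cnorm_ge0//.
Qed.

Lemma cW_Z a f : cW f -> cW (fun x => a * f x).
Proof. by apply: cW_bM => //; exact: cM_cst. Qed.

Lemma bounded_of_support (h : R -> R) (a : R) : continuous h ->
  (forall x, a <= `|x| -> h x = 0) -> exists M : R, forall x, `|h x| <= M.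
Proof.
move=> ch h0; have [a0|a0] := ltP a 0.
  by exists 0 => x; rewrite h0 ?normr0// (le_trans (ltW a0)).
have aa : - a <= a by rewrite ge0_cp.
have ch' : {within `[- a, a], continuous (fun x => `|h x|)}.
  apply: continuous_subspaceT => x; apply: cvg_norm; exact: ch.
have [m _ hm] := EVT_max aa ch'.
exists `|h m| => x; have [xa|xa] := leP a `|x|; first by rewrite h0 ?normr0.
by apply: hm; rewrite in_itv /= -ler_norml ltW.
Qed.

Definition Tf (f : R -> C) := smooth f /\ exists a : R, forall x, a <= `|x| -> f x = 0.

Lemma wt_ge (a x : R) : `|x| <= a -> (1 + a ^+ 2)^-1 <= wt x.
Proof.
move=> xa; rewrite /wt lef_pV2 ?posrE ?ltr_pwDl ?sqr_ge0// lerD2l.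
rewrite -(@real_normK _ x) ?num_real// ler_pXn2r ?nnegrE//.
exact: le_trans xa.
Qed.

Lemma support_wt (f : R -> C) (a M : R) : (forall x, a <= `|x| -> f x = 0) ->
  (forall x, cnorm (f x) <= M) -> forall x, cnorm (f x) <= M * (1 + a ^+ 2) * wt x.
Proof.
move=> f0 fM x.
have M0 : 0 <= M by exact: le_trans (cnorm_ge0 _) (fM 0).
have a0 : 0 < 1 + a ^+ 2 by rewrite ltr_pwDl ?sqr_ge0.
have [xa|xa] := leP a `|x|.
  by rewrite f0// cnorm0 !mulr_ge0 ?wt_ge0// ltW.
rewrite (le_trans (fM x))// -mulrA ler_peMr// -ler_pdivrMl// mulr1.
exact/wt_ge/ltW.
Qed.

Lemma Tf_cW f : Tf f -> cW f.
Proof.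
move=> [sf [a f0]]; split; first exact: smooth_cM.
have /smoothP[f' /hasd_continuous[c1 c2] _] := sf.
have z1 x : a <= `|x| -> Re (f x) = 0 by move=> /f0 ->.
have z2 x : a <= `|x| -> Im (f x) = 0 by move=> /f0 ->.
have [M1 h1] := bounded_of_support c1 z1.
have [M2 h2] := bounded_of_support c2 z2.
exists ((M1 + M2) * (1 + a ^+ 2)); apply: support_wt => // x.
by rewrite (le_trans (cnorm_leReIm _))// lerD.
Qed.

Lemma Tf_cI f : Tf f -> cI f.
Proof. by move=> /Tf_cW/cW_cI. Qed.

Lemma Tf_cM f : Tf f -> cM f.
Proof. by move=> /Tf_cW[]. Qed.

Lemma hasd_support f f' (a : R) : hasd f f' -> (forall x, a <= `|x| -> f x = 0) ->
  forall x, a < `|x| -> f' x = 0.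
Proof.
move=> hf f0 x ax.
have h : \forall y \near x, f y = 0.
  near=> y; apply: f0; near: y.
  have /= := @norm_continuous _ _ x.
  move=> /(_ [set z | a <= z]); apply.
  by apply: filterS (lt_nbhsr ax) => z /ltW.
have [f1 f2] := hf x.
have r1 : is_derive x 1 (fun y => Re (f y)) 0.
  have hn : \near x, (0 : R) = Re (f x) by apply: filterS h => y ->.
  exact: (near_eq_is_derive hn (is_derive_cst (0 : R) x (1 : R))).
have r2 : is_derive x 1 (fun y => Im (f y)) 0.
  have hn : \near x, (0 : R) = Im (f x) by apply: filterS h => y ->.
  exact: (near_eq_is_derive hn (is_derive_cst (0 : R) x (1 : R))).
apply: complex_eq => /=.
  by case: f1 => _ <-; case: r1.
by case: f2 => _ <-; case: r2.
Unshelve. all: by end_near.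
Qed.

Lemma Tf_derive f : Tf f -> exists2 f', hasd f f' & Tf f'.
Proof.
move=> [/smoothP[f' hf sf'] [a f0]]; exists f' => //; split => //.
(* The derivative is known to vanish only for [a < |x|], strictly, hence the larger radius. *)
exists (a + 1) => x ax; apply: (hasd_support hf f0).
by rewrite (lt_le_trans _ ax)// ltrDl.
Qed.

Lemma Tf_M (f g : R -> C) : smooth g -> Tf f -> Tf (fun x => g x * f x).
Proof.
move=> sg [sf [a f0]]; split; first exact: smooth_M.
by exists a => x /f0 ->; rewrite mulr0.
Qed.

Lemma Tf_affine (a b : R) f : a != 0 -> Tf f -> Tf (fun x => f (a * x + b)).
Proof.
move=> a0 [sf [c f0]]; split; first exact: smooth_affine.
exists ((c + `|b|) / `|a|) => x; rewrite ler_pdivrMr ?normr_gt0// => h.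
apply: f0; rewrite -(lerD2r `|b|) (le_trans h)// mulrC -normrM.
by rewrite -[X in `|X| <= _](addrK b) (le_trans (ler_normB _ _)).
Qed.

Lemma Tf_test f : Tf f <-> test_fun setT f.
Proof.
split=> [[sf [a f0]]|[/csmoothE sf [K [cK _ f0]]]].
  split; first exact/csmoothE.
  exists `[- a, a]%classic; split => //; first exact: segment_compact.
  move=> x; rewrite /= in_itv /= -ler_norml => /negP; rewrite -ltNge => h.
  by apply: f0; exact: ltW.
split => //; have [M [Mr KM]] := compact_bounded cK.
exists (M + 2) => x ax; apply: f0 => Kx.
have /= := KM (M + 1) _ x Kx; rewrite ltrDl ltr01 => /(_ isT) h.
by have := le_trans ax h; lra.
Qed.

(** Integrals over intervals are written as integrals over the line with this factor, so that a
    single set of integration lemmas serves; half-open intervals concatenate without overlap. *)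
Definition chi (p q u : R) : R := ((p < u) && (u <= q))%:R.

Lemma chiE p q : chi p q = \1_(`]p, q]).
Proof.
apply/funext => u; rewrite indicE /chi.
by congr (nat_of_bool _)%:R; apply/idP/idP; rewrite inE /= in_itv.
Qed.

Lemma measurable_chi p q : measurable_fun setT (chi p q).
Proof. by rewrite chiE; exact: measurable_indic. Qed.

Lemma rint_chi_FTC (F f : R -> R) p q : p <= q ->
  (forall x : R, is_derive x 1 F (f x)) -> continuous f ->
  rint (fun u => chi p q u * f u) = F q - F p.
Proof.
move=> pq hF cf; move: pq; rewrite le_eqVlt => /orP[/eqP <-|pq].
  rewrite subrr -[RHS](mul0r (rint (@wt R))) -rintZ; last exact: rI_wt.
  congr rint; apply/funext => u; rewrite /chi mul0r.
  by case: ltP => [pu|pu] /=; rewrite ?mul0r// leNgt pu mul0r.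
have -> : rint (fun u => chi p q u * f u) = Rintegral mu `]p, q] f.
  rewrite Rintegral_mkcond /rint; congr Rintegral; apply/funext => u.
  rewrite /chi patchE; case: ifPn => h.
    by move: h; rewrite inE /= in_itv /= => ->; rewrite mul1r.
  by rewrite (_ : (p < u) && _ = false) ?mul0r//; apply/negbTE; apply: contra h; rewrite inE /= in_itv.
have cfw : {within `[p, q], continuous f} by exact: continuous_subspaceT.
have mf : measurable_fun `]p, q] f.
  by apply: measurable_funTS; exact: continuous_measurable_fun.
rewrite Rintegral_itv_obnd_cbnd//; last first.
  apply: (@integrableS _ _ _ mu `[p, q]) => //; first exact: subset_itv_oc_cc.
  apply: continuous_compact_integrable => //; exact: segment_compact.
rewrite /Rintegral (@continuous_FTC2 _ f F)//.
  have cF : continuous F.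
    move=> x; apply/differentiable_continuous/derivable1_diffP.
    by have [] := hF x.
  split.
  - by move=> x _; have [] := hF x.
  - exact/cvg_at_right_filter/cF.
  - exact/cvg_at_left_filter/cF.
by move=> x _; rewrite derive1E; have [] := hF x.
Qed.

(** Differentiability of [f] is the form in which its continuity is supplied. *)
Lemma cint_chi_FTC (F f g : R -> C) p q : p <= q -> hasd F f -> hasd f g ->
  cint (fun u => RtoC (chi p q u) * f u) = F q - F p.
Proof.
move=> pq hF hf; have [c1 c2] := hasd_continuous hf.
rewrite cintE; apply: complex_eq; rewrite ?ReImE /=.
  have <- := rint_chi_FTC pq (fun x => (hF x).1) c1.
  by congr rint; apply/funext => u; rewrite ReImE /= mul0r subr0.
have <- := rint_chi_FTC pq (fun x => (hF x).2) c2.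
by congr rint; apply/funext => u; rewrite ReImE /= mul0r addr0.
Qed.

Lemma cint_derive0 f f' : Tf f -> hasd f f' -> cint f' = 0.
Proof.
move=> [sf [a f0]] hf.
have [g hg] : exists g, hasd f' g.
  have /smoothP[h hh /smoothP[g hg _]] := sf.
  by exists g; rewrite -(hasd_cderiv hf) (hasd_cderiv hh).
pose b := `|a| + 1.
have b0 : 0 <= b by rewrite addr_ge0.
have -> : f' = fun u => RtoC (chi (- b) b u) * f' u.
  apply/funext => u; rewrite /chi; case: (boolP (_ && _)) => h /=.
    by rewrite RtoC1 mul1r.
  rewrite RtoC0 mul0r; apply: (hasd_support hf f0).
  have : b <= `|u|.
    rewrite leNgt; apply: contra h; rewrite ltr_norml => /andP[-> /ltW ->//].
  by apply: lt_le_trans; rewrite /b (le_lt_trans (ler_norm a))// ltrDl.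
rewrite (cint_chi_FTC _ hf hg) ?ge0_cp//.
by rewrite !f0 ?subr0// ?normrN (ger0_norm b0) (le_trans (ler_norm a))// lerDl.
Qed.

Lemma hasd_under_integral (k k' : R -> R -> C) (c : R) :
  (forall t, cM (k t)) -> (forall t x, cnorm (k t x) <= c * wt x) ->
  (forall x, hasd (k^~ x) (k'^~ x)) -> (forall t x, cnorm (k' t x) <= c * wt x) ->
  hasd (fun t => cint (k t)) (fun t => cint (k' t)).
Proof.
move=> mk kc hk kc' t.
have It : `]t - 1, t + 1[%classic t by rewrite /= in_itv /= gtrBl ltrDl ltr01.
have igw : mu.-integrable setT (EFin \o (fun x : R => c * wt x)).
  by have := rIZ c (@rI_wt R).
have c0 x : 0 <= c * wt x by exact: le_trans (cnorm_ge0 _) (kc 0 x).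
have ki s : cI (k s) by apply: cI_W; [exact: mk|exact: kc].
split => /=.
  have d1 s x : derivable (fun u => Re (k u x)) s 1 by have [[]] := hk x s.
  have e1 s x : partial1of2 (fun u x => Re (k u x)) s x = Re (k' s x).
    by rewrite partial1of2E; have [[]] := hk x s.
  have bd s x : `]t - 1, t + 1[%classic s -> setT x ->
      `|partial1of2 (fun u x => Re (k u x)) s x| <= c * wt x.
    by move=> _ _; rewrite e1 (le_trans (cnorm_Re _)).
  have dd := @derivable_under_integral R _ _ mu (fun s x => Re (k s x)) setT measurableT t _ _ It
    (fun s _ => (ki s).1) (fun s x _ _ => d1 s x) _ c0 igw bd.
  have ee := @differentiation_under_integral R _ _ mu (fun s x => Re (k s x)) setT measurableT t _ _ It
    (fun s _ => (ki s).1) (fun s x _ _ => d1 s x) _ c0 igw bd.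
  apply: DeriveDef => //; rewrite -derive1E ee.
  by congr Rintegral; apply/funext => x; exact: e1.
have d1 s x : derivable (fun u => Im (k u x)) s 1 by have [_ []] := hk x s.
have e1 s x : partial1of2 (fun u x => Im (k u x)) s x = Im (k' s x).
  by rewrite partial1of2E; have [_ []] := hk x s.
have bd s x : `]t - 1, t + 1[%classic s -> setT x ->
    `|partial1of2 (fun u x => Im (k u x)) s x| <= c * wt x.
  by move=> _ _; rewrite e1 (le_trans (cnorm_Im _)).
have dd := @derivable_under_integral R _ _ mu (fun s x => Im (k s x)) setT measurableT t _ _ It
  (fun s _ => (ki s).2) (fun s x _ _ => d1 s x) _ c0 igw bd.
have ee := @differentiation_under_integral R _ _ mu (fun s x => Im (k s x)) setT measurableT t _ _ It
  (fun s _ => (ki s).2) (fun s x _ _ => d1 s x) _ c0 igw bd.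
apply: DeriveDef => //; rewrite -derive1E ee.
by congr Rintegral; apply/funext => x; exact: e1.
Qed.

End TestFunctions.

(** * Fourier transforms of test functions *)

Section FourierBasics.
Context {R : realType}.
Local Notation C := R[i].
Local Notation Re := complex.Re.
Local Notation Im := complex.Im.
Local Notation W := (rint (@wt R)).

Lemma cM_ker (t : R) : cM (fun x : R => cexpi (- (t * x))).
Proof. by apply: cM_cexpi; apply: measurableT_comp => //; exact: measurable_funM. Qed.

Lemma cM_fourier_integrand (t : R) (f : R -> C) : cM f -> cM (fun x : R => cexpi (- (t * x)) * f x).
Proof. by move=> mf; apply: cM_M => //; exact: cM_ker. Qed.

Lemma cnorm_cexpiM (x : R) z : cnorm (cexpi x * z) = cnorm z.
Proof. by rewrite cnormM cnorm_cexpi mul1r. Qed.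

Lemma cI_fourier t (f : R -> C) : cW f -> cI (fun x => cexpi (- (t * x)) * f x).
Proof.
move=> [mf [c fc]]; apply: (@cI_W _ _ c); first exact: cM_fourier_integrand.
by move=> x; rewrite cnorm_cexpiM.
Qed.

Lemma fourier_le (f : R -> C) c t : cM f -> (forall x, cnorm (f x) <= c * wt x) ->
  cnorm (fourier f t) <= 2 * c * W.
Proof.
move=> mf fc; apply: cint_leW; first exact: cM_fourier_integrand.
by move=> x; rewrite cnorm_cexpiM.
Qed.

Lemma fourier_Z a (f : R -> C) t : cW f -> fourier (fun x => a * f x) t = a * fourier f t.
Proof.
move=> fW; rewrite /fourier -cintZ; last exact: cI_fourier.
by apply: eq_cint => x; rewrite mulrCA.
Qed.

Lemma fourier_D (f g : R -> C) t : cW f -> cW g ->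
  fourier (fun x => f x + g x) t = fourier f t + fourier g t.
Proof.
move=> fW gW; rewrite /fourier -cintD; try exact: cI_fourier.
by apply: eq_cint => x; rewrite mulrDr.
Qed.

Lemma fourier_modulate y (f : R -> C) x :
  fourier (fun t => cexpi (y * t) * f t) x = fourier f (x - y).
Proof.
rewrite /fourier; apply: eq_cint => t; rewrite mulrA -cexpiD.
by congr (cexpi _ * _); ring.
Qed.

Lemma fourier_affine (a b : R) (f : R -> C) x : a != 0 -> cW f ->
  fourier (fun t => f (a * t + b)) x =
  RtoC `|a|^-1 * cexpi (x * b / a) * fourier f (x / a).
Proof.
move=> a0 fW; pose g u := cexpi (x * b / a) * (cexpi (- (x / a * u)) * f u).
have gi : cI g by apply: cI_Z; exact: cI_fourier.
have na : RtoC `|a| != 0 by rewrite RtoC_eq0 normr_eq0.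
apply: (mulfI na); rewrite !mulrA -RtoCM mulfV ?normr_eq0// RtoC1 mul1r.
rewrite /fourier -[RHS]cintZ; last exact: cI_fourier.
rewrite -(cint_affine b a0 gi); congr (_ * _); apply: eq_cint => t.
rewrite /g mulrA -cexpiD; congr (cexpi _ * _); field; exact: a0.
Qed.

Lemma hasd_fourier (f : R -> C) c : cM f -> (forall x, cnorm (f x) <= c * wt x) ->
  (forall x, `|x| * cnorm (f x) <= c * wt x) ->
  hasd (fourier f) (fourier (fun x => - ci * RtoC x * f x)).
Proof.
move=> mf fc fxc.
apply: (@hasd_under_integral _ (fun t x => cexpi (- (t * x)) * f x)
  (fun t x => cexpi (- (t * x)) * (- ci * RtoC x * f x)) c).
- by move=> t; exact: cM_fourier_integrand.
- by move=> t x; rewrite cnorm_cexpiM.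
- move=> x.
  have h := hasd_M (hasd_cexpi_lin (- x)) (hasd_cst (f x)).
  apply: (hasd_eq _ _ h) => t; first by rewrite mulNr [x * t]mulrC.
  rewrite mulr0 addr0 !mulNr RtoCN (mulrC x t); ring.
- move=> t x; rewrite cnorm_cexpiM !cnormM cnormN cnorm_ci mul1r cnorm_RtoC.
  exact: fxc.
Qed.

Lemma hasd_fourier_Tf (f : R -> C) : Tf f ->
  hasd (fourier f) (fourier (fun x => - ci * RtoC x * f x)).
Proof.
move=> Tff; have [mf [c1 h1]] := Tf_cW Tff.
have [_ [c2 h2]] := Tf_cW (Tf_M smooth_id Tff).
apply: (@hasd_fourier _ (Num.max c1 c2)) => // x.
  by rewrite (le_trans (h1 x))// ler_wpM2r ?wt_ge0// le_max lexx.
by rewrite -cnorm_RtoC -cnormM (le_trans (h2 x))// ler_wpM2r ?wt_ge0// le_max lexx orbT.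
Qed.

Lemma Tf_mulX (f : R -> C) : Tf f -> Tf (fun x => - ci * RtoC x * f x).
Proof. by apply: Tf_M; apply: smooth_M; [exact: smooth_cst|exact: smooth_id]. Qed.

Lemma smooth_fourier (f : R -> C) : Tf f -> smooth (fourier f).
Proof.
move=> Tff n; elim: n f Tff => // n IH f Tff.
exists (fourier (fun x => - ci * RtoC x * f x)); first exact: hasd_fourier_Tf.
exact/IH/Tf_mulX.
Qed.

Lemma cM_fourier (f : R -> C) : Tf f -> cM (fourier f).
Proof. by move=> /smooth_fourier/smooth_cM. Qed.

(** The derivative of [exp(-itx) f(x)] has integral zero. *)
Lemma fourier_derive (f f' : R -> C) t : Tf f -> hasd f f' ->
  fourier f' t = ci * RtoC t * fourier f t.
Proof.
move=> Tff hf.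
have [g' hg Tg] := Tf_derive Tff.
have Tf' : Tf f' by rewrite -(hasd_cderiv hf) (hasd_cderiv hg).
have hE := hasd_M (hasd_cexpi_lin (- t)) hf.
have TE : Tf (fun x => cexpi (- t * x) * f x) by apply: Tf_M => //; exact: smooth_cexpi.
have := cint_derive0 TE hE.
have e1 : (fun x : R => RtoC (- t) * ci * cexpi (- t * x) * f x + cexpi (- t * x) * f' x)
  = (fun x => - (ci * RtoC t) * (cexpi (- (t * x)) * f x) + cexpi (- (t * x)) * f' x).
  apply/funext => x; rewrite RtoCN !mulNr; congr (_ + _); ring.
rewrite e1 cintD; last 2 first.
- by apply: cI_Z; apply: cI_fourier; exact: Tf_cW.
- by apply: cI_fourier; exact: Tf_cW.
rewrite cintZ; last by apply: cI_fourier; exact: Tf_cW.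
by rewrite -!/(fourier _ _) mulNr addrC => /eqP; rewrite subr_eq0 => /eqP.
Qed.

Lemma fourier_decay k (f : R -> C) : Tf f ->
  exists2 c, 0 <= c & forall t, `|t| ^+ k * cnorm (fourier f t) <= c.
Proof.
elim: k f => [|k IH] f Tff.
  have [mf [c fc]] := Tf_cW Tff; exists (2 * c * W).
    rewrite !mulr_ge0 ?(ltW (rint_wt_gt0))//; exact: wt_bound_ge0 fc.
  by move=> t; rewrite expr0 mul1r; exact: fourier_le.
have [f' hf Tf'] := Tf_derive Tff.
have [c c0 hc] := IH _ Tf'; exists c => // t.
rewrite (le_trans _ (hc t))// (fourier_derive t Tff hf) !cnormM cnorm_ci mul1r.
by rewrite cnorm_RtoC exprSr mulrA.
Qed.

(** Each derivative of the transform is again the transform of a test function, so [fourier_decay]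
    settles all orders. *)
Lemma schwartz_fourier (f : R -> C) : Tf f -> schwartz (fourier f).
Proof.
move=> Tff; split; first by apply/csmoothE; exact: smooth_fourier.
move=> j k; elim: j f Tff => [|j IH] f Tff.
  by have [c _ h] := fourier_decay k Tff; exists c.
have [M hM] := IH _ (Tf_mulX Tff); exists M => x.
by rewrite cderivnS (hasd_cderiv (hasd_fourier_Tf Tff)).
Qed.

(** Two factors [wt]: one ensures integrability, the other is spent on a growing factor or on
    smallness far out. The seminorms used are those in the expansion of [(1 + t^2)^2]. *)
Lemma schwartz_wt2 (f : R -> C) : schwartz f ->
  exists2 c, 0 <= c & forall t, cnorm (f t) <= c * wt t ^+ 2.
Proof.
move=> [_ hf]; have [M0 h0] := hf 0%N 0%N; have [M2 h2] := hf 0%N 2; have [M4 h4] := hf 0%N 4.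
exists (`|M0| + 2 * `|M2| + `|M4|); first by rewrite !addr_ge0 ?mulr_ge0.
move=> t; rewrite /wt exprVn ler_pdivlMr ?exprn_gt0 ?ltr_pwDl ?sqr_ge0//.
have e2 : `|t| ^+ 2 = t ^+ 2 by rewrite real_normK ?num_real.
have e4 : `|t| ^+ 4 = (t ^+ 2) ^+ 2 by rewrite -e2 -exprM.
have := h0 t; have := h2 t; have := h4 t; rewrite /= expr0 mul1r e2 e4.
have := ler_norm M0; have := ler_norm M2; have := ler_norm M4.
move: (cnorm _) => z n4 n2 n0 a4 a2 a0.
have -> : z * (1 + t ^+ 2) ^+ 2 = z + 2 * (t ^+ 2 * z) + (t ^+ 2) ^+ 2 * z by ring.
lra.
Qed.

Lemma fourier_wt2 (f : R -> C) : Tf f ->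
  exists2 c, 0 <= c & forall t, cnorm (fourier f t) <= c * wt t ^+ 2.
Proof. by move=> Tff; exact: schwartz_wt2 (schwartz_fourier Tff). Qed.

Lemma fourier_wt (f : R -> C) : Tf f ->
  exists2 c, 0 <= c & forall t, cnorm (fourier f t) <= c * wt t.
Proof.
move=> /fourier_wt2[c c0 h]; exists c => // t; rewrite (le_trans (h t))//.
by rewrite ler_wpM2l// expr2 ler_piMr ?wt_ge0 ?wt_le1.
Qed.

Lemma ccvg_unique (u : nat -> C) (a b : C) : ccvg u a -> ccvg u b -> a = b.
Proof.
move=> /ccvgP[a1 a2] /ccvgP[b1 b2].
by apply: complex_eq; [exact: cvg_unique a1 b1|exact: cvg_unique a2 b2].
Qed.

(** The Heaviside function with both arguments explicit, so that it serves as a cutoff in either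
    variable when integrals over [u < v] are exchanged. *)
Definition stp (u v : R) : R := (u < v)%R%:R.

Lemma measurable_stp u : measurable_fun setT (stp u).
Proof.
have -> : stp u = \1_(`]u, +oo[) :> (R -> R); last exact: measurable_indic.
apply/funext => v; rewrite indicE /stp.
by congr (nat_of_bool _)%:R; apply/idP/idP; rewrite inE /= in_itv /= andbT.
Qed.

Lemma measurable_stp_fst v : measurable_fun setT (fun u => stp u v).
Proof.
have -> : (fun u => stp u v) = \1_(`]-oo, v[) :> (R -> R); last exact: measurable_indic.
apply/funext => u; rewrite indicE /stp.
by congr (nat_of_bool _)%:R; apply/idP/idP; rewrite inE /= in_itv.
Qed.

Lemma stp_le1 u v : `|stp u v| <= 1.
Proof. by rewrite /stp; case: ltP => _; rewrite ?normr0// normr1. Qed.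

Lemma exp_wt (e : R) : 0 < e -> exists2 c, 0 <= c & forall v, 0 <= v -> expR (- (e * v)) <= c * wt v.
Proof.
move=> e0; have [c c0 hc] := @exprn_le_expR R 2.
exists (1 + c / e ^+ 2); first by rewrite addr_ge0// divr_ge0// sqr_ge0.
move=> v; rewrite le_eqVlt => /orP[/eqP <-|v0].
  by rewrite mulr0 oppr0 expR0 /wt expr0n addr0 invr1 mulr1 lerDl divr_ge0// sqr_ge0.
rewrite /wt ler_pdivlMr ?ltr_pwDl ?sqr_ge0// mulrDr mulr1 lerD//.
  by rewrite -[leRHS]expR0 ler_expR oppr_le0 mulr_ge0 ?ltW.
have := hc (e * v) (mulr_gt0 e0 v0); rewrite exprMn expRN => h.
rewrite ler_pdivlMr ?exprn_gt0// -mulrA [v ^+ 2 * _]mulrC.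
by rewrite ler_pdivrMl ?expR_gt0// [expR _ * c]mulrC.
Qed.

Lemma wt_cvg0 (u : R) : wt (u + n%:R) @[n --> \oo] --> (0 : R).
Proof.
apply/cvgrPdist_le => e e0; near=> n.
rewrite sub0r normrN ger0_norm ?wt_ge0//.
have h : e^-1 + 1 <= u + n%:R.
  by rewrite -lerBlDl; near: n; exact: nbhs_infty_ger.
rewrite /wt -[leRHS]invrK lef_pV2 ?posrE ?invr_gt0// ?ltr_pwDl ?sqr_ge0//.
have e1 : 0 < e^-1 by rewrite invr_gt0.
have : e^-1 * 1 <= (u + n%:R) * (u + n%:R) by apply: ler_pM => //; lra.
rewrite -expr2; lra.
Unshelve. all: by end_near.
Qed.

(** The bounds are required on the half-line only, because an exponential that decays on one side
    grows on the other. *)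
Lemma cint_halfline (g g' g'' : R -> C) (u c d : R) : hasd g g' -> hasd g' g'' ->
  (forall v, u < v -> cnorm (g' v) <= c * wt v) ->
  (forall v, u < v -> cnorm (g v) <= d * wt v) ->
  cint (fun v => RtoC (stp u v) * g' v) = - g u.
Proof.
move=> hg hg' g'c gd.
have c0 : 0 <= c.
  rewrite -(pmulr_lge0 _ (wt_gt0 (u + 1))) (le_trans (cnorm_ge0 _) (g'c (u + 1) _))//.
  by rewrite ltrDl.
pose f_ n v := RtoC (chi u (u + n%:R) v) * g' v.
have mg' := hasd_cM hg'.
have h1 : ccvg (fun n => cint (f_ n)) (cint (fun v => RtoC (stp u v) * g' v)).
  apply: (@cint_DCT _ _ _ c).
  - by move=> n; apply: cM_M => //; apply: cM_RtoC; exact: measurable_chi.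
  - by apply: cM_M => //; apply: cM_RtoC; exact: measurable_stp.
  - move=> v; apply: (cvg_near_cst 0); near=> n.
    rewrite /f_ /chi /stp (_ : v <= u + n%:R) ?andbT ?subrr ?cnorm0//.
    by rewrite -lerBlDl; near: n; exact: nbhs_infty_ger.
  - move=> n v; rewrite /f_ /chi; case: ltP => /= uv; last by rewrite mul0r cnorm0 mulr_ge0 ?wt_ge0.
    case: (v <= _); last by rewrite mul0r cnorm0 mulr_ge0 ?wt_ge0.
    by rewrite mul1r g'c.
have h2 : ccvg (fun n => cint (f_ n)) (- g u).
  have hb : d * wt (u + n%:R) @[n --> \oo] --> (0 : R).
    by rewrite -[0 in X in _ --> X](mulr0 d); apply: cvgM; [exact: cvg_cst|exact: wt_cvg0].
  apply: (squeeze_cvgr _ _ hb); last exact: cvg_cst.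
  near=> n; rewrite cnorm_ge0 /= /f_ (cint_chi_FTC _ hg hg') ?lerDl// opprK subrK.
  apply: gd; rewrite ltrDl; near: n; exact: nbhs_infty_gtr.
exact: ccvg_unique h1 h2.
Unshelve. all: by end_near.
Qed.

Lemma cint_halfline_neg (g g' g'' : R -> C) (u c d : R) : hasd g g' -> hasd g' g'' ->
  (forall v, v <= u -> cnorm (g' v) <= c * wt v) ->
  (forall v, v <= u -> cnorm (g v) <= d * wt v) ->
  cint (fun v => RtoC (1 - stp u v) * g' v) = g u.
Proof.
move=> hg hg' g'c gd.
have c0 : 0 <= c.
  by rewrite -(pmulr_lge0 _ (wt_gt0 u)) (le_trans (cnorm_ge0 _) (g'c u _)).
pose f_ n v := RtoC (chi (u - n%:R) u v) * g' v.
have mg' := hasd_cM hg'.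
have sE v : 1 - stp u v = (v <= u)%R%:R.
  by rewrite /stp; case: ltP => _ /=; rewrite ?subrr ?subr0.
have h1 : ccvg (fun n => cint (f_ n)) (cint (fun v => RtoC (1 - stp u v) * g' v)).
  apply: (@cint_DCT _ _ _ c).
  - by move=> n; apply: cM_M => //; apply: cM_RtoC; exact: measurable_chi.
  - by apply: cM_M => //; apply: cM_RtoC; apply: measurable_funB => //; exact: measurable_stp.
  - move=> v; apply: (cvg_near_cst 0); near=> n.
    rewrite /f_ /chi sE (_ : u - n%:R < v) /= ?subrr ?cnorm0//.
    by rewrite ltrBlDl -ltrBlDr; near: n; exact: nbhs_infty_gtr.
  - move=> n v; rewrite /f_ /chi.
    case: (leP v u) => /= uv; last by rewrite andbF mul0r cnorm0 mulr_ge0 ?wt_ge0.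
    case: (_ < v); last by rewrite mul0r cnorm0 mulr_ge0 ?wt_ge0.
    by rewrite mul1r g'c.
have h2 : ccvg (fun n => cint (f_ n)) (g u).
  have wtN (x : R) : wt (- x) = wt x by rewrite /wt sqrrN.
  have hb : d * wt (u - n%:R) @[n --> \oo] --> (0 : R).
    rewrite -[0 in X in _ --> X](mulr0 d); apply: cvgM; first exact: cvg_cst.
    under eq_fun do rewrite -wtN opprB addrC; exact: wt_cvg0.
  apply: (squeeze_cvgr _ _ hb); last exact: cvg_cst.
  near=> n; rewrite cnorm_ge0 /= /f_ (cint_chi_FTC _ hg hg') ?gerBl//.
  have -> : g u - g (u - n%:R) - g u = - g (u - n%:R) by ring.
  by rewrite cnormN gd// gerBl.
exact: ccvg_unique h1 h2.
Unshelve. all: by end_near.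
Qed.

(** [exp ((a + i b) v)] *)
Definition ez (a b v : R) : C := RtoC (expR (a * v)) * cexpi (b * v).

Lemma hasd_ez a b : hasd (ez a b) (fun v => Complex a b * ez a b v).
Proof.
apply: (hasd_eq _ _ (hasd_M (hasd_expR a) (hasd_cexpi_lin b))) => // v.
have -> : Complex a b = RtoC a + RtoC b * ci.
  by apply: complex_eq; rewrite !ReImE /=; ring.
rewrite /ez; ring.
Qed.

Lemma cnorm_ez a b v : cnorm (ez a b v) = expR (a * v).
Proof. by rewrite /ez cnormM cnorm_cexpi mulr1 cnorm_RtoC ger0_norm ?expR_ge0. Qed.

Lemma ez0 a b : ez a b 0 = 1.
Proof. by rewrite /ez !mulr0 expR0 cexpi0 mul1r. Qed.

Lemma cM_ez a b : cM (ez a b).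
Proof. exact: hasd_cM (hasd_ez a b). Qed.

Lemma Complex_neq0 (a b : R) : a != 0 -> Complex a b != 0.
Proof. by apply: contra => /eqP[-> _]. Qed.

Lemma cint_ez_pos (e b : R) : 0 < e ->
  cint (fun v => RtoC (stp 0 v) * ez (- e) b v) = - (Complex (- e) b)^-1.
Proof.
move=> e0; pose z := Complex (- e) b.
have z0 : z != 0 by apply: Complex_neq0; rewrite oppr_eq0 gt_eqF.
have hz := hasd_ez (- e) b.
have [c c0 hc] := exp_wt e0.
have bd v : 0 < v -> cnorm (ez (- e) b v) <= c * wt v.
  by move=> v0; rewrite cnorm_ez mulNr hc// ltW.
have -> : - (Complex (- e) b)^-1 = - (z^-1 * ez (- e) b 0) by rewrite ez0 mulr1.
apply: (@cint_halfline (fun v => z^-1 * ez (- e) b v) _ (fun v => z * ez (- e) b v) 0 c (cnorm z^-1 * c)) => //.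
- apply: (hasd_eq _ _ (hasd_Z z^-1 hz)) => // v.
  by rewrite mulrA mulVf// mul1r.
- by move=> v v0; rewrite cnormM -mulrA ler_wpM2l ?cnorm_ge0// bd.
Qed.

Lemma cint_reflect (f : R -> C) : cI f -> cint (fun x => f (- x)) = cint f.
Proof.
move=> fi; rewrite -(@cint_affine _ (-1) 0 f) ?oppr_eq0 ?oner_eq0//.
rewrite normrN1 mul1r; apply: eq_cint => x; by rewrite mulN1r addr0.
Qed.
End FourierBasics.

(** * Fourier inversion by Abel summation *)

Section Inversion.
Context {R : realType}.
Local Notation C := R[i].
Local Notation Re := complex.Re.
Local Notation Im := complex.Im.
Local Notation W := (rint (@wt R)).

Lemma measurable_abs_exp (e : R) : measurable_fun setT (fun x : R => expR (- (e * `|x|))).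
Proof.
apply: measurableT_comp => //; apply: measurableT_comp => //.
by apply: measurable_funM => //; exact: measurableT_comp.
Qed.

Lemma abs_exp_le1 (e x : R) : 0 < e -> `|expR (- (e * `|x|))| <= 1.
Proof.
move=> e0; rewrite ger0_norm ?expR_ge0// -[leRHS]expR0 ler_expR oppr_le0.
by rewrite mulr_ge0// ltW.
Qed.

Lemma abs_exp_wt (e : R) : 0 < e ->
  exists2 c, 0 <= c & forall x : R, expR (- (e * `|x|)) <= c * wt x.
Proof.
move=> /exp_wt[c c0 h]; exists c => // x.
by rewrite (le_trans (h _ (normr_ge0 x)))// /wt real_normK ?num_real.
Qed.

(** The transform of [exp (- e |x|)] is the Poisson kernel. *)
Lemma cint_abs_exp (e u : R) : 0 < e ->
  cint (fun x => cexpi (- (u * x)) * RtoC (expR (- (e * `|x|)))) =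
  RtoC (2 / e * wt (u / e)).
Proof.
move=> e0; have en0 : e != 0 by rewrite gt_eqF.
have [c c0 hc] := exp_wt e0.
have mE b d : cM (fun v : R => RtoC (stp 0 v) * ez b d v).
  by apply: cM_M; [apply: cM_RtoC; exact: measurable_stp|exact: cM_ez].
have mE' b d : cM (fun v : R => RtoC (1 - stp 0 v) * ez b d v).
  apply: cM_M; last exact: cM_ez.
  by apply: cM_RtoC; apply: measurable_funB => //; exact: measurable_stp.
have -> : (fun x => cexpi (- (u * x)) * RtoC (expR (- (e * `|x|)))) =
  (fun x => RtoC (stp 0 x) * ez (- e) (- u) x + RtoC (1 - stp 0 x) * ez e (- u) x).
  apply/funext => x; rewrite /stp /ez; case: ltP => x0 /=.
    by rewrite subrr RtoC1 RtoC0 mul0r addr0 mul1r gtr0_norm// mulrC !mulNr.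
  by rewrite subr0 RtoC1 RtoC0 mul0r add0r mul1r ler0_norm// mulrC !mulNr mulrN opprK.
rewrite cintD; last 2 first.
- apply: (@cI_W _ _ c) => // x; rewrite cnormM cnorm_RtoC cnorm_ez /stp.
  case: ltP => x0 /=; last by rewrite normr0 mul0r mulr_ge0 ?wt_ge0.
  by rewrite normr1 mul1r mulNr hc// ltW.
- apply: (@cI_W _ _ c) => // x; rewrite cnormM cnorm_RtoC cnorm_ez /stp.
  case: ltP => x0 /=; first by rewrite subrr normr0 mul0r mulr_ge0 ?wt_ge0.
  rewrite subr0 normr1 mul1r -[e * x]opprK -mulrN (le_trans (hc _ _)) ?oppr_ge0//.
  by rewrite /wt sqrrN.
rewrite cint_ez_pos//.
pose z := Complex e (- u).
have z0 : z != 0 by exact: Complex_neq0.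
have hz := hasd_ez e (- u).
have bd v : v <= 0 -> cnorm (ez e (- u) v) <= c * wt v.
  move=> v0; rewrite cnorm_ez -[e * v]opprK -mulrN (le_trans (hc _ _)) ?oppr_ge0//.
  by rewrite /wt sqrrN.
rewrite (@cint_halfline_neg _ (fun v => z^-1 * ez e (- u) v) _ (fun v => z * ez e (- u) v) 0 c (cnorm z^-1 * c)) //; last 2 first.
- apply: (hasd_eq _ _ (hasd_Z z^-1 hz)) => // v.
  by rewrite mulrA mulVf// mul1r.
- by move=> v v0; rewrite cnormM -mulrA ler_wpM2l ?cnorm_ge0// bd.
have d0 : e ^+ 2 + u ^+ 2 != 0 by rewrite gt_eqF// ltr_pwDl ?sqr_ge0// exprn_gt0.
have -> : wt (u / e) = e ^+ 2 / (e ^+ 2 + u ^+ 2).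
  rewrite /wt -[RHS]invf_div; congr (_^-1); field; exact: en0.
rewrite ez0 mulr1 /z; apply: complex_eq; rewrite !ReImE /= ?sqrrN.
  by field; rewrite d0 en0.
by ring.
Qed.

Lemma expR_cvg_harmonic (x : R) : expR (- (n.+1%:R^-1 * `|x|)) @[n --> \oo] --> (1 : R).
Proof.
rewrite -[in X in _ --> X](@expR0 R).
apply: (@cvg_comp _ _ _ (fun n : nat => - (n.+1%:R^-1 * `|x|)) (@expR R) _ (nbhs (0 : R))); last exact: continuous_expR.
have h : n.+1%:R^-1 * `|x| @[n --> \oo] --> (0 : R).
  by rewrite -[0 in X in _ --> X](mul0r `|x|); apply: cvgM; [exact: cvg_harmonic|exact: cvg_cst].
have h2 : - (n.+1%:R^-1 * `|x|) @[n --> \oo] --> - (0 : R) by exact: cvgN.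
by rewrite oppr0 in h2.
Qed.

(** The outer integral is damped by [exp(-e|x|)] with [e = 1 / (n + 1)]. Exchanging integrals gives
    the average of [f] against a Poisson kernel, which the substitution [s = e w - t] turns into
    that of [f (e w - t)] against [2 * wt w]; then [e] tends to [0]. The constant [2 * W] is
    [2 * pi] by [integral_wt]. *)
Lemma fourier_inversion (f : R -> C) t : Tf f ->
  fourier (fourier f) t = RtoC (2 * W) * f (- t).
Proof.
move=> Tff; pose g := fourier f.
have [cg cg0 hg] := fourier_wt Tff.
have [mf [cf hf]] := Tf_cW Tff.
have cf0 := wt_bound_ge0 hf.
have mg : cM g by exact: cM_fourier.
pose e n : R := n.+1%:R^-1.
have e0 n : 0 < e n by rewrite invr_gt0.
pose E n (x : R) := RtoC (expR (- (e n * `|x|))) : C.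
have mE n : cM (E n) by apply: cM_RtoC; exact: measurable_abs_exp.
pose I n := cint (fun x => cexpi (- (t * x)) * (E n x * g x)).
have c1 : ccvg I (fourier g t).
  apply: (@cint_DCT _ _ _ cg).
  - by move=> n; apply: cM_fourier_integrand; exact: cM_M.
  - exact: cM_fourier_integrand.
  - move=> x; apply/ccvgP.
    have h := expR_cvg_harmonic x.
    have eR n : Re (cexpi (- (t * x)) * (E n x * g x)) =
        expR (- (e n * `|x|)) * Re (cexpi (- (t * x)) * g x).
      by rewrite /E !ReImE /=; ring.
    have eI n : Im (cexpi (- (t * x)) * (E n x * g x)) =
        expR (- (e n * `|x|)) * Im (cexpi (- (t * x)) * g x).
      by rewrite /E !ReImE /=; ring.
    have hh r : expR (- (e n * `|x|)) * r @[n --> \oo] --> r.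
      by rewrite -[in X in _ --> X](mul1r r); apply: cvgM => //; exact: cvg_cst.
    by split; [under eq_fun do rewrite eR|under eq_fun do rewrite eI]; exact: hh.
  - move=> n x; rewrite cnorm_cexpiM cnormM cnorm_RtoC (le_trans _ (hg x))//.
    by rewrite ler_piMl ?cnorm_ge0// abs_exp_le1.
have eqI n : I n = cint (fun s => f s * RtoC (2 / e n * wt ((t + s) / e n))).
  pose F x s := cexpi (- (t * x)) * E n x * (cexpi (- (x * s)) * f s).
  have mF : cM (fun z : R * R => F z.1 z.2).
    have m1 : cM (fun z : R * R => cexpi (- (t * z.1)) * E n z.1).
      apply: (@cM_comp _ _ _ (fun x => cexpi (- (t * x)) * E n x) (fun z : R * R => z.1)).
        exact: cM_fourier_integrand.
      exact: measurable_fst.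
    have m2 : cM (fun z : R * R => f z.2) by apply: cM_comp => //; exact: measurable_snd.
    do 2 (apply: cM_M => //).
    apply: cM_cexpi; apply: measurableT_comp => //.
    exact: measurable_funM.
  have [cE cE0 hE] := abs_exp_wt (e0 n).
  have FC x s : cnorm (F x s) <= cE * cf * (wt x * wt s).
    rewrite /F cnormM !cnorm_cexpiM cnorm_RtoC ger0_norm ?expR_ge0//.
    have -> : cE * cf * (wt x * wt s) = (cE * wt x) * (cf * wt s) by ring.
    by rewrite ler_pM ?expR_ge0 ?cnorm_ge0.
  transitivity (cint (fun x => cint (fun s => F x s))).
    apply: eq_cint => x; rewrite /F cintZ; last by apply: cI_fourier; exact: Tf_cW.
    by rewrite -/(fourier f x) mulrA.
  rewrite (cint_Fubini mF FC); apply: eq_cint => s.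
  rewrite -(cint_abs_exp (t + s) (e0 n)) -cintZ; last first.
    apply: (@cI_W _ _ cE); first exact: (cM_fourier_integrand (t + s) (mE n)).
    by move=> x; rewrite cnorm_cexpiM cnorm_RtoC ger0_norm ?expR_ge0.
  apply: eq_cint => x; rewrite /F.
  have -> : - ((t + s) * x) = - (t * x) + - (x * s) by ring.
  rewrite cexpiD /E; ring.
have eqI2 n : I n = cint (fun w => f (e n * w - t) * RtoC (2 * wt w)).
  have en0 : e n != 0 by rewrite gt_eqF.
  have hi : cI (fun s => f s * RtoC (2 / e n * wt ((t + s) / e n))).
    apply: (@cI_W _ _ (cf * (2 / e n))).
      apply: cM_M => //; apply: cM_RtoC; apply: measurable_funM => //.
      have -> : (fun s => wt ((t + s) / e n)) = (fun s => wt ((e n)^-1 * s + t / e n)).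
        by apply/funext => s; congr wt; rewrite mulrDl addrC [s * _]mulrC.
      by apply: (@measurable_affine _ _ _ wt); exact: measurable_wt.
    move=> s; rewrite cnormM cnorm_RtoC.
    have -> : cf * (2 / e n) * wt s = (cf * wt s) * (2 / e n) by ring.
    have h2 : 0 <= 2 / e n by rewrite divr_ge0// ltW.
    apply: ler_pM => //; first exact: cnorm_ge0.
    rewrite ger0_norm; last by rewrite mulr_ge0 ?wt_ge0.
    by rewrite ler_piMr ?wt_le1.
  rewrite eqI -(cint_affine (- t) en0 hi) gtr0_norm// -cintZ; last first.
    exact: (cI_affine (- t) en0 hi).
  apply: eq_cint => w; rewrite mulrCA -RtoCM.
  have -> : (t + (e n * w - t)) / e n = w by field; exact: en0.
  by congr (_ * RtoC _); field; exact: en0.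
have c2 : ccvg I (RtoC (2 * W) * f (- t)).
  have -> : RtoC (2 * W) * f (- t) = cint (fun w => f (- t) * RtoC (2 * wt w)).
    rewrite cintZ; last first.
      apply: (@cI_W _ _ 2); first by apply: cM_RtoC; apply: measurable_funM => //; exact: measurable_wt.
      by move=> x; rewrite cnorm_RtoC ger0_norm ?mulr_ge0 ?wt_ge0.
    rewrite mulrC; congr (_ * _); rewrite cintE /=; apply: complex_eq => /=.
      by rewrite rintZ//; exact: rI_wt.
    rewrite -[LHS](mul0r W) -rintZ; last exact: rI_wt.
    by congr rint; apply/funext => x; rewrite mul0r.
  have -> : I = (fun n => cint (fun w => f (e n * w - t) * RtoC (2 * wt w))) by apply/funext.
  have m2w : cM (fun w : R => RtoC (2 * wt w) : C).
    by apply: cM_RtoC; apply: measurable_funM => //; exact: measurable_wt.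
  apply: (@cint_DCT _ _ _ (cf * 2)).
  - by move=> n; apply: cM_M => //; exact: cM_affine.
  - by apply: cM_M => //; exact: cM_cst.
  - move=> w.
    have [f' hfd _] := Tf_derive Tff; have [k1 k2] := hasd_continuous hfd.
    have ha : e n * w - t @[n --> \oo] --> - t.
      rewrite -[X in _ --> X]add0r -[0 in X in _ --> X](mul0r w).
      by apply: cvgD; [apply: cvgM; [exact: cvg_harmonic|exact: cvg_cst]|exact: cvg_cst].
    have r1 : Re (f (e n * w - t)) @[n --> \oo] --> Re (f (- t)) by exact: (cvg_comp _ _ ha (k1 (- t))).
    have r2 : Im (f (e n * w - t)) @[n --> \oo] --> Im (f (- t)) by exact: (cvg_comp _ _ ha (k2 (- t))).
    apply/ccvgP; split.
      under eq_fun do rewrite cReM /= mulr0 subr0.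
      by rewrite cReM /= mulr0 subr0; apply: cvgM => //; exact: cvg_cst.
    under eq_fun do rewrite cImM /= mulr0 add0r.
    by rewrite cImM /= mulr0 add0r; apply: cvgM => //; exact: cvg_cst.
  - move=> n w; rewrite cnormM cnorm_RtoC -mulrA ler_pM ?cnorm_ge0//.
      exact: (cW_bounded hf).
    by rewrite ger0_norm// mulr_ge0 ?wt_ge0.
exact: ccvg_unique c1 c2.
Qed.

End Inversion.

(** * Nonnegative kernels and decay of pseudofunctions *)

Section Kernels.
Context {R : realType}.
Local Notation C := R[i].
Local Notation Re := complex.Re.
Local Notation Im := complex.Im.
Local Notation W := (rint (@wt R)).

(** Peetre's inequality *)
Lemma wt_shift (x y : R) : wt (x + y) <= 2 * (1 + y ^+ 2) * wt x.
Proof.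
have p (z : R) : 0 < 1 + z ^+ 2 by rewrite ltr_pwDl ?sqr_ge0.
rewrite /wt ler_pdivlMr// ler_pdivrMl//.
rewrite -subr_ge0.
have -> : (1 + (x + y) ^+ 2) * (2 * (1 + y ^+ 2)) - (1 + x ^+ 2) =
  1 + 2 * ((x + y) * y) ^+ 2 + (x + 2 * y) ^+ 2 by ring.
have := sqr_ge0 ((x + y) * y); have := sqr_ge0 (x + 2 * y); lra.
Qed.

Lemma Tf_bounded (f : R -> C) : Tf f -> exists2 M, 0 <= M & forall x, cnorm (f x) <= M.
Proof.
move=> /Tf_cW[_ [c fc]]; exists c; first exact: wt_bound_ge0 fc.
exact: (cW_bounded fc).
Qed.

Definition autocorr (f g : R -> C) (t : R) : C := cint (fun s => cconj (f s) * g (s + t)).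

Lemma Tf_autocorr_bound (f g : R -> C) : Tf f -> Tf g ->
  exists c, forall t s, cnorm (cconj (f s) * g (s + t)) <= c * wt s.
Proof.
move=> /Tf_cW[_ [c fc]] Tg; have [M M0 hM] := Tf_bounded Tg; exists (M * c) => t s.
by rewrite cnormM cnorm_cconj mulrC -mulrA ler_pM ?cnorm_ge0.
Qed.

Lemma cM_autocorr_integrand (f g : R -> C) t : Tf f -> Tf g ->
  cM (fun s => cconj (f s) * g (s + t)).
Proof.
move=> /Tf_cM mf /Tf_cM mg; apply: cM_M; first exact: cM_cconj.
by apply: cM_comp => //; exact: measurable_funD.
Qed.

Lemma smooth_autocorr (f g : R -> C) : Tf f -> Tf g -> smooth (autocorr f g).
Proof.
move=> Tff Tg n; elim: n g Tg => // n IH g Tg.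
have [g' hg Tg'] := Tf_derive Tg.
exists (autocorr f g'); last exact: IH.
have [c1 h1] := Tf_autocorr_bound Tff Tg.
have [c2 h2] := Tf_autocorr_bound Tff Tg'.
apply: (@hasd_under_integral _ _ (fun t s => cconj (f s) * g' (s + t)) (Num.max c1 c2)).
- by move=> t; exact: cM_autocorr_integrand.
- by move=> t s; rewrite (le_trans (h1 t s))// ler_wpM2r ?wt_ge0// le_max lexx.
- move=> s; apply: hasd_Z.
  by apply: (hasd_eq _ _ (hasd_affine 1 s hg)) => t; rewrite ?RtoC1 !mul1r addrC.
- by move=> t s; rewrite (le_trans (h2 t s))// ler_wpM2r ?wt_ge0// le_max lexx orbT.
Qed.

Lemma autocorr_support (f : R -> C) (a t : R) : (forall x, a <= `|x| -> f x = 0) ->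
  2 * a <= `|t| -> autocorr f f t = 0.
Proof.
move=> f0 ht; rewrite -[RHS](@cint0 R); apply: eq_cint => s.
have [sa|sa] := leP a `|s|; first by rewrite f0// cconj0 mul0r.
rewrite [f (s + t)]f0 ?mulr0//.
have := ler_normB (s + t) s; rewrite addrAC subrr add0r; lra.
Qed.

(** Exchange the integrals, then substitute [t + s] for [t]. This is how kernels with nonnegative
    transform are produced. *)
Lemma fourier_autocorr (f : R -> C) (a x : R) : Tf f -> (forall x, a <= `|x| -> f x = 0) ->
  fourier (autocorr f f) x = RtoC (cnorm (fourier f x) ^+ 2).
Proof.
move=> Tff f0.
have mf := Tf_cM Tff.
have [M M0 hM] := Tf_bounded Tff.
pose F (t s : R) := cexpi (- (x * t)) * (cconj (f s) * f (s + t)).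
have mF : cM (fun z : R * R => F z.1 z.2).
  apply: cM_M.
    apply: (@cM_comp _ _ _ (fun t => cexpi (- (x * t))) (fun z : R * R => z.1)).
      exact: cM_ker.
    exact: measurable_fst.
  apply: cM_M.
    apply: (@cM_comp _ _ _ (fun s => cconj (f s)) (fun z : R * R => z.2)).
      exact: cM_cconj.
    exact: measurable_snd.
  by apply: cM_comp => //; apply: measurable_funD; [exact: measurable_snd|exact: measurable_fst].
(* [F t s] vanishes unless [|s| < a] and [|t| < 2a], and there the two weights are at least the
   inverses of the last two factors. *)
pose c := M * M * ((1 + a ^+ 2) * (1 + (2 * a) ^+ 2)).
have FC t s : cnorm (F t s) <= c * (wt t * wt s).
  have p1 (b : R) : 0 < 1 + b ^+ 2 by rewrite ltr_pwDl ?sqr_ge0.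
  rewrite /F cnorm_cexpiM cnormM cnorm_cconj.
  have c0 : 0 <= c * (wt t * wt s).
    by rewrite !mulr_ge0 ?wt_ge0// ltW.
  have [sa|sa] := leP a `|s|; first by rewrite f0// cnorm0 mul0r.
  have [ta|ta] := leP (2 * a) `|t|.
    rewrite [f (s + t)]f0 ?cnorm0 ?mulr0//.
    have := ler_normB (s + t) s; rewrite addrAC subrr add0r; lra.
  have -> : c * (wt t * wt s) = M * M * (((1 + a ^+ 2) * wt s) * ((1 + (2 * a) ^+ 2) * wt t)).
    by rewrite /c; ring.
  apply: (@le_trans _ _ (M * M)); first by rewrite ler_pM ?cnorm_ge0.
  rewrite ler_peMr ?mulr_ge0// -[leLHS]mulr1 ler_pM//.
    by rewrite -ler_pdivrMl// mulr1; exact/wt_ge/ltW.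
  by rewrite -ler_pdivrMl// mulr1; exact/wt_ge/ltW.
have [c1 h1] := Tf_autocorr_bound Tff Tff.
rewrite -mul_cconj /fourier.
transitivity (cint (fun t => cint (fun s => F t s))).
  apply: eq_cint => t; rewrite -cintZ//; apply: (@cI_W _ _ c1) => [|s].
    exact: cM_autocorr_integrand.
  exact: h1.
rewrite (cint_Fubini mF FC).
have fW := Tf_cW Tff.
rewrite -cint_cconj; last exact: cI_fourier.
rewrite mulrC -[RHS]cintZ; last first.
  split; have [] := cI_fourier x fW => // i1 i2.
  by rewrite /cconj /=; have := rIZ (-1) i2; under eq_fun do rewrite mulN1r.
apply: eq_cint => s.
transitivity (cconj (f s) * cexpi (x * s) * cint (fun t => cexpi (- (x * (t + s))) * f (t + s))).
  rewrite -cintZ; last first.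
    exact: (cI_shift s (cI_fourier x fW)).
  apply: eq_cint => t; rewrite /F.
  have -> : - (x * t) = x * s + - (x * (t + s)) by ring.
  rewrite cexpiD (addrC s t); ring.
rewrite (cint_shift s (cI_fourier x fW)) cconjM cconj_cexpi opprK -/(fourier f x); ring.
Qed.

(** Since [mollifier 0 <> 0], inversion forbids the transform of the mollifier to vanish
    identically; modulating moves a point where it is nonzero to the origin. *)
Lemma positive_kernel (d : R) : 0 < d -> exists p : R -> C, exists k : R -> R,
  [/\ Tf p, forall x, d <= `|x| -> p x = 0, forall x, fourier p x = RtoC (k x),
      forall x, 0 <= k x & 0 < k 0].
Proof.
(* Autocorrelation doubles the support, so [f] is confined to [|x| < d / 2]. *)
move=> d0; pose f (x : R) : C := RtoC (mollifier ((2 / d) * x + 0)).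
have d20 : 2 / d != 0 by rewrite mulf_neq0// invr_eq0 gt_eqF.
have d2_gt0 : 0 < 2 / d by rewrite divr_gt0.
have f0 x : d / 2 <= `|x| -> f x = 0.
  move=> h; rewrite /f mollifier_eq0// addr0 normrM gtr0_norm//.
  by rewrite -ler_pdivrMl// mulr1 invf_div.
have Tff : Tf f.
  split; first exact: (smooth_affine (2 / d) 0 (@smooth_mollifier R)).
  by exists (d / 2).
have [x0 hx0] : exists x0, fourier f x0 != 0.
  apply: contrapT => h.
  have {}h x : fourier f x = 0 by apply: contrapT => /eqP hx; apply: h; exists x.
  have := fourier_inversion 0 Tff; rewrite oppr0 /f mulr0 add0r -RtoCM.
  have -> : fourier (fourier f) 0 = 0.
    by rewrite -[RHS](@cint0 R); apply: eq_cint => x; rewrite h mulr0.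
  move/esym/eqP; rewrite RtoC_eq0; apply/negP.
  apply: lt0r_neq0; apply: mulr_gt0; last exact: mollifier0_gt0.
  by apply: mulr_gt0 => //; exact: rint_wt_gt0.
pose q := autocorr f f.
have Tq : Tf q.
  split; first exact: smooth_autocorr.
  exists (2 * (d / 2)) => x; exact: autocorr_support.
exists (fun t => cexpi (- x0 * t) * q t), (fun x => cnorm (fourier f (x + x0)) ^+ 2).
split.
- by apply: Tf_M => //; exact: smooth_cexpi.
- move=> x dx; rewrite /q (autocorr_support f0) ?mulr0//.
  by rewrite (_ : 2 * (d / 2) = d)//; field.
- by move=> x; rewrite fourier_modulate opprK (fourier_autocorr _ Tff f0).
- by move=> x; rewrite sqr_ge0.
- by rewrite add0r exprn_gt0// cnorm_gt0.
Qed.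

(** A bump of width [d] around [s], normalised so that its integral does not depend on [d]. *)
Definition dilate (d s : R) (f : R -> C) : R -> C :=
  fun t => RtoC d^-1 * f (d^-1 * (t - s)).

Lemma dilateE d s f : dilate d s f = fun t => RtoC d^-1 * f (d^-1 * t + - (d^-1 * s)).
Proof. by apply/funext => t; rewrite /dilate mulrBr. Qed.

Lemma Tf_dilate d s f : 0 < d -> Tf f -> Tf (dilate d s f).
Proof.
move=> d0 Tff; rewrite dilateE; apply: Tf_M; first exact: smooth_cst.
by apply: Tf_affine; rewrite ?invr_eq0 ?gt_eqF.
Qed.

Lemma fourier_dilate d s f x : 0 < d -> Tf f ->
  fourier (dilate d s f) x = cexpi (- (s * x)) * fourier f (d * x).
Proof.
move=> d0 Tff; have dn : d != 0 by rewrite gt_eqF.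
have di : d^-1 != 0 by rewrite invr_eq0.
rewrite dilateE fourier_Z; last first.
  by apply: Tf_cW; exact: Tf_affine.
rewrite fourier_affine//; last exact: Tf_cW.
rewrite gtr0_norm ?invr_gt0// !invrK !mulrA -RtoCM mulVf// RtoC1 mul1r.
rewrite (mulrC x d); congr (cexpi _ * _); field; exact: dn.
Qed.

(** The limit at infinity is tested along sequences, to which dominated convergence applies. *)
Lemma cvgy_DCT (k : R -> R -> C) (c : R) : (forall y, cM (k y)) ->
  (forall y x, cnorm (k y x) <= c * wt x) ->
  (forall x, cnorm (k y x) @[y --> +oo] --> (0 : R)) ->
  cnorm (cint (k y)) @[y --> +oo] --> (0 : R).
Proof.
move=> mk kc k0; apply/cvg_pinftyP => u uy.
have := @cint_DCT R (fun n => k (u n)) (fun=> 0) c (fun n => mk (u n)) (cM_cst _ 0).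
rewrite /ccvg cint0 => h.
have {}h := h _ (fun n => kc (u n)).
under eq_fun do rewrite -[X in cnorm X]subr0; apply: h => x.
under eq_fun do rewrite subr0.
by have /cvg_pinftyP := k0 x; apply.
Qed.

(** By inversion [f] is the transform of the Schwartz function [fourier k], with [k] a reflected
    multiple of [f], and modulating [f] translates it. Hence the pairing is the integral of
    [G (x - y) * fourier k x], which tends to [0] by dominated convergence, since [G] vanishes at
    minus infinity. *)
Lemma pseudofunction_vanish (P : (R -> C) -> C) (f : R -> C) : pseudofunction P -> Tf f ->
  cnorm (P (fun t => cexpi (y * t) * f t)) @[y --> +oo] --> (0 : R).
Proof.
move=> [_ [G [[mG1 mG2 [B GB]] [_ Gm GP]]]] Tff.
pose k t := RtoC (2 * W)^-1 * f (- t).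
have Wn : 2 * W != 0 by rewrite mulf_neq0// gt_eqF// rint_wt_gt0.
have Tk : Tf k.
  apply: Tf_M; first exact: smooth_cst.
  have := @Tf_affine _ (-1) 0 _ _ Tff; rewrite oppr_eq0 oner_eq0 => /(_ isT).
  by under eq_fun do rewrite mulN1r addr0.
have Tky y : Tf (fun t => cexpi (- y * t) * k t) by apply: Tf_M => //; exact: smooth_cexpi.
have ck := cM_fourier Tk.
have [c c0 hc] := fourier_wt Tk.
have mG : cM G by split.
have e y : P (fun t => cexpi (y * t) * f t) = cint (fun x => G (x - y) * fourier k x).
  have -> : (fun t => cexpi (y * t) * f t) = fourier (fourier (fun t => cexpi (- y * t) * k t)).
    apply/funext => t; rewrite fourier_inversion// /k opprK mulrN mulNr opprK.
    by rewrite mulrCA [RtoC _ * (RtoC _ * _)]mulrA -RtoCM mulfV// RtoC1 mul1r.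
  rewrite GP; last exact: schwartz_fourier.
  under eq_cint do rewrite fourier_modulate opprK.
  rewrite -[LHS](cint_shift (- y)).
    by apply: eq_cint => x; rewrite subrK.
  apply: (@cI_W _ _ (B * (c * (2 * (1 + y ^+ 2))))).
    by apply: cM_M => //; apply: cM_comp => //; exact: measurable_funD.
  move=> x; rewrite cnormM -!mulrA ler_pM ?cnorm_ge0// (le_trans (hc _))//.
  by rewrite !mulrA -[c * 2]mulrC -!mulrA mulrCA ler_wpM2l// mulrA wt_shift.
under eq_fun do rewrite e.
apply: (@cvgy_DCT _ (B * c)).
- move=> y; apply: cM_M => //; apply: cM_comp => //.
  exact: measurable_funB.
- by move=> y x; rewrite cnormM -mulrA ler_pM ?cnorm_ge0.
move=> x.
have h : cnorm (G (x - y)) @[y --> +oo] --> (0 : R).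
  have xy : x - y @[y --> +oo] --> -oo.
    apply/cvgrNyPle => A; near=> y.
    by rewrite lerBlDr -lerBlDl; near: y; apply: nbhs_pinfty_ge; rewrite num_real.
  exact: cvg_comp xy Gm.
under eq_fun do rewrite cnormM.
by rewrite -[X in nbhs X](mul0r (cnorm (fourier k x))); apply: cvgM => //; exact: cvg_cst.
Unshelve. all: by end_near.
Qed.

End Kernels.

(** * Good test functions and the exceptional set *)

Section BaireLine.
Context {R : realType}.

(** Closedness of [K] and of the [F n] is expressed by balls in the complements. *)
Lemma baire_line (K : set R) (F : nat -> set R) (c0 : R) : K c0 ->
  (forall x, ~ K x -> exists2 r, 0 < r & forall z, `|z - x| < r -> ~ K z) ->
  (forall n x, ~ F n x -> exists2 r, 0 < r & forall z, `|z - x| < r -> ~ F n z) ->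
  (forall x, K x -> exists n, F n x) ->
  exists n c r, [/\ K c, 0 < r & forall x, K x -> `|x - c| < r -> F n x].
Proof.
move=> Kc0 oK oF KF; apply: contrapT => H.
(* If the conclusion fails, the ball of half the radius around a point of [K] contains a point of
   [K] outside [F n], hence a smaller closed ball missing [F n]. Pairs are centre and radius. *)
have step n (p : R * R) : {q : R * R | K p.1 -> 0 < p.2 ->
    [/\ K q.1, 0 < q.2, q.2 <= p.2 / 2, `|q.1 - p.1| <= p.2 / 2
      & forall z, `|z - q.1| <= q.2 -> ~ F n z]}.
  apply: cid; have [Kp|nKp] := pselect (K p.1); last by exists p.
  have [p0|p0] := ltP 0 p.2; last by exists p.
  have p20 : 0 < p.2 / 2 by rewrite divr_gt0.
  have [x [Kx xp nFx]] : exists x, [/\ K x, `|x - p.1| < p.2 / 2 & ~ F n x].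
    apply: contrapT => h; apply: H; exists n, p.1, (p.2 / 2); split => // x Kx xp.
    by apply: contrapT => nF; apply: h; exists x.
  have [r r0 hr] := oF n x nFx.
  have m0 : 0 < Num.min (r / 2) (p.2 / 2) by rewrite lt_min p20 divr_gt0.
  exists (x, Num.min (r / 2) (p.2 / 2)) => _ _; split => //=.
  - by rewrite ge_min lexx orbT.
  - exact: ltW.
  - move=> z; rewrite le_min => /andP[zr _]; apply: hr.
    by rewrite (le_lt_trans zr)// ltr_pdivrMr// ltr_pMr// ltr1n.
pose q : nat -> R * R := fix q n := if n is n'.+1 then sval (step n' (q n')) else (c0, 1).
have qK n : K (q n).1 /\ 0 < (q n).2.
  elim: n => [|n [Kn rn]] //=.
  by case: (step n (q n)) => p /= /(_ Kn rn)[].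
have qS n : [/\ (q n.+1).2 <= (q n).2 / 2, `|(q n.+1).1 - (q n).1| <= (q n).2 / 2
      & forall z, `|z - (q n.+1).1| <= (q n.+1).2 -> ~ F n z].
  have [Kn rn] := qK n.
  by move=> /=; case: (step n (q n)) => p /= /(_ Kn rn)[].
pose lo n := (q n).1 - (q n).2; pose hi n := (q n).1 + (q n).2.
have loS n : lo n <= lo n.+1.
  have [h1 h2 _] := qS n; move: h2; rewrite ler_norml => /andP[h2 _].
  rewrite /lo; lra.
have hiS n : hi n.+1 <= hi n.
  have [h1 h2 _] := qS n; move: h2; rewrite ler_norml => /andP[_ h2].
  rewrite /hi; lra.
have lohi n : lo n <= hi n by have [_ h] := qK n; rewrite /lo /hi; lra.
have loD m n : (m <= n)%N -> lo m <= lo n by move/(homo_leq (@le_refl _ R) (@le_trans _ R) loS).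
have hiD m n : (m <= n)%N -> hi n <= hi m.
  move=> mn; rewrite -lerN2; move: mn.
  have hS k : - hi k <= - hi k.+1 by rewrite lerN2.
  by move/(homo_leq (f := fun k => - hi k) (@le_refl _ R) (@le_trans _ R) hS).
have lh m n : lo m <= hi n.
  case: (leqP m n) => mn; first exact: le_trans (loD _ _ mn) (lohi n).
  exact: le_trans (lohi m) (hiD _ _ (ltnW mn)).
pose x := sup (range lo).
have ub : has_ubound (range lo) by exists (hi 0%N) => _ [m _ <-].
have xlo n : lo n <= x by apply: ub_le_sup => //; exists n.
have xhi n : x <= hi n.
  by apply: ge_sup => [|_ [m _ <-]]; [exists (lo 0%N), 0%N|exact: lh].
have xq n : `|x - (q n).1| <= (q n).2.
  by rewrite ler_norml; have := xlo n; have := xhi n; rewrite /lo /hi => ? ?; apply/andP; split; lra.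
(* The centres lie in [K] and the radii are at least halved at each step, so [x] is a limit of
   points of the closed set [K]. *)
have Kx : K x.
  apply: contrapT => /oK[r r0 hr].
  have qr n : (q n).2 <= (n.+1%:R)^-1.
    elim: n => [|n IH]; first by rewrite invr1.
    have [h1 _ _] := qS n; apply: (le_trans h1).
    apply: (@le_trans _ _ (n.+1%:R^-1 / 2)); first by rewrite ler_pM2r.
    rewrite -invfM lef_pV2 ?posrE ?mulr_gt0//.
    by rewrite -natrM ler_nat muln2 -addnn !addnS ltnS addSn ltnS leq_addl.
  have /cvgrPdist_lt/(_ r r0)[N _ hN] := @cvg_harmonic R.
  have := hN N (leqnn N); rewrite sub0r normrN /harmonic gtr0_norm ?invr_gt0// => hNr.
  have [KN _] := qK N.
  apply: hr KN; rewrite distrC (le_lt_trans (xq N))//.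
  exact: le_lt_trans (qr N) hNr.
have [n Fn] := KF _ Kx.
have [_ _ /(_ x)] := qS n; apply => //.
Qed.

End BaireLine.

(** * Mollified transforms and the null set *)

Section Core.
Context {R : realType}.
Local Notation C := R[i].
Local Notation Re := complex.Re.
Local Notation Im := complex.Im.
Local Notation W := (rint (@wt R)).
Local Notation mu := (@lebesgue_measure R).

Lemma rint_eq1 (a : R) (f g : R -> R) : measurable_fun setT f -> measurable_fun setT g ->
  (forall x, x != a -> f x = g x) -> rint f = rint g.
Proof.
move=> mf mg fg; rewrite /rint /Rintegral; congr fine.
apply: ae_eq_integral => //; try exact: measurable_EFin.
exists [set a]; split => //; first exact: lebesgue_measure_set1.
move=> x /= h; apply: contrapT => /eqP xa; apply: h => _.
by rewrite fg.
Qed.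

Lemma cint_eq1 (a : R) (f g : R -> C) : cM f -> cM g ->
  (forall x, x != a -> f x = g x) -> cint f = cint g.
Proof.
move=> [f1 f2] [g1 g2] fg; rewrite !cintE.
by congr Complex; apply: (rint_eq1 (a := a)) => // x /fg ->.
Qed.

Lemma lipschitz0 (h h' : R -> R) (D : R) : (forall x : R, is_derive x 1 h (h' x)) ->
  (forall x, `|h' x| <= D) -> forall x, `|h x - h 0| <= D * `|x|.
Proof.
move=> hd hD x.
have ch : continuous h.
  by move=> z; apply/differentiable_continuous/derivable1_diffP; have [] := hd z.
have [x0|x0] := leP 0 x.
  have [c _ ->] := MVT_segment x0 (fun z _ => hd z) (continuous_subspaceT ch).
  by rewrite subr0 normrM ler_wpM2r.
have [c _ e] := MVT_segment (ltW x0) (fun z _ => hd z) (continuous_subspaceT ch).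
by rewrite distrC e sub0r normrM normrN ler_wpM2r.
Qed.

Lemma Tf_bounded_fourier (f : R -> C) : Tf f ->
  exists2 D, 0 <= D & forall x, cnorm (fourier f x) <= D.
Proof.
by move=> /fourier_wt[c c0 hc]; exists c => //; exact: (cW_bounded hc).
Qed.

Variables (ep : R -> R) (B : R).
Hypothesis mep : measurable_fun setT ep.
Hypothesis epB : forall x, `|ep x| <= B.
Hypothesis ep0 : forall x, x <= 0 -> ep x = 0.

Lemma core_B_ge0 : 0 <= B. Proof. exact: le_trans (normr_ge0 _) (epB 0). Qed.

(** The Fourier transform of [ep], as a distribution, applied to [t |-> cexpi (y * t) * f t]. *)
Definition tpair (f : R -> C) (y : R) : C := cint (fun x => RtoC (ep (x + y)) * fourier f x).
Definition good (f : R -> C) := cnorm (tpair f y) @[y --> +oo] --> (0 : R).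
Definition locgood (t : R) := exists2 d : R, 0 < d &
  forall f, smooth f -> (forall x, d <= `|x - t| -> f x = 0) -> good f.

Lemma cM_ep (y : R) : cM (fun x : R => RtoC (ep (x + y)) : C).
Proof. by apply: cM_RtoC; apply: measurableT_comp => //; exact: measurable_funD. Qed.

Lemma tpair_integrand f y c : (forall x, cnorm (fourier f x) <= c * wt x) ->
  forall x, cnorm (RtoC (ep (x + y)) * fourier f x) <= B * c * wt x.
Proof. by move=> fc x; rewrite cnormM cnorm_RtoC -mulrA ler_pM ?cnorm_ge0. Qed.

Lemma tpair_cI f y : Tf f -> cI (fun x => RtoC (ep (x + y)) * fourier f x).
Proof.
move=> Tff; have [c _ fc] := fourier_wt Tff.
apply: cI_W; last exact: tpair_integrand fc.
by apply: cM_M; [exact: cM_ep|exact: cM_fourier].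
Qed.

Variables (psi : R -> C) (kp : R -> R).
Hypothesis psiT : Tf psi.
Hypothesis psi0 : forall x, 1 <= `|x| -> psi x = 0.
Hypothesis psiE : forall x, fourier psi x = RtoC (kp x).
Hypothesis kp0 : 0 < kp 0.

(** As a function of [s], the Fourier transform of the translate of [ep] by [y], mollified at scale
    [d]. *)
Definition tker (d s y : R) := tpair (dilate d s psi) y.

Lemma tkerE d s y : 0 < d ->
  tker d s y = cint (fun x => RtoC (ep (x + y)) * (cexpi (- (s * x)) * fourier psi (d * x))).
Proof. by move=> d0; apply: eq_cint => x; rewrite fourier_dilate. Qed.

Lemma dilate_hat_wt d : 0 < d -> exists2 c, 0 <= c & forall x, cnorm (fourier psi (d * x)) <= c * wt x.
Proof.
move=> d0; have [c c0 hc] := fourier_wt (Tf_dilate 0 d0 psiT); exists c => // x.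
by rewrite (le_trans _ (hc x))// fourier_dilate// mul0r oppr0 cexpi0 mul1r.
Qed.

Lemma tker_bound d : 0 < d -> exists2 c, 0 <= c & forall s y, cnorm (tker d s y) <= c.
Proof.
move=> d0; have [c c0 hc] := dilate_hat_wt d0.
exists (2 * (B * c) * W).
  by rewrite !mulr_ge0 ?core_B_ge0// ltW// rint_wt_gt0.
move=> s y; rewrite tkerE//; apply: cint_leW.
  apply: cM_M; first exact: cM_ep.
  apply: cM_M; first exact: cM_ker.
  by apply: cM_comp; [exact: cM_fourier|exact: measurable_funM].
by move=> x; rewrite cnormM cnorm_cexpiM cnorm_RtoC -mulrA ler_pM ?cnorm_ge0.
Qed.

Section Mollify.
Variables (f : R -> C) (d y : R).
Hypothesis Tff : Tf f.
Hypothesis d0 : 0 < d.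

Let F s x := f s * (RtoC (ep (x + y)) * (cexpi (- (s * x)) * fourier psi (d * x))).

Lemma mollify_cM2 : cM (fun z : R * R => F z.1 z.2).
Proof.
apply: cM_M; first by apply: cM_comp; [exact: Tf_cM|exact: measurable_fst].
apply: cM_M.
  by apply: (@cM_comp _ _ _ (fun x => RtoC (ep (x + y)))); [exact: cM_ep|exact: measurable_snd].
apply: cM_M.
  apply: cM_cexpi; apply: measurableT_comp => //; apply: measurable_funM.
    exact: measurable_fst.
  exact: measurable_snd.
apply: cM_comp; first exact: cM_fourier.
by apply: measurable_funM => //; exact: measurable_snd.
Qed.

Lemma mollify_bound : exists c, forall s x, cnorm (F s x) <= c * (wt s * wt x).
Proof.
have [mf [cf fc]] := Tf_cW Tff; have [c c0 hc] := dilate_hat_wt d0.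
exists (cf * (B * c)) => s x.
have -> : cf * (B * c) * (wt s * wt x) = (cf * wt s) * (B * (c * wt x)) by ring.
rewrite /F cnormM cnormM cnorm_cexpiM cnorm_RtoC ler_pM ?cnorm_ge0//.
  by rewrite mulr_ge0 ?cnorm_ge0.
by rewrite ler_pM ?cnorm_ge0.
Qed.

Lemma mollify_slice s : cint (F s) = f s * tker d s y.
Proof.
rewrite tkerE// -cintZ//; have [c c0 hc] := dilate_hat_wt d0.
apply: (@cI_W _ _ (B * c)).
  apply: cM_M; first exact: cM_ep.
  apply: cM_M; first exact: cM_ker.
  by apply: cM_comp; [exact: cM_fourier|exact: measurable_funM].
by move=> x; rewrite cnormM cnorm_cexpiM cnorm_RtoC -mulrA ler_pM ?cnorm_ge0.
Qed.

Lemma cM_mollify : cM (fun s => f s * tker d s y).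
Proof.
have [c hc] := mollify_bound.
apply: (cM_eq _ (cM_cint_fst mollify_cM2 hc)) => s; exact: mollify_slice.
Qed.

Lemma mollifyE : cint (fun s => f s * tker d s y) =
  cint (fun x => RtoC (ep (x + y)) * (RtoC (kp (d * x)) * fourier f x)).
Proof.
have [c hc] := mollify_bound.
under eq_cint do rewrite -mollify_slice.
rewrite (cint_Fubini mollify_cM2 hc); apply: eq_cint => x.
rewrite mulrA -cintZ; last by apply: cI_fourier; exact: Tf_cW.
apply: eq_cint => s; rewrite /F psiE (mulrC s x); ring.
Qed.
End Mollify.

(** The transform of [f] mollified at scale [d] is [kp (d * x)] times that of [f]. *)
Lemma mollify_approx f : Tf f -> forall e, 0 < e -> exists2 d0, 0 < d0 &
  forall d y, 0 < d -> d < d0 ->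
  cnorm (RtoC (kp 0) * tpair f y - cint (fun s => f s * tker d s y)) <= e.
Proof.
move=> Tff e e0; have [c c0 hc] := fourier_wt2 Tff.
have hd := hasd_fourier_Tf psiT.
have [D D0 hD] := Tf_bounded_fourier (Tf_mulX psiT).
have lip x : `|kp x - kp 0| <= D * `|x|.
  apply: (@lipschitz0 kp (fun x => Re (fourier (fun x : R => - ci * RtoC x * psi x) x))) => z.
    have [h _] := hd z; move: h; rewrite (_ : (fun _ => _) = kp)//.
    by apply/funext => u; rewrite psiE.
  exact: le_trans (cnorm_Re _) (hD z).
have W0 := @rint_wt_gt0 R.
pose K := 2 * (B * D * c) * W.
have K0 : 0 <= K by rewrite !mulr_ge0 ?core_B_ge0// ltW.
(* The summand [1] keeps the denominator positive when [K = 0]; the same device recurs below. *)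
exists (e / (K + 1)); first by rewrite divr_gt0// ltr_wpDl.
move=> d y d0 dlt; rewrite mollifyE// -cintZ; last exact: tpair_cI.
have mkp : cM (fun x => RtoC (kp x) : C).
  by apply: (cM_eq _ (cM_fourier psiT)) => x; rewrite psiE.
have mkpd : cM (fun x => RtoC (kp (d * x)) : C).
  by apply: (@cM_comp _ _ _ (fun x => RtoC (kp x))) => //; exact: measurable_funM.
have [ck ck0 hck] := dilate_hat_wt d0.
have [cf cf0 hcf] := fourier_wt Tff.
rewrite -cintB; last 2 first.
- by apply: cI_Z; exact: tpair_cI.
- apply: (@cI_W _ _ (B * (ck * cf))).
    by apply: cM_M; [exact: cM_ep|apply: cM_M => //; exact: cM_fourier].
  move=> x; rewrite cnormM cnorm_RtoC -mulrA ler_pM ?cnorm_ge0// cnormM -mulrA.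
  rewrite ler_pM ?cnorm_ge0// -psiE (le_trans (hck x))//.
  by rewrite ler_piMr ?wt_le1.
apply: (@le_trans _ _ (2 * (B * D * c * d) * W)); last first.
  have -> : 2 * (B * D * c * d) * W = K * d by rewrite /K; ring.
  have : d * (K + 1) < e by rewrite -ltr_pdivlMr// ltr_wpDl.
  rewrite mulrDr mulr1 mulrC; lra.
apply: cint_leW.
  apply: cM_D.
    apply: cM_M; first exact: cM_cst.
    by apply: cM_M; [exact: cM_ep|exact: cM_fourier].
  apply: cM_N; apply: cM_M; first exact: cM_ep.
  by apply: cM_M => //; exact: cM_fourier.
move=> x.
have -> : RtoC (kp 0) * (RtoC (ep (x + y)) * fourier f x) -
    RtoC (ep (x + y)) * (RtoC (kp (d * x)) * fourier f x) =
  RtoC (ep (x + y)) * (RtoC (kp 0 - kp (d * x)) * fourier f x).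
  by rewrite RtoCB; ring.
rewrite !cnormM !cnorm_RtoC.
have -> : B * D * c * d * wt x = B * (D * d * (c * wt x)) by ring.
apply: ler_pM => //; first by rewrite mulr_ge0 ?cnorm_ge0.
(* The Lipschitz bound on [kp] gives a gain [d] at the price of [|x|], which one of the two factors
   [wt x] absorbs. *)
apply: (@le_trans _ _ (D * (d * `|x|) * (c * wt x ^+ 2))).
  rewrite ler_pM ?cnorm_ge0// distrC (le_trans (lip _))//.
  by rewrite normrM (gtr0_norm d0).
have -> : D * (d * `|x|) * (c * wt x ^+ 2) = D * d * (c * wt x) * (`|x| * wt x) by ring.
have -> : D * d * (c * wt x) = D * d * (c * wt x) * 1 by rewrite mulr1.
rewrite mulr1 ler_piMr ?mulr_ge0 ?wt_ge0 ?(ltW d0)//.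
rewrite mulrC /wt ler_pdivrMl ?ltr_pwDl ?sqr_ge0// mulr1.
have := sqr_ge0 (`|x| - 1); rewrite sqrrB1 real_normK ?num_real// -mulr_natl.
have := normr_ge0 x; lra.
Qed.

Lemma dilate_support d s x : 0 < d -> d <= `|x - s| -> dilate d s psi x = 0.
Proof.
move=> d0 h; rewrite /dilate psi0 ?mulr0// normrM gtr0_norm ?invr_gt0//.
by rewrite -ler_pdivrMl ?invr_gt0// invrK mulr1.
Qed.

(** Compactness makes the radius uniform, as with a Lebesgue number. *)
Lemma locgood_segment (p q : R) : (forall t, p <= t <= q -> locgood t) ->
  exists2 dl, 0 < dl & forall s d f, p <= s <= q -> d <= dl -> smooth f ->
    (forall x, d <= `|x - s| -> f x = 0) -> good f.
Proof.
move=> lg.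
have /compact_near_coveringP := @segment_compact R p q.
move=> /(_ R (0 : R)^'+ (fun dl s => forall f, smooth f ->
  (forall x, dl <= `|x - s| -> f x = 0) -> good f) _) h.
have : \forall dl \near (0 : R)^'+, `[p, q] `<=` (fun s => forall f, smooth f ->
  (forall x, dl <= `|x - s| -> f x = 0) -> good f).
  apply: h => t; rewrite /= in_itv /= => pq.
  have [d d0 hd] := lg t pq.
  (* Half of [d] is allowed for displacing the centre, half for the radius of the support. *)
  near=> s dl => f sf f0; apply: hd => // x xt; apply: f0 => /=.
  have h1 : `|t - s| < d / 2.
    by near: s; apply: nbhsx_ballx; rewrite divr_gt0.
  have h2 : dl < d / 2 by near: dl; apply: nbhs_right_lt; rewrite divr_gt0.
  have := ler_normD (x - s) (s - t); rewrite subrKA [`|s - t|]distrC; lra.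
move=> -[e /= e0 he].
exists (e / 2); first by rewrite divr_gt0.
move=> s d f pq de sf f0.
have e20 : 0 < e / 2 by rewrite divr_gt0.
have be : `|0 - e / 2| < e.
  by rewrite sub0r normrN gtr0_norm// ltr_pdivrMr// ltr_pMr// ltr1n.
have sI : `[p, q]%classic s by rewrite /= in_itv.
exact: (he _ be e20 s sI f sf (fun x hx => f0 x (le_trans de hx))).
Unshelve. all: by end_near.
Qed.

Lemma good_of_approx f : Tf f -> (forall e, 0 < e -> \forall y \near +oo, cnorm (tpair f y) <= e) -> good f.
Proof.
move=> Tff h; apply/cvgrPdist_le => e e0.
by apply: filterS (h e e0) => y; rewrite sub0r normrN ger0_norm ?cnorm_ge0.
Qed.

(** Mollification plays the part of a partition of unity: uniformly in [y], the pairing with [f] is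
    nearly a superposition of pairings with bumps centred in the segment. Each of these tends to
    [0], and dominated convergence in the centre concludes. *)
Lemma good_segment f (p q : R) : smooth f -> (forall t, p <= t <= q -> locgood t) ->
  (forall x, ~~ (p <= x <= q) -> f x = 0) -> good f.
Proof.
move=> sf lg f0.
have Tff : Tf f.
  split => //; exists (Num.max `|p| `|q| + 1) => x xl; apply: f0; apply/negP => /andP[px xq].
  have : `|x| <= Num.max `|p| `|q|.
    rewrite le_max; have [x0|x0] := leP 0 x.
      by apply/orP; right; rewrite (ger0_norm x0) (le_trans xq)// ler_norm.
    apply/orP; left; rewrite (ltr0_norm x0) (@ltr0_norm _ p) ?lerN2//.
    exact: le_lt_trans px x0.
  lra.
have [mf [cf fc]] := Tf_cW Tff.
have [dl dl0 hdl] := locgood_segment lg.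
apply: good_of_approx => // e e0.
have [d0 d00 hd0] := mollify_approx Tff (e := kp 0 * e / 2) ltac:(by rewrite divr_gt0// mulr_gt0).
pose d := Num.min (d0 / 2) dl.
have dpos : 0 < d by rewrite lt_min dl0 divr_gt0.
have dd0 : d < d0 by rewrite gt_min; apply/orP; left; rewrite ltr_pdivrMr// ltr_pMr// ltr1n.
have ddl : d <= dl by rewrite ge_min lexx orbT.
have [cd cd0 hcd] := tker_bound dpos.
have hk : cnorm (cint (fun s => f s * tker d s y)) @[y --> +oo] --> (0 : R).
  apply: (@cvgy_DCT _ _ (cf * cd)).
  - by move=> y; exact: cM_mollify.
  - move=> y s; rewrite cnormM.
    have -> : cf * cd * wt s = (cf * wt s) * cd by ring.
    by rewrite ler_pM ?cnorm_ge0.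
  - move=> s; under eq_fun do rewrite cnormM.
    have [sp|sp] := boolP (p <= s <= q); last first.
      by rewrite f0// cnorm0; under eq_fun do rewrite mul0r; exact: cvg_cst.
    have g : good (dilate d s psi).
      apply: (hdl s d) => //; first by have [] := Tf_dilate s dpos psiT.
      by move=> x; exact: dilate_support.
    rewrite -[X in nbhs X](mulr0 (cnorm (f s))); apply: cvgM => //; exact: cvg_cst.
have ke0 : 0 < kp 0 * e / 2 by rewrite divr_gt0// mulr_gt0.
have /cvgrPdist_le/(_ _ ke0) := hk; apply: filterS => y.
rewrite sub0r normrN ger0_norm ?cnorm_ge0// => h1.
have h2 := hd0 d y dpos dd0.
rewrite -(ler_pM2l kp0) -{1}(gtr0_norm kp0) -cnorm_RtoC -cnormM.
have := cnormD (RtoC (kp 0) * tpair f y - cint (fun s => f s * tker d s y)) (cint (fun s => f s * tker d s y)).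
rewrite subrK; lra.
Qed.

(** Condition (III) transferred from [dS] to [ep]: a bound on the primitive of [ep(u) exp(-iku)]. *)
Definition bounded_at (k M : R) :=
  forall x, 0 < x -> cnorm (fourier (fun u => RtoC (chi 0 x u * ep u)) k) <= M.

(** Integration by parts moves the derivative from the primitive of [ep(u) exp(-iku)], bounded by
    [M], to the kernel [g]; the integral of [|g'|] has a bound free of [d], [s] and [y]. As [ep] is
    merely measurable, the parts formula is obtained by writing [g (u - y)] as minus the integral of
    [g' (v - y)] over [v > u] and exchanging integrals. *)
Lemma tker_near_bounded : exists2 C1, 0 <= C1 & forall k M d s y, 0 <= M ->
  bounded_at k M -> 0 < d -> d <= 1 -> `|s - k| <= 2 * d -> cnorm (tker d s y) <= C1 * M.
Proof.
have Tp' := Tf_mulX psiT.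
have hd := hasd_fourier_Tf psiT; have hd' := hasd_fourier_Tf Tp'.
set psi' := fun x : R => - ci * RtoC x * psi x in Tp' hd hd'.
have hd'' := hasd_fourier_Tf (Tf_mulX Tp').
have [c c0 hc] := fourier_wt2 psiT; have [c' c'0 hc'] := fourier_wt2 Tp'.
pose K := 2 * c + c'.
have K0 : 0 <= K by rewrite addr_ge0 ?mulr_ge0.
have W0 := @rint_wt_gt0 R.
exists (2 * (K * W)); first by rewrite !mulr_ge0// ltW.
move=> k M d s y M0 bM d0 d1 sk.
pose g x := cexpi (- (s - k) * x) * fourier psi (d * x + 0).
pose g' x := RtoC (- (s - k)) * ci * cexpi (- (s - k) * x) * fourier psi (d * x + 0)
   + cexpi (- (s - k) * x) * (RtoC d * fourier psi' (d * x + 0)).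
have hg : hasd g g' by apply: hasd_M; [exact: hasd_cexpi_lin|exact: hasd_affine].
have [g'' hg'] : exists g'', hasd g' g''.
  eexists; apply: hasd_D.
    apply: hasd_M; last exact: hasd_affine hd.
    exact: hasd_Z (hasd_cexpi_lin _).
  apply: hasd_M; first exact: hasd_cexpi_lin.
  exact: hasd_Z (hasd_affine d 0 hd').
(* Differentiating the modulation costs [|s - k| <= 2 * d], differentiating the dilated transform
   costs [d]. This common factor offsets the width [1 / d] of the kernel. *)
have g'K x : cnorm (g' x) <= d * K * wt (d * x) ^+ 2.
  rewrite (le_trans (cnormD _ _))// !cnormM !cnorm_cexpi cnorm_ci !cnorm_RtoC !mulr1 mul1r normrN addr0.
  rewrite (gtr0_norm d0).
  have -> : d * K * wt (d * x) ^+ 2 = 2 * d * (c * wt (d * x) ^+ 2) + d * (c' * wt (d * x) ^+ 2).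
    by rewrite /K; ring.
  by rewrite lerD// ler_pM ?cnorm_ge0// ltW.
have wtd x : wt (d * x) <= d ^- 2 * wt x.
  rewrite /wt -invfM lef_pV2 ?posrE ?mulr_gt0 ?exprn_gt0 ?ltr_pwDl ?sqr_ge0//.
  rewrite mulrDr mulr1 exprMn lerD2r -[leRHS](expr1n _ 2).
  by rewrite ler_pXn2r ?nnegrE ?(ltW d0).
have wt2_1 (x : R) : wt x ^+ 2 <= wt x by rewrite expr2 ler_piMr ?wt_ge0 ?wt_le1.
(* From [d <= 1] and Peetre's inequality. The constants built on [Z] depend on [d] and [y] and serve
   integrability alone; the final estimate returns to [g'K]. *)
pose Z := d ^- 2 * (2 * (1 + (- y) ^+ 2)).
have d2 : 0 <= d ^- 2 by rewrite invr_ge0 exprn_ge0// ltW.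
have Z0 : 0 <= Z by rewrite mulr_ge0// mulr_ge0// addr_ge0// sqr_ge0.
have wtZ v : wt (d * (v - y)) <= Z * wt v.
  rewrite (le_trans (wtd _))// /Z -mulrA; apply: ler_wpM2l => //; exact: wt_shift.
have dK0 : 0 <= d * K by exact: mulr_ge0 (ltW d0) K0.
pose c2 := d * K * Z ^+ 2.
have c20 : 0 <= c2 by apply: mulr_ge0 => //; exact: sqr_ge0.
have g'2 v : cnorm (g' (v - y)) <= c2 * wt v ^+ 2.
  have -> : c2 * wt v ^+ 2 = d * K * (Z * wt v) ^+ 2 by rewrite /c2 -[LHS]mulrA -exprMn.
  apply: (le_trans (g'K _)); apply: ler_wpM2l => //.
  by rewrite ler_pXn2r ?nnegrE ?wt_ge0// mulr_ge0// wt_ge0.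
pose c3 := c * Z.
have g3 v : cnorm (g (v - y)) <= c3 * wt v.
  rewrite cnorm_cexpiM addr0 (le_trans (hc _))// /c3 -mulrA; apply: ler_wpM2l => //.
  exact: le_trans (wt2_1 _) (wtZ v).
clearbody c2 c3.
have hG : hasd (fun v => g (v - y)) (fun v => g' (v - y)).
  by apply: (hasd_eq _ _ (hasd_affine 1 (- y) hg)) => v; rewrite ?RtoC1 !mul1r.
have hG' : hasd (fun v => g' (v - y)) (fun v => g'' (v - y)).
  by apply: (hasd_eq _ _ (hasd_affine 1 (- y) hg')) => v; rewrite ?RtoC1 !mul1r.
have GE u : g (u - y) = - cint (fun v => RtoC (stp u v) * g' (v - y)).
  rewrite (@cint_halfline _ (fun v => g (v - y)) _ _ u c2 c3 hG hG') ?opprK//.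
  by move=> v _; rewrite (le_trans (g'2 v))// ler_wpM2l.
have mg : cM g by exact: hasd_cM hg.
have mg' : cM g' by exact: hasd_cM hg'.
pose e u := RtoC (ep u) * cexpi (- (k * u)).
have me : cM e by apply: cM_M; [exact: cM_RtoC|exact: cM_ker].
have eB u : cnorm (e u) <= B by rewrite cnormM cnorm_cexpi mulr1 cnorm_RtoC.
have -> : tker d s y = cexpi (k * y) * cint (fun u => e u * g (u - y)).
  rewrite -cintZ; last first.
    apply: (@cI_W _ _ (B * c3)).
      apply: cM_M => //; apply: (cM_comp mg); exact: measurable_funB.
    by move=> u; rewrite cnormM -mulrA ler_pM ?cnorm_ge0.
  rewrite tkerE// -[RHS](cint_shift y); last first.
    apply: cI_Z; apply: (@cI_W _ _ (B * c3)).
      apply: cM_M => //; apply: (cM_comp mg); exact: measurable_funB.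
    by move=> u; rewrite cnormM -mulrA ler_pM ?cnorm_ge0.
  apply: eq_cint => x; rewrite addrK /e /g addr0.
  have -> : - (s * x) = - (k * (x + y)) + - (s - k) * x + k * y by ring.
  rewrite !cexpiD; ring.
rewrite cnorm_cexpiM.
pose F u v := e u * (RtoC (stp u v) * g' (v - y)).
have mF : cM (fun z : R * R => F z.1 z.2).
  apply: cM_M; first by apply: (cM_comp me); exact: measurable_fst.
  apply: cM_M.
    apply: cM_RtoC.
    have -> : (fun z : R * R => stp z.1 z.2) = \1_[set z : R * R | z.1 < z.2].
      by apply/funext => z; rewrite indicE /stp; congr (nat_of_bool _)%:R; apply/idP/idP; rewrite inE.
    apply: measurable_indic.
    have := @measurable_fun_ltr _ _ R setT (fst : R * R -> R) (snd : R * R -> R) measurable_fst measurable_snd.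
    move=> /(_ measurableT [set true]) => /(_ ltac:(by [])).
    by rewrite setTI.
  by apply: (cM_comp mg'); apply: measurable_funB => //; exact: measurable_snd.
(* Only [0 < u < v] matters, and there [wt v <= wt u]: one of the two factors [wt v] is traded for
   [wt u]. *)
have FC u v : cnorm (F u v) <= B * c2 * (wt u * wt v).
  have rhs0 : 0 <= B * c2 * (wt u * wt v) by rewrite !mulr_ge0 ?wt_ge0// core_B_ge0.
  have [u0|u0] := leP u 0; first by rewrite /F /e ep0// RtoC0 !mul0r cnorm0.
  rewrite /F !cnormM !cnorm_RtoC cnorm_cexpi mulr1 /stp.
  have [uv|uv] := ltP u v; last by rewrite normr0 mul0r mulr0.
  rewrite normr1 mul1r -mulrA ler_pM ?cnorm_ge0//.
  rewrite (le_trans (g'2 v))// ler_wpM2l// expr2 ler_wpM2r ?wt_ge0//.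
  rewrite /wt lef_pV2 ?posrE ?ltr_pwDl ?sqr_ge0// lerD2l ler_pXn2r ?nnegrE//; try exact: ltW.
  by rewrite ltW// (lt_trans u0).
have -> : cint (fun u => e u * g (u - y)) = - cint (fun u => cint (fun v => F u v)).
  rewrite -cintN; last first.
    apply: (@cI_W _ _ (2 * (B * c2) * W)); first exact: (cM_cint_fst mF FC).
    move=> u; have -> : 2 * (B * c2) * W * wt u = 2 * (B * c2 * wt u) * W by ring.
    apply: cint_leW; last by move=> v; rewrite -mulrA.
    apply: cM_M; first exact: cM_cst.
    by apply: cM_M; [apply: cM_RtoC; exact: measurable_stp|apply: (cM_comp mg'); exact: measurable_funB].
  apply: eq_cint => u; rewrite GE mulrN; congr (- _); rewrite -cintZ//.
  apply: (@cI_W _ _ c2).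
    by apply: cM_M; [apply: cM_RtoC; exact: measurable_stp|apply: (cM_comp mg'); exact: measurable_funB].
  move=> v; rewrite cnormM cnorm_RtoC -[leRHS]mul1r.
  apply: ler_pM; rewrite ?cnorm_ge0 ?stp_le1//.
  apply: (le_trans (g'2 v)); exact: ler_wpM2l.
rewrite cnormN (cint_Fubini mF FC).
have HE v : cint (fun u => F u v) = g' (v - y) * cint (fun u => e u * RtoC (stp u v)).
  have [v0|v0] := leP v 0.
    have z u : e u * RtoC (stp u v) = 0.
      rewrite /stp; case: ltP => uv; last by rewrite mulr0.
      by rewrite /e ep0 ?RtoC0 ?mul0r// ltW// (lt_le_trans uv).
    rewrite (_ : (fun u => F u v) = fun=> 0); last first.
      by apply/funext => u; rewrite /F mulrA z mul0r.
    by rewrite (_ : (fun u => _ * _) = fun=> 0) ?cint0 ?mulr0//; apply/funext => u; exact: z.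
  rewrite -cintZ; last first.
    apply: (@cI_W _ _ (B * (1 + v ^+ 2))).
      by apply: cM_M => //; apply: cM_RtoC; exact: measurable_stp_fst.
    move=> u; rewrite cnormM cnorm_RtoC -mulrA.
    have w0 : 0 <= (1 + v ^+ 2) * wt u by rewrite mulr_ge0 ?wt_ge0// addr_ge0 ?sqr_ge0.
    rewrite /stp; have [uv|uv] := ltP u v; last by rewrite normr0 mulr0 mulr_ge0// core_B_ge0.
    have [u0|u0] := leP u 0; first by rewrite /e ep0// RtoC0 mul0r cnorm0 mul0r mulr_ge0// core_B_ge0.
    rewrite normr1 ler_pM ?cnorm_ge0// -ler_pdivrMl ?ltr_pwDl ?sqr_ge0// mulr1.
    by apply: wt_ge; rewrite gtr0_norm// ltW.
  by apply: eq_cint => u; rewrite /F; ring.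
have HB v : 0 < v -> cnorm (cint (fun u => e u * RtoC (stp u v))) <= M.
  move=> v0; apply: le_trans (bM v v0); rewrite le_eqVlt; apply/orP; left; apply/eqP; congr cnorm.
  (* [chi 0 v] contains the endpoint [u = v], which [stp u v] leaves out. *)
  apply: (@cint_eq1 v).
  - by apply: cM_M => //; apply: cM_RtoC; exact: measurable_stp_fst.
  - apply: cM_fourier_integrand; apply: cM_RtoC; apply: measurable_funM => //.
    exact: measurable_chi.
  - move=> u uv; rewrite /e /chi /stp.
    have [u0|u0] := leP u 0; first by rewrite ep0// !(RtoC0, mul0r, mulr0).
    rewrite [u < v]lt_neqAle uv /= RtoCM; ring.
(* The substitution [d * v - d * y] removes both the scale and the translation from the bound. *)
have -> : 2 * (K * W) * M = 2 * rint (fun v => M * (d * K * wt (d * v + - (d * y)))).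
  rewrite rintZ; last by apply: rIZ; apply: rI_affine; [rewrite gt_eqF|exact: rI_wt].
  rewrite rintZ; last by apply: rI_affine; [rewrite gt_eqF|exact: rI_wt].
  have := @rint_affine R d (- (d * y)) (@wt R) ltac:(by rewrite gt_eqF) (@rI_wt R).
  rewrite gtr0_norm// => <-; ring.
under eq_cint do rewrite HE.
apply: cint_le.
- by under eq_fun do rewrite -HE; exact: (cM_cint_snd mF FC).
- apply: rIZ; apply: rIZ; apply: rI_affine; [by rewrite gt_eqF|exact: rI_wt].
- move=> v; rewrite -mulrBr.
  have dK : cnorm (g' (v - y)) <= d * K * wt (d * (v - y)).
    rewrite (le_trans (g'K _))// ler_wpM2l// mulr_ge0// ltW.
  have [v0|v0] := leP v 0.
    rewrite -HE (_ : (fun u => F u v) = fun=> 0); last first.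
      apply/funext => u; rewrite /F /stp; case: ltP => uv; last by rewrite RtoC0 mul0r mulr0.
      by rewrite /e ep0 ?RtoC0 ?mul0r// ltW// (lt_le_trans uv).
    by rewrite cint0 cnorm0 !mulr_ge0 ?wt_ge0// ltW.
  by rewrite cnormM mulrC ler_pM ?cnorm_ge0// HB.
Qed.


Definition thick (K : set R) (d : R) : set R := [set s | exists2 k, K k & `|s - k| < d].

Lemma open_thick K d : open (thick K d).
Proof.
rewrite openE => s [k Kk sk]; rewrite /interior.
have h : 0 < d - `|s - k| by rewrite subr_gt0.
have := nbhsx_ballx s _ h; apply: filterS => z; rewrite /ball /= => sz.
exists k => //; have := ler_normD (z - s) (s - k); rewrite subrKA [`|z - s|]distrC; lra.
Qed.

Lemma measurable_thick K d : measurable (thick K d).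
Proof. by apply: open_measurable; exact: open_thick. Qed.

(** Continuity from above: the neighbourhoods of the closed set [K] shrink to [K], and the bounded
    window supplies finite measure. *)
Lemma thick_small (K : set R) (c rho : R) : closed K -> mu K = 0%E ->
  forall e, 0 < e -> exists2 d0 : R, 0 < d0 & forall d, 0 < d -> d <= d0 ->
    rint (\1_(thick K d `&` `[c - rho, c + rho]) : R -> R) <= e.
Proof.
move=> cK K0 e e0; pose J := `[c - rho, c + rho]%classic.
pose A n := thick K n.+1%:R^-1 `&` J.
have mJ : measurable J by exact: measurable_itv.
have mA d : measurable (thick K d `&` J) by apply: measurableI => //; exact: measurable_thick.
have muJ : (mu J < +oo)%E.
  by rewrite /J lebesgue_measure_itv /=; case: ifP => _; rewrite ?ltry// -EFinD ltry.
have AS n m : (n <= m)%N -> A m `<=` A n.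
  move=> nm s [[k Kk sk] Js]; split => //; exists k => //.
  by rewrite (lt_le_trans sk)// lef_pV2 ?posrE// ler_nat ltnS.
have capA : \bigcap_n A n `<=` K.
  move=> s hs; have := cK; rewrite closedE; apply => nK.
  move: nK => [r /= r0 hr].
  have /cvgrPdist_lt/(_ r r0)[N _ hN] := @cvg_harmonic R.
  have := hN N (leqnn N); rewrite sub0r normrN /harmonic gtr0_norm ?invr_gt0// => hNr.
  have [[k Kk sk] _] := hs N I.
  by apply: (hr k) Kk; rewrite /ball_ /= (lt_trans sk).
have mcap : measurable (\bigcap_n A n) by apply: bigcap_measurable => // n _; exact: mA.
have cap0 : mu (\bigcap_n A n) = 0%E.
  apply/eqP; rewrite eq_le measure_ge0 andbT -K0; apply: le_measure => //.
  - by rewrite inE.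
  - by rewrite inE; exact: closed_measurable.
have cvgA : mu (A n) @[n --> \oo] --> 0%E.
  rewrite -cap0; apply: nonincreasing_cvg_mu => //.
  - by rewrite (le_lt_trans _ muJ)//; apply: le_measure; rewrite ?inE//; [exact: mA|exact: subIsetr].
  - by move=> n; exact: mA.
  - by move=> n m nm; apply/subsetPset; exact: AS.
have e0' : (0 < e%:E)%E by rewrite lte_fin.
have [N hN] : exists N, (mu (A N) < e%:E)%E.
  have : nbhs (0%E : \bar R) [set y | (y < e%:E)%E].
    by apply: open_nbhs_nbhs; split => //; exact: lray_open.
  by move=> /cvgA[N _ hN]; exists N; exact: (hN N (leqnn N)).
exists N.+1%:R^-1; first by rewrite invr_gt0.
move=> d d0 dN; rewrite /rint /Rintegral.
rewrite integral_indic ?setIT//; last exact: mA.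
rewrite -lee_fin fineK; last first.
  rewrite ge0_fin_numE//; apply: le_lt_trans muJ.
  by apply: le_measure; rewrite ?inE; [exact: mA|exact: mJ|exact: subIsetr].
apply: le_trans (ltW hN); apply: le_measure; rewrite ?inE; [exact: mA|exact: mA|].
move=> s [[k Kk sk] Js]; split => //; exists k => //; exact: lt_le_trans sk dN.
Qed.

(** Let [K], a subset of [E], be the set of points that are not locally good.  If
    [K] is nonempty, Baire's theorem yields an interval around a point of [K] on
    which the bounds of the last hypothesis are uniform over [K].  Mollify [f] at
    scale [d]: the translates of the kernel centred at distance [< 2d] from [K]
    contribute a bounded multiple of the measure of a neighbourhood of the null
    set [K], and the other translates are good. *)
Lemma good_everywhere (E : set R) : closed E -> mu E = 0%E ->
  (forall t, ~ E t -> locgood t) ->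
  (forall t, E t -> exists M, bounded_at t M) ->
  forall f, Tf f -> good f.
Proof.
move=> cE E0 lgE bE f [sf [a f0]].
suff lg t : locgood t.
  apply: (@good_segment f (- a) a) => // x /negP h; apply: f0.
  by rewrite leNgt; apply/negP => /ltW; rewrite ler_norml.
apply: contrapT => nlg.
pose K : set R := [set t | ~ locgood t].
have KE : K `<=` E by move=> s Ks; apply: contrapT => /lgE.
have oK x : ~ K x -> exists2 r, 0 < r & forall z, `|z - x| < r -> ~ K z.
  move=> /contrapT[d d0 hd]; exists (d / 2); first by rewrite divr_gt0.
  move=> z zx; apply; exists (d / 2); first by rewrite divr_gt0.
  move=> g sg g0; apply: hd => // u ux; apply: g0.
  have := ler_normD (u - z) (z - x); rewrite subrKA; lra.
have cK : closed K.
  rewrite -(setCK K); apply: open_closedC; rewrite openE => x /oK[r r0 hr].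
  rewrite /interior; have := nbhsx_ballx x _ r0; apply: filterS => z.
  by rewrite /ball /= distrC; exact: hr.
have K0 : mu K = 0%E.
  apply/eqP; rewrite eq_le measure_ge0 andbT -E0; apply: le_measure => //; rewrite inE.
    exact: closed_measurable.
  exact: closed_measurable.
pose F (n : nat) : set R := [set k | bounded_at k n%:R].
(* For a fixed truncation [v] the transform is continuous in the frequency, so exceeding [n] at [x]
   persists nearby. *)
have oF n x : ~ F n x -> exists2 r, 0 < r & forall z, `|z - x| < r -> ~ F n z.
  move=> /existsNP[v /not_implyP[v0 /negP]]; rewrite -ltNge => hv.
  pose q u := RtoC (chi 0 v u * ep u) : C.
  have mq : cM q by apply: cM_RtoC; apply: measurable_funM => //; exact: measurable_chi.
  have qc u : cnorm (q u) <= B * (1 + v ^+ 2) * wt u.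
    rewrite cnorm_RtoC normrM /chi; have [u0|u0] := ltP 0 u; last first.
      by rewrite normr0 mul0r !mulr_ge0 ?wt_ge0 ?core_B_ge0// addr_ge0 ?sqr_ge0.
    case: (leP u v) => uv; last first.
      by rewrite normr0 mul0r !mulr_ge0 ?wt_ge0 ?core_B_ge0// addr_ge0 ?sqr_ge0.
    rewrite normr1 mul1r (le_trans (epB u))// -mulrA ler_peMr ?core_B_ge0//.
    rewrite -ler_pdivrMl ?ltr_pwDl ?sqr_ge0// mulr1.
    by apply: wt_ge; rewrite gtr0_norm.
  have qc2 u : `|u| * cnorm (q u) <= `|v| * (B * (1 + v ^+ 2)) * wt u.
    have [uv|uv] := leP `|u| `|v|.
      by rewrite -mulrA ler_pM ?cnorm_ge0.
    rewrite (_ : q u = 0) ?cnorm0 ?mulr0; last first.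
      rewrite /q /chi; case: ltP => u0; last by rewrite mul0r.
      case: (leP u v) => uv'; last by rewrite mul0r.
      by move: uv; rewrite !gtr0_norm// ltNge uv'.
    by rewrite !mulr_ge0 ?wt_ge0 ?core_B_ge0// addr_ge0 ?sqr_ge0.
  have hq : hasd (fourier q) (fourier (fun x => - ci * RtoC x * q x)).
    apply: (@hasd_fourier _ _ (Num.max (B * (1 + v ^+ 2)) (`|v| * (B * (1 + v ^+ 2))))) => // u.
      by rewrite (le_trans (qc u))// ler_wpM2r ?wt_ge0// le_max lexx.
    by rewrite (le_trans (qc2 u))// ler_wpM2r ?wt_ge0// le_max lexx orbT.
  have [c1 c2] := hasd_continuous hq.
  pose e := (cnorm (fourier q x) - n%:R) / 2.
  have e0 : 0 < e by rewrite divr_gt0// subr_gt0.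
  have /cvgrPdist_lt/(_ e e0)[r1 /= r10 h1] := c1 x.
  have /cvgrPdist_lt/(_ e e0)[r2 /= r20 h2] := c2 x.
  exists (Num.min r1 r2); first by rewrite lt_min r10.
  move=> z; rewrite lt_min => /andP[zr1 zr2] Fz.
  have := Fz v v0; rewrite -/(q) => hz.
  have d1 : `|Re (fourier q x) - Re (fourier q z)| < e by apply: h1; rewrite /ball_ /= distrC.
  have d2 : `|Im (fourier q x) - Im (fourier q z)| < e by apply: h2; rewrite /ball_ /= distrC.
  have := cnormD (fourier q x - fourier q z) (fourier q z); rewrite subrK.
  have := cnorm_leReIm (fourier q x - fourier q z); rewrite !ReImE.
  move: hz d1 d2; rewrite /e -/(fourier q z); lra.
have KF x : K x -> exists n, F n x.
  move=> /KE/bE[M bM]; exists (Num.trunc `|M|).+1 => v v0.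
  rewrite (le_trans (bM v v0))// (le_trans (ler_norm M))// ltW//.
  by rewrite truncnS_gt.
have [n [c [r [Kc r0 hr]]]] := baire_line (nlg : K t) oK oF KF.
(* The contradiction: the point [c] of [K] turns out to be locally good, with half the radius from
   Baire's theorem. *)
apply: Kc; exists (r / 2); first by rewrite divr_gt0.
move=> h sh h0.
have Th : Tf h.
  split => //; exists (`|c| + r / 2) => x xl; apply: h0.
  have := ler_normD (x - c) c; rewrite subrK; lra.
have [mh [ch hch]] := Tf_cW Th; have [Mh Mh0 hMh] := Tf_bounded Th.
have [C1 C10 hC1] := tker_near_bounded.
pose D := 2 * (Mh * (C1 * n%:R)).
have D0 : 0 <= D by rewrite !mulr_ge0.
apply: good_of_approx => // e e0.
have ke0 : 0 < kp 0 * e / 3 by rewrite divr_gt0// mulr_gt0.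
have [d0 d00 hd0] := mollify_approx Th ke0.
have [d1 d10 hd1] := thick_small c (r / 2) cK K0 (divr_gt0 ke0 (ltr_wpDl D0 ltr01)).
(* In turn: accuracy of the mollification, small measure of the [2d]-neighbourhood of [K], the
   condition [d <= 1] of [tker_near_bounded], and [2d + r / 2 < r], which keeps the point of [K]
   near [s] inside the ball where bounds are uniform. *)
pose d := Num.min (Num.min (d0 / 2) (d1 / 2)) (Num.min 1 (r / 8)).
have dpos : 0 < d by rewrite !lt_min ltr01 !divr_gt0.
have dd0 : d <= d0 / 2 by rewrite /d !ge_min lexx.
have dd1 : d <= d1 / 2 by rewrite /d !ge_min lexx orbT.
have dle1 : d <= 1 by rewrite /d !ge_min lexx !orbT.
have dr : d <= r / 8 by rewrite /d !ge_min lexx !orbT.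
pose Wd := thick K (2 * d).
pose iW : R -> R := \1_Wd.
have miW : measurable_fun setT iW by apply: measurable_indic; exact: measurable_thick.
have ciW : cM (fun s => RtoC (iW s) : C) by exact: cM_RtoC.
have iWE s : iW s = 0 \/ (iW s = 1 /\ Wd s).
  rewrite /iW indicE; case: (boolP (s \in Wd)) => hs; [right|left] => //.
  by split => //; move: hs; rewrite inE.
have iW1 s : `|iW s| <= 1 by case: (iWE s) => [->|[-> _]]; rewrite ?normr0 ?normr1.
have iW1' s : `|1 - iW s| <= 1 by case: (iWE s) => [->|[-> _]]; rewrite ?subr0 ?subrr ?normr0 ?normr1.
have [cd cd0 hcd] := tker_bound dpos.
have hkc y s : cnorm (h s * tker d s y) <= ch * cd * wt s.
  rewrite cnormM.
  have -> : ch * cd * wt s = (ch * wt s) * cd by ring.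
  by rewrite ler_pM ?cnorm_ge0.
have far : cnorm (cint (fun s => RtoC (1 - iW s) * (h s * tker d s y))) @[y --> +oo] --> (0 : R).
  apply: (@cvgy_DCT _ _ (ch * cd)).
  - move=> y; apply: cM_M; last exact: cM_mollify.
    by apply: cM_RtoC; exact: measurable_funB.
  - move=> y s; rewrite cnormM cnorm_RtoC -[leRHS]mul1r.
    by apply: ler_pM; rewrite ?cnorm_ge0.
  - move=> s; under eq_fun do rewrite cnormM cnorm_RtoC cnormM mulrA.
    case: (boolP (s \in Wd)) => hs.
      rewrite /iW indicE hs subrr normr0 mul0r; under eq_fun do rewrite mul0r; exact: cvg_cst.
    have nW : ~ Wd s by move: hs; rewrite notin_setE.
    (* [s] is at distance at least [2d] from [K], so all of [[s - d, s + d]] is locally good. *)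
    have g : good (dilate d s psi).
      apply: (@good_segment _ (s - d) (s + d)); first by have [] := Tf_dilate s dpos psiT.
        move=> z zs; apply: contrapT => nz; apply: nW; exists z => //.
        have : `|s - z| <= d by rewrite distrC ler_distl.
        lra.
      move=> x xs; apply: dilate_support => //; rewrite leNgt; apply: contra xs => /ltW.
      by rewrite ler_distl.
    rewrite -[X in nbhs X](mulr0 (`|1 - iW s| * cnorm (h s))); apply: cvgM => //; exact: cvg_cst.
have near_bd y : cnorm (cint (fun s => RtoC (iW s) * (h s * tker d s y))) <= kp 0 * e / 3.
  pose A := thick K (2 * d) `&` `[c - r / 2, c + r / 2]%classic.
  have mA : measurable A by apply: measurableI; [exact: measurable_thick|exact: measurable_itv].
  have iA : rI (\1_A : R -> R).
    apply: (@rI_dom _ _ (1 + (`|c| + r / 2) ^+ 2)); first exact: measurable_indic.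
    move=> x; rewrite indicE; case: (boolP (x \in A)) => hx; last first.
      by rewrite normr0 mulr_ge0 ?wt_ge0// addr_ge0 ?sqr_ge0.
    rewrite normr1 -ler_pdivrMl ?ltr_pwDl ?sqr_ge0// mulr1; apply: wt_ge.
    move: hx; rewrite inE => -[_]; rewrite /= in_itv /= -ler_distl.
    have := ler_normD (x - c) c; rewrite subrK; lra.
  have h1 := hd1 (2 * d) ltac:(by rewrite mulr_gt0) ltac:(lra).
  rewrite -/A in h1.
  apply: (@le_trans _ _ (2 * rint (fun s => Mh * (C1 * n%:R) * \1_A s))); last first.
    rewrite rintZ// mulrA -/D.
    move: h1; rewrite ler_pdivlMr ?ltr_wpDl// => h1.
    apply: le_trans h1; rewrite mulrC ler_wpM2l ?lerDl//.
    by apply: Rintegral_ge0 => x _; exact: (ler0n R (x \in A)).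
  apply: cint_le.
  - by apply: cM_M => //; exact: cM_mollify.
  - exact: rIZ.
  - move=> s; rewrite cnormM cnorm_RtoC.
    have [->|[-> [k Kk sk]]] := iWE s.
      by rewrite normr0 mul0r mulr_ge0// ?indicE// !mulr_ge0.
    rewrite normr1 mul1r.
    have [sc|sc] := leP (r / 2) `|s - c|.
      by rewrite h0// mul0r cnorm0 mulr_ge0// ?indicE// !mulr_ge0.
    have sA : s \in A.
      by rewrite inE; split; [exists k|rewrite /= in_itv /= -ler_distl ltW].
    rewrite indicE sA mulr1 cnormM ler_pM ?cnorm_ge0//.
    suff bk : bounded_at k n%:R.
      exact: (hC1 k n%:R d s y (ler0n R n) bk dpos dle1 (ltW sk)).
    apply: hr => //; have := ler_normD (k - s) (s - c); rewrite subrKA [`|k - s|]distrC; lra.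
have /cvgrPdist_le/(_ _ ke0) := far; apply: filterS => y.
rewrite sub0r normrN ger0_norm ?cnorm_ge0// => hfar.
have hnear := near_bd y.
have happ := hd0 d y dpos ltac:(lra).
have spl : cint (fun s => h s * tker d s y) =
    cint (fun s => RtoC (iW s) * (h s * tker d s y)) +
    cint (fun s => RtoC (1 - iW s) * (h s * tker d s y)).
  rewrite -cintD.
  - by apply: eq_cint => s; rewrite -mulrDl -RtoCD addrC subrK RtoC1 mul1r.
  - apply: (@cI_W _ _ (ch * cd)); first by apply: cM_M => //; exact: cM_mollify.
    by move=> s; rewrite cnormM cnorm_RtoC -[leRHS]mul1r; apply: ler_pM; rewrite ?cnorm_ge0.
  - apply: (@cI_W _ _ (ch * cd)).
      by apply: cM_M; [apply: cM_RtoC; exact: measurable_funB|exact: cM_mollify].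
    by move=> s; rewrite cnormM cnorm_RtoC -[leRHS]mul1r; apply: ler_pM; rewrite ?cnorm_ge0.
rewrite -(ler_pM2l kp0) -{1}(gtr0_norm kp0) -cnorm_RtoC -cnormM.
have := cnormD (RtoC (kp 0) * tpair h y - cint (fun s => h s * tker d s y)) (cint (fun s => h s * tker d s y)).
have := cnormD (cint (fun s => RtoC (iW s) * (h s * tker d s y)))
    (cint (fun s => RtoC (1 - iW s) * (h s * tker d s y))).
rewrite -spl subrK; lra.
Qed.

End Core.

(** * Laplace-Stieltjes transforms *)

Lemma cint_RtoC {R : realType} (g : R -> R) : cint (fun x => RtoC (g x)) = RtoC (rint g).
Proof.
rewrite cintE; apply: complex_eq => //=.
rewrite -[RHS](mul0r (rint (@wt R))) -rintZ; last exact: rI_wt.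
by congr rint; apply/funext => x; rewrite mul0r.
Qed.

Section StieltjesParts.
Context {R : realType}.
Local Notation C := R[i].
Local Notation Re := complex.Re.
Local Notation Im := complex.Im.

Variables (S V : R -> R) (f f' f'' : R -> C) (a b D : R).
Hypothesis mS : measurable_fun setT S.
Hypothesis SV : forall x y, x <= y -> `|S x - S y| <= V y - V x.
Hypothesis hf : hasd f f'.
Hypothesis hf' : hasd f' f''.
Hypothesis f'D : forall x, a <= x -> x <= b -> cnorm (f' x) <= D.

Lemma chi_wt (p q u : R) : `|chi p q u| <= (1 + (Num.max `|p| `|q|) ^+ 2) * wt u.
Proof.
rewrite /chi; case: (boolP (_ && _)) => [/andP[pu uq]|_]; last first.
  by rewrite normr0 mulr_ge0 ?wt_ge0// addr_ge0 ?sqr_ge0.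
rewrite normr1 -ler_pdivrMl ?ltr_pwDl ?sqr_ge0// mulr1; apply: wt_ge.
rewrite le_max; have [u0|u0] := leP 0 u.
  by apply/orP; right; rewrite (ger0_norm u0) (le_trans uq)// ler_norm.
apply/orP; left; rewrite (ltr0_norm u0) (@ltr0_norm _ p) ?lerN2 ?ltW//.
exact: lt_trans pu u0.
Qed.

Lemma chi_dom (p q M : R) (g : R -> C) : cM g -> 0 <= M ->
  (forall u, p < u -> u <= q -> cnorm (g u) <= M) ->
  cI (fun u => RtoC (chi p q u) * g u).
Proof.
move=> mg M0 gM; apply: (@cI_W _ _ ((1 + (Num.max `|p| `|q|) ^+ 2) * M)).
  by apply: cM_M => //; apply: cM_RtoC; exact: measurable_chi.
move=> u; rewrite cnormM cnorm_RtoC mulrAC.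
rewrite {1}/chi; case: (boolP (_ && _)) => [/andP[pu uq]|_]; last first.
  by rewrite normr0 mul0r !mulr_ge0 ?wt_ge0// addr_ge0 ?sqr_ge0.
have := chi_wt p q u; rewrite /chi pu uq => h.
by apply: ler_pM; rewrite ?cnorm_ge0// gM.
Qed.

Lemma rint_chi (p q : R) : p <= q -> rint (chi p q) = q - p.
Proof.
move=> pq; rewrite -(@rint_chi_FTC R id (cst 1) p q pq).
- by congr rint; apply/funext => u; rewrite mulr1.
- by move=> x; exact: cvg_cst.
Qed.

Lemma rI_chi (p q : R) : rI (chi p q).
Proof. by apply: rI_dom (chi_wt p q); exact: measurable_chi. Qed.

Definition Sint (p q : R) : C := cint (fun u => RtoC (chi p q u) * (RtoC (S u) * f' u)).

Lemma D_ge0 : a <= b -> 0 <= D.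
Proof. by move=> ab; exact: le_trans (cnorm_ge0 _) (f'D (lexx a) ab). Qed.

Lemma V_nd x y : x <= y -> V x <= V y.
Proof. by move=> xy; rewrite -subr_ge0; exact: le_trans (normr_ge0 _) (SV xy). Qed.

Lemma Sint_cI p q : a <= p -> q <= b -> p <= q ->
  cI (fun u => RtoC (chi p q u) * (RtoC (S u) * f' u)).
Proof.
move=> ap qb pq; have D0 : 0 <= D by apply: D_ge0; lra.
apply: (@chi_dom _ _ ((`|S q| + (V q - V p)) * D)).
- by apply: cM_M; [exact: cM_RtoC|exact: hasd_cM hf'].
- by apply: mulr_ge0 => //; apply: addr_ge0 => //; rewrite subr_ge0 V_nd.
- move=> u pu uq; rewrite cnormM cnorm_RtoC; apply: ler_pM; rewrite ?cnorm_ge0//; last by apply: f'D; lra.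
  have := SV uq; have := V_nd (ltW pu).
  have := ler_normD (S u - S q) (S q); rewrite subrK; lra.
Qed.

(** The error is exactly the integral of [(S q - S u) * f' u] over []p, q]], and [|S q - S u|] is at
    most [V q - V p] there. *)
Lemma stieltjes_single p q : a <= p -> q <= b -> p <= q ->
  cnorm (f q * RtoC (S q) - f p * RtoC (S p) - Sint p q - f p * RtoC (S q - S p))
  <= 2 * (D * (V q - V p)) * (q - p).
Proof.
move=> ap qb pq; have D0 : 0 <= D by apply: D_ge0; lra.
have Vpq : 0 <= V q - V p by rewrite subr_ge0 V_nd.
have mf' : cM f' by exact: hasd_cM hf'.
have mSC : cM (fun u => RtoC (S u) : C) by exact: cM_RtoC.
have -> : f q * RtoC (S q) - f p * RtoC (S p) - Sint p q - f p * RtoC (S q - S p) =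
  cint (fun u => RtoC (chi p q u) * (RtoC (S q - S u) * f' u)).
  have -> : (fun u => RtoC (chi p q u) * (RtoC (S q - S u) * f' u)) =
    (fun u => RtoC (S q) * (RtoC (chi p q u) * f' u) - RtoC (chi p q u) * (RtoC (S u) * f' u)).
    by apply/funext => u; rewrite RtoCB; ring.
  have i1 : cI (fun u => RtoC (chi p q u) * f' u).
    by apply: (@chi_dom _ _ D) => // u pu uq; apply: f'D; lra.
  rewrite cintB; [|exact: cI_Z|exact: Sint_cI].
  rewrite cintZ// (cint_chi_FTC pq hf hf') -/(Sint p q) RtoCB; ring.
have -> : 2 * (D * (V q - V p)) * (q - p) = 2 * rint (fun u => D * (V q - V p) * chi p q u).
  by rewrite rintZ ?rint_chi ?mulrA//; exact: rI_chi.
apply: cint_le.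
- apply: cM_M; first by apply: cM_RtoC; exact: measurable_chi.
  by apply: cM_M => //; apply: cM_RtoC; exact: measurable_funB.
- by apply: rIZ; exact: rI_chi.
- move=> u; rewrite !cnormM !cnorm_RtoC /chi; case: (boolP (_ && _)) => [/andP[pu uq]|_]; last first.
    by rewrite normr0 mul0r mulr0.
  rewrite normr1 mul1r mulr1 mulrC; apply: ler_pM; rewrite ?cnorm_ge0//.
    by apply: f'D; lra.
  by have := SV uq; have := V_nd (ltW pu); rewrite distrC; lra.
Qed.

Lemma Sint_add p q r : a <= p -> p <= q -> q <= r -> r <= b ->
  Sint p r = Sint p q + Sint q r.
Proof.
move=> ap pq qr rb; rewrite /Sint -cintD; [|apply: Sint_cI; lra|apply: Sint_cI; lra].
apply: eq_cint => u; rewrite -mulrDl -RtoCD; congr (RtoC _ * _); rewrite /chi.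
have [pu|pu] := ltP p u; have [uq|uq] := leP u q; have [ur|ur] := leP u r; rewrite /= ?addr0 ?add0r//; lra.
Qed.

(** The increments of [V] telescope, leaving the mesh times the total variation. *)
Lemma stieltjes_sum (x : nat -> R) (m : R) n : x 0%N = a -> 
  (forall i, (i < n)%N -> x i <= x i.+1 /\ x i.+1 - x i <= m) -> x n <= b ->
  a <= x n /\
  cnorm (f (x n) * RtoC (S (x n)) - f a * RtoC (S a) - Sint a (x n)
    - \sum_(i < n) f (x i) * RtoC (S (x i.+1) - S (x i))) <= 2 * (D * (V (x n) - V a)) * m.
Proof.
move=> x0; elim: n => [|n IH] hx xb.
  rewrite x0 big_ord0 !subrr subr0 mulr0 mulr0 mul0r; split => //.
  rewrite sub0r cnormN /Sint (_ : (fun u => _) = fun=> 0) ?cint0 ?cnorm0//.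
  apply/funext => u; rewrite /chi; case: (ltP a u) => [au|au] /=; last by rewrite mul0r.
  by rewrite ?[u <= a]leNgt ?au mul0r.
have [xx xm] := hx n (leqnn _).
have [|ax IHn] := IH (fun i hi => hx i (ltnW hi)).
  exact: le_trans xx xb.
split; first exact: le_trans xx.
rewrite big_ord_recr /= (@Sint_add a (x n) (x n.+1))//.
have D0 : 0 <= D by apply: D_ge0; lra.
have h1 := stieltjes_single ax xb xx.
have Vn : 0 <= V (x n.+1) - V (x n) by rewrite subr_ge0 V_nd.
set A := f (x n) * RtoC (S (x n)) - f a * RtoC (S a) - Sint a (x n) - _ in IHn.
set B := f (x n.+1) * RtoC (S (x n.+1)) - f (x n) * RtoC (S (x n)) - _ - _ in h1.
have -> : f (x n.+1) * RtoC (S (x n.+1)) - f a * RtoC (S a) - (Sint a (x n) + Sint (x n) (x n.+1)) -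
    (\sum_(i < n) f (x i) * RtoC (S (x i.+1) - S (x i)) + f (x n) * RtoC (S (x n.+1) - S (x n))) = A + B.
  by rewrite /A /B; ring.
apply: le_trans (cnormD _ _) _.
have h2 : 2 * (D * (V (x n.+1) - V (x n))) * (x n.+1 - x n) <= 2 * (D * (V (x n.+1) - V (x n))) * m.
  by rewrite ler_wpM2l// !mulr_ge0.
have -> : 2 * (D * (V (x n.+1) - V a)) * m = 2 * (D * (V (x n) - V a)) * m + 2 * (D * (V (x n.+1) - V (x n))) * m by ring.
by apply: lerD => //; exact: le_trans h2.
Qed.

(** The integral exists by hypothesis, so one fine partition for each tolerance suffices; it is
    taken uniform and tagged at left endpoints, as in [stieltjes_sum]. *)
Lemma is_RS_parts I : a < b -> is_RS f S a b I ->
  I = f b * RtoC (S b) - f a * RtoC (S a) - Sint a b.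
Proof.
move=> ab hI; apply/eqP; rewrite -subr_eq0; apply/eqP/cnorm_eq0/eqP.
rewrite eq_le cnorm_ge0 andbT; apply/ler_addgt0Pr => e e0; rewrite add0r.
have e20 : 0 < e / 2 by rewrite divr_gt0.
have [d [d0 hd]] := hI _ e20.
have D0 : 0 <= D by apply: D_ge0; exact: ltW.
pose K := 2 * (D * (V b - V a)).
have K0 : 0 <= K by rewrite !mulr_ge0// subr_ge0 V_nd// ltW.
pose m := Num.min (d / 2) (e / 2 / (K + 1)).
have m0 : 0 < m by rewrite lt_min !divr_gt0// ltr_wpDl.
pose n := (Num.trunc ((b - a) / m)).+1.
have n0 : 0 < n%:R :> R by rewrite ltr0n.
pose h := (b - a) / n%:R.
have ba : 0 < b - a by rewrite subr_gt0.
have h0 : 0 < h by rewrite divr_gt0.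
have hm : h <= m.
  rewrite /h ler_pdivrMr// mulrC -ler_pdivrMr// ltW//.
  exact: truncnS_gt.
pose x (i : nat) := a + i%:R * h.
have x0 : x 0%N = a by rewrite /x mul0r addr0.
have xS i : x i.+1 - x i = h by rewrite /x -natr1; ring.
have xn : x n = b by rewrite /x /h mulrCA mulfV ?mulr1 ?subrKC// gt_eqF.
have xx i : x i <= x i.+1 by rewrite -subr_ge0 xS ltW.
have [_] := @stieltjes_sum x m n x0 (fun i _ => conj (xx i) (eq_rect_r (fun z => z <= m) hm (xS i))) ltac:(by rewrite xn).
rewrite xn => h1.
have md : m <= d / 2 by rewrite ge_min lexx.
have mK : m <= e / 2 / (K + 1) by rewrite ge_min lexx orbT.
have hx i : (i < n)%N -> x i <= x i <= x i.+1 /\ x i.+1 - x i < d.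
  by move=> _; rewrite lexx xx xS; split => //; lra.
have := hd n x x x0 xn hx.
set Sg := \sum_(i < n) _ in h1 *; move=> h2.
have h3 : K * m <= e / 2.
  have : m * (K + 1) <= e / 2 by rewrite -ler_pdivlMr// ltr_wpDl.
  rewrite mulrDr mulr1 mulrC; lra.
have -> : I - (f b * RtoC (S b) - f a * RtoC (S a) - Sint a b) =
  - ((Sg - I) + (f b * RtoC (S b) - f a * RtoC (S a) - Sint a b - Sg)) by ring.
rewrite cnormN; apply: le_trans (cnormD _ _) _.
move: h1 h2 h3; rewrite -/K; lra.
Qed.

End StieltjesParts.

(** * Growth of S and its Laplace transform *)

Section LaplaceStieltjes.
Context {R : realType}.
Local Notation C := R[i].
Local Notation Re := complex.Re.
Local Notation Im := complex.Im.

Variables (S : R -> R) (alpha : R) (L : C -> C).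
Hypothesis alpha0 : 0 < alpha.
Hypothesis Snd : forall x y : R, 0 <= x -> x <= y -> S x <= S y.
Hypothesis Sneg : forall x : R, x < 0 -> S x = 0.
Hypothesis SL : forall s : C, alpha < Re s -> is_LS S s (L s).

(** [S 0] may be negative, so [S] need not be monotone across the origin; [V] counts the jump there
    by its absolute value. *)
Let V (x : R) := if 0 <= x then S x - S 0 + `|S 0| else 0.

Lemma S_variation x y : x <= y -> `|S x - S y| <= V y - V x.
Proof.
move=> xy; rewrite /V; have [x0|x0] := leP 0 x.
  have y0 : 0 <= y by exact: le_trans xy.
  by rewrite y0 distrC ger0_norm ?subr_ge0 ?Snd//; lra.
have [y0|y0] := leP 0 y; last by rewrite !Sneg// subrr normr0.
rewrite (Sneg x0) sub0r normrN subr0.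
have := Snd (lexx 0) y0; have := ler_norm (S 0); have := ler_normD (S y - S 0) (S 0).
rewrite subrK => h _ h2; rewrite (le_trans h)// lerD2r ger0_norm// subr_ge0//.
Qed.

Lemma measurable_S : measurable_fun setT S.
Proof.
have -> : S = fun x => V x + (S 0 - `|S 0|) * \1_(`[0, +oo[) x.
  apply/funext => x; rewrite /V indicE; have [x0|x0] := leP 0 x.
    rewrite mem_set ?mulr1; last by rewrite /= in_itv /= x0.
    by ring.
  rewrite memNset ?mulr0 ?addr0 ?Sneg//=.
  by rewrite in_itv /= andbT; apply/negP; rewrite -ltNge.
apply: measurable_funD.
  apply: nondecreasing_measurable => // x y xy; rewrite -subr_ge0.
  exact: le_trans (normr_ge0 _) (S_variation xy).
by apply: measurable_funM => //; exact: measurable_indic.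
Qed.

Lemma cexp_ez (s : C) u : cexp (- (s * RtoC u)) = ez (- Re s) (- Im s) u.
Proof. by rewrite /cexp /ez !ReImE /= !mulr0 subr0 add0r !mulNr. Qed.

Lemma cexp_ez_fun (s : C) : (fun u => cexp (- (s * RtoC u))) = ez (- Re s) (- Im s).
Proof. by apply/funext => u; exact: cexp_ez. Qed.

Lemma Complex_ReIm (s : C) : Complex (- Re s) (- Im s) = - s.
Proof. by case: s. Qed.

Lemma RS_exp_parts (s : C) (p q : R) I : p < q ->
  is_RS (fun u => cexp (- (s * RtoC u))) S p q I ->
  I = ez (- Re s) (- Im s) q * RtoC (S q) - ez (- Re s) (- Im s) p * RtoC (S p)
    + s * cint (fun u => RtoC (chi p q u * S u) * ez (- Re s) (- Im s) u).
Proof.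
rewrite cexp_ez_fun => pq hI; pose E := ez (- Re s) (- Im s).
have hE : hasd E (fun u => - s * E u) by rewrite -Complex_ReIm; exact: hasd_ez.
have hE' := hasd_Z (- s) hE.
(* The modulus of the exponential is monotone in [u], hence largest at an endpoint. *)
pose M := Num.max (expR (- Re s * p)) (expR (- Re s * q)).
have EM u : p <= u -> u <= q -> cnorm (E u) <= M.
  move=> pu uq; rewrite cnorm_ez le_max; have [s0|s0] := leP 0 (- Re s).
    by apply/orP; right; rewrite ler_expR ler_wpM2l.
  by apply/orP; left; rewrite ler_expR ler_wnM2l// ltW.
have M0 : 0 <= M by exact: le_trans (cnorm_ge0 _) (EM p (lexx p) (ltW pq)).
have E'D u : p <= u -> u <= q -> cnorm (- s * E u) <= cnorm s * M.
  by move=> pu uq; rewrite cnormM cnormN ler_pM ?cnorm_ge0// EM.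
rewrite (is_RS_parts measurable_S S_variation hE hE' E'D pq hI); congr (_ + _).
have i1 : cI (fun u => RtoC (chi p q u * S u) * E u).
  have := @chi_dom _ p q ((`|S q| + (V q - V p)) * M) (fun u => RtoC (S u) * E u).
  have -> : (fun u => RtoC (chi p q u) * (RtoC (S u) * E u)) = (fun u => RtoC (chi p q u * S u) * E u).
    by apply/funext => u; rewrite mulrA -RtoCM.
  have Vm x y : x <= y -> V x <= V y.
    by move=> xy; rewrite -subr_ge0; exact: le_trans (normr_ge0 _) (S_variation xy).
  apply.
  - by apply: cM_M; [apply: cM_RtoC; exact: measurable_S|exact: cM_ez].
  - by apply: mulr_ge0 => //; apply: addr_ge0 => //; rewrite subr_ge0 Vm// ltW.
  - move=> u pu uq; rewrite cnormM cnorm_RtoC; apply: ler_pM; rewrite ?cnorm_ge0//; last by apply: EM; lra.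
    have := S_variation uq; have := Vm _ _ (ltW pu).
    have := ler_normD (S u - S q) (S q); rewrite subrK; lra.
rewrite -cintZ// -cintN; last first.
  have := cI_Z (- s) i1; congr cI; apply/funext => u; rewrite RtoCM /E; ring.
by apply: eq_cint => u; rewrite RtoCM /E; ring.
Qed.


Lemma rint_chi_exp (be X : R) : 0 < be -> -1 <= X ->
  rint (fun u => chi (-1) X u * (be * expR (- be * u))) = expR be - expR (- be * X).
Proof.
move=> be0 X1.
have hd (x : R) : is_derive x 1 (fun u => - expR (- be * u)) (be * expR (- be * x)).
  have := hasd_expR (- be) x => -[h _]; move: h => /= h.
  rewrite mul0r subr0 in h.
  by have := is_deriveN h; rewrite mulNr opprK.
rewrite (rint_chi_FTC X1 hd); first by rewrite mulrNN mulr1; ring.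
move=> x; apply: cvgM; first exact: cvg_cst.
apply: (@continuous_comp _ _ _ (fun u => - be * u) (@expR R)); last exact: continuous_expR.
by apply: cvgM; [exact: cvg_cst|exact: cvg_id].
Qed.

(** At the real point [be] the parts formula writes a bounded quantity as [S X * expR (- be * X)]
    plus an integral. Since [S] is bounded below, so is the integral; the first term is therefore
    bounded above. *)
Lemma S_growth (be : R) : alpha < be -> exists2 c, 0 <= c & forall x, 0 <= x -> `|S x| <= c * expR (be * x).
Proof.
move=> ab; have be0 : 0 < be by exact: lt_trans ab.
have [X0 hX0] := SL (s := RtoC be) ab ltr01.
pose s0 : R := `|S 0|.
have s00 : 0 <= s0 by rewrite /s0.
(* The [1] is the tolerance at which [is_LS] was used; the last term bounds the negative part of the
   integral over []-1, X]]. *)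
pose c1 := cnorm (L (RtoC be)) + 1 + s0 * expR be.
have S0 x : 0 <= x -> - s0 <= S x.
  by move=> x0; rewrite (le_trans _ (Snd (lexx 0) x0))// lerNl ler_normr lexx orbT.
have big X : X0 <= X -> 0 <= X -> S X <= c1 * expR (be * X).
  move=> XX X_ge0; have [I [hI1 hI2]] := hX0 X XX.
  have X1 : -1 < X by lra.
  have := RS_exp_parts X1 hI1; rewrite (@Sneg (-1))// ?ltrN10// RtoC0 mulr0 subr0 => hI.
  have [M1 hM1] : exists M, forall u, -1 < u -> u <= X -> `|S u| <= M.
    exists (s0 + `|S X|) => u u1 uX; have [u0|u0] := leP 0 u; last first.
      by rewrite Sneg// normr0 addr_ge0.
    rewrite ler_norml; have := S0 u u0; have := Snd u0 uX; have := ler_norm (S X).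
    have := normr_ge0 (S X) => h1 h2 h3 h4; apply/andP; split; lra.
  have ReI : Re I = expR (- be * X) * S X + be * rint (fun u => chi (-1) X u * S u * expR (- be * u)).
    have ezr u : ez (- Re (RtoC be)) (- Im (RtoC be)) u = RtoC (expR (- be * u)).
      by rewrite /ez /= oppr0 mul0r cexpi0 mulr1.
    rewrite hI ezr; under eq_cint do rewrite ezr -RtoCM.
    by rewrite cint_RtoC -!RtoCM -RtoCD.
  have m1 : measurable_fun setT (fun u => chi (-1) X u * S u * expR (- be * u)).
    apply: measurable_funM; first by apply: measurable_funM; [exact: measurable_chi|exact: measurable_S].
    by apply: measurableT_comp => //; exact: measurable_funM.
  have eb u : -1 < u -> expR (- be * u) <= expR be.
    by move=> u1; rewrite ler_expR mulNr -mulrN ler_piMr ?(ltW be0)//; lra.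
  have lower : - s0 * (expR be - expR (- be * X)) <= be * rint (fun u => chi (-1) X u * S u * expR (- be * u)).
    have M10 : 0 <= M1 by exact: le_trans (normr_ge0 _) (hM1 0 (ltrN10 R) X_ge0).
    have w0 : 0 <= (1 + (Num.max `|-1| `|X|) ^+ 2) :> R by rewrite addr_ge0 ?sqr_ge0.
    have i1 : rI (fun u => chi (-1) X u * S u * expR (- be * u)).
      apply: (@rI_dom _ _ ((1 + (Num.max `|-1| `|X|) ^+ 2) * (M1 * expR be))) => // u.
      rewrite !normrM mulrAC -mulrA; have := chi_wt (-1) X u; rewrite /chi.
      case: (boolP (_ && _)) => [/andP[h1 h2]|_] hw; last first.
        by rewrite normr0 mul0r mulr_ge0// ?mulr_ge0 ?wt_ge0 ?expR_ge0.
      rewrite [leRHS]mulrAC; apply: ler_pM => //.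
      by rewrite mulrC; apply: ler_pM => //; rewrite ?hM1// ger0_norm ?expR_ge0 ?eb.
    have i2 : rI (fun u => chi (-1) X u * (be * expR (- be * u))).
      apply: (@rI_dom _ _ ((1 + (Num.max `|-1| `|X|) ^+ 2) * (be * expR be))) => [|u].
        apply: measurable_funM; first exact: measurable_chi.
        by apply: measurable_funM => //; apply: measurableT_comp => //; exact: measurable_funM.
      rewrite normrM mulrAC; have := chi_wt (-1) X u; rewrite /chi.
      case: (boolP (_ && _)) => [/andP[h1 h2]|_] hw; last first.
        by rewrite normr0 mul0r mulr_ge0// ?mulr_ge0 ?wt_ge0 ?expR_ge0// ltW.
      apply: ler_pM => //.
      by rewrite ger0_norm ?mulr_ge0 ?expR_ge0 ?(ltW be0)// ler_wpM2l ?(ltW be0)// eb.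
    rewrite -(rint_chi_exp be0 (ltW X1)) -!rintZ//; apply: le_rint; [exact: rIZ|exact: rIZ|].
    move=> u; have [u0|u0] := leP 0 u; last first.
      rewrite Sneg// mulr0 mul0r mulr0 mulNr oppr_le0 mulr_ge0// mulr_ge0 ?mulr_ge0 ?expR_ge0 ?(ltW be0)//.
    have -> : - s0 * (chi (-1) X u * (be * expR (- be * u))) = (chi (-1) X u * (be * expR (- be * u))) * - s0 by ring.
    have -> : be * (chi (-1) X u * S u * expR (- be * u)) = (chi (-1) X u * (be * expR (- be * u))) * S u by ring.
    by rewrite ler_wpM2l ?S0// mulr_ge0 ?mulr_ge0 ?expR_ge0 ?(ltW be0).
  have hR : Re I <= cnorm (L (RtoC be)) + 1.
    have := ler_norm (Re I); have := cnorm_Re I.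
    have := cnormD (I - L (RtoC be)) (L (RtoC be)); rewrite subrK; lra.
  have eX : 0 <= expR (- be * X) by exact: expR_ge0.
  have h : expR (- be * X) * S X <= c1.
    have : 0 <= s0 * expR (- be * X) by exact: mulr_ge0.
    rewrite /c1; move: lower hR; rewrite ReI; lra.
  move: h; rewrite mulNr expRN mulrC ler_pdivrMr ?expR_gt0//.
pose X1 := Num.max X0 0.
have c10 : 0 <= c1 by rewrite /c1 !addr_ge0 ?cnorm_ge0// mulr_ge0// expR_ge0. clearbody c1.
have X01 : X0 <= X1 by rewrite /X1 le_max lexx.
have s0E : 0 <= s0 := s00; clearbody s0 X1.
exists (c1 + s0 + `|S X1|); first by apply: addr_ge0 => //; exact: addr_ge0.
move=> x x0; have e1 : 1 <= expR (be * x).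
  by rewrite -expR0 ler_expR mulr_ge0// ltW.
have p1 (z : R) : 0 <= z -> z <= z * expR (be * x) by move=> z0; rewrite ler_peMr.
have q1 := p1 _ s0E; have q2 := p1 _ (normr_ge0 (S X1)); have q3 := p1 _ c10.
have q4 := normr_ge0 (S X1).
rewrite !mulrDl ler_norml; have hS := S0 x x0; apply/andP; split.
  by lra.
have [xX|Xx] := leP x X1.
  by have := @Snd x X1 x0 xX; have := ler_norm (S X1); lra.
have h1 : X0 <= x by apply: le_trans (ltW Xx).
by have := big x h1 x0; lra.
Qed.

Lemma S_exp_wt (a : R) : alpha < a -> exists2 c, 0 <= c & forall b u,
  cnorm (RtoC (stp 0 u * S u) * ez (- a) b u) <= c * wt u.
Proof.
(* The midpoint leaves an exponential decay of rate [a - be] after the growth of [S] is paid for. *)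
move=> aa; pose be := (alpha + a) / 2.
have [c c0 hc] := S_growth (be := be) ltac:(rewrite /be; lra).
have [d d0 hd] := @exp_wt R (a - be) ltac:(rewrite /be; lra).
exists (c * d); first exact: mulr_ge0.
move=> b u; rewrite cnormM cnorm_RtoC cnorm_ez /stp; have [u0|u0] := ltP 0 u; last first.
  by rewrite mul0r normr0 mul0r !mulr_ge0 ?wt_ge0.
rewrite mul1r; apply: (@le_trans _ _ (c * expR (be * u) * expR (- a * u))).
  by apply: ler_wpM2r; [exact: expR_ge0|exact: hc (ltW u0)].
rewrite -mulrA -expRD -mulrA ler_wpM2l//.
have -> : be * u + - a * u = - ((a - be) * u) by ring.
exact: hd (ltW u0).
Qed.

Lemma cM_S_exp a b : cM (fun u => RtoC (stp 0 u * S u) * ez a b u).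
Proof.
apply: cM_M; last exact: cM_ez.
by apply: cM_RtoC; apply: measurable_funM; [exact: measurable_stp|exact: measurable_S].
Qed.

(** Parts on [[-1, n]]: the boundary term at [-1] is zero and the one at [n] tends to [0] by the
    growth bound. *)
Lemma laplace_transform (s : C) : alpha < Re s ->
  L s = s * cint (fun u => RtoC (stp 0 u * S u) * ez (- Re s) (- Im s) u).
Proof.
move=> sa; pose E := ez (- Re s) (- Im s).
have [c c0 hc] := S_exp_wt sa.
pose J n := cint (fun u => RtoC (chi 0 n%:R u * S u) * E u).
have mchi n : cM (fun u => RtoC (chi 0 n%:R u * S u) * E u).
  apply: cM_M; last exact: cM_ez.
  by apply: cM_RtoC; apply: measurable_funM; [exact: measurable_chi|exact: measurable_S].
have cJ : ccvg J (cint (fun u => RtoC (stp 0 u * S u) * E u)).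
  apply: (@cint_DCT _ _ _ c).
  - exact: mchi.
  - exact: cM_S_exp.
  - move=> u; apply: (cvg_near_cst 0); near=> n.
    rewrite /chi /stp (_ : u <= n%:R) ?andbT ?subrr ?cnorm0//.
    by near: n; exact: nbhs_infty_ger.
  - move=> n u; apply: le_trans (hc (- Im s) u).
    rewrite (cnormM (RtoC (chi 0 n%:R u * S u))) (cnormM (RtoC (stp 0 u * S u))).
    apply: ler_wpM2r; first exact: cnorm_ge0.
    rewrite !cnorm_RtoC !normrM; apply: ler_wpM2r => //; rewrite /chi /stp.
    by case: (0 < u); case: (u <= _); rewrite /= ?normr0 ?normr1.
apply/eqP; rewrite -subr_eq0; apply/eqP/cnorm_eq0/eqP; rewrite eq_le cnorm_ge0 andbT.
apply/ler_addgt0Pr => e e0; rewrite add0r.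
have e3 : 0 < e / 3 by rewrite divr_gt0.
have [X0 hX0] := SL sa e3.
have e3s : 0 < e / 3 / (cnorm s + 1) by rewrite divr_gt0// ltr_wpDl ?cnorm_ge0.
have /cvgrPdist_lt/(_ _ e3s)[n1 _ hn1] := cJ.
have hw : c * wt (0 + n%:R) @[n --> \oo] --> (0 : R).
  by rewrite -[X in _ --> X](mulr0 c); apply: cvgM; [exact: cvg_cst|exact: wt_cvg0].
have /cvgrPdist_lt/(_ _ e3)[n2 _ hn2] := hw.
pose n := (maxn 1 (maxn n1 (maxn n2 (Num.trunc `|X0|).+1)))%N.
have nX : X0 <= n%:R.
  apply: (@le_trans _ _ (Num.trunc `|X0|).+1%:R); last by rewrite ler_nat !leq_max leqnn !orbT.
  by rewrite (le_trans (ler_norm _))// ltW// truncnS_gt.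
have n_gt0 : (0 : R) < n%:R by rewrite ltr0n !leq_max.
have [I [hI1 hI2]] := hX0 n%:R nX.
have := RS_exp_parts (lt_trans (ltrN10 R) n_gt0) hI1.
rewrite (@Sneg (-1)) ?ltrN10// RtoC0 mulr0 subr0 -/E => hI.
have JE : cint (fun u => RtoC (chi (-1) n%:R u * S u) * E u) = J n.
  (* On negative [u] the factor [S u] is zero, so the integrands differ at most at the jump point
     [0]. *)
  apply: (@cint_eq1 _ 0) => //.
    apply: cM_M; last exact: cM_ez.
    by apply: cM_RtoC; apply: measurable_funM; [exact: measurable_chi|exact: measurable_S].
  move=> u u0; congr (RtoC _ * _); rewrite /chi.
  have [ul|ul] := ltP 0 u; first by rewrite (lt_trans (ltrN10 R) ul).
  by rewrite (@Sneg u) ?mulr0// lt_neqAle u0.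
rewrite JE in hI.
have h1 : cnorm (J n - cint (fun u => RtoC (stp 0 u * S u) * E u)) < e / 3 / (cnorm s + 1).
  have := hn1 n; rewrite /= sub0r normrN ger0_norm ?cnorm_ge0//; apply.
  by rewrite !leq_max leqnn !orbT.
have h2 : cnorm (E n%:R * RtoC (S n%:R)) < e / 3.
  have := hn2 n; rewrite /= sub0r normrN add0r ger0_norm ?mulr_ge0 ?wt_ge0// => h.
  apply: le_lt_trans (h _); last by rewrite !leq_max leqnn !orbT.
  by have := hc (- Im s) n%:R; rewrite /stp n_gt0 mul1r mulrC.
have h3 : cnorm s * cnorm (J n - cint (fun u => RtoC (stp 0 u * S u) * E u)) <= e / 3.
  have s0 := cnorm_ge0 s.
  move: h1; rewrite ltr_pdivlMr ?ltr_wpDl// mulrDr mulr1 mulrC.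
  have := cnorm_ge0 (J n - cint (fun u => RtoC (stp 0 u * S u) * E u)); lra.
have -> : L s - s * cint (fun u => RtoC (stp 0 u * S u) * E u) =
  - (I - L s) + (E n%:R * RtoC (S n%:R) + s * (J n - cint (fun u => RtoC (stp 0 u * S u) * E u))).
  rewrite hI; ring.
apply: le_trans (cnormD _ _) _; rewrite cnormN.
have := cnormD (E n%:R * RtoC (S n%:R)) (s * (J n - cint (fun u => RtoC (stp 0 u * S u) * E u))).
rewrite [cnorm (s * _)]cnormM; move: h2 h3 hI2; lra.
Unshelve. all: by end_near.
Qed.

End LaplaceStieltjes.

(** * The main term and the remainder *)

Section MainTerm.
Context {R : realType}.
Local Notation C := R[i].
Local Notation Re := complex.Re.
Local Notation Im := complex.Im.

Lemma cI_sum (I : Type) (s : seq I) (f : I -> R -> C) : (forall i, cI (f i)) ->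
  cI (fun x => \sum_(i <- s) f i x).
Proof.
move=> fi; elim: s => [|i s IH].
  under eq_fun do rewrite big_nil; apply: (@cI_W _ _ 0) => [|x]; first exact: cM_cst.
  by rewrite cnorm0 mul0r.
by under eq_fun do rewrite big_cons; exact: cI_D.
Qed.

Lemma cint_sum (I : Type) (s : seq I) (f : I -> R -> C) : (forall i, cI (f i)) ->
  cint (fun x => \sum_(i <- s) f i x) = \sum_(i <- s) cint (f i).
Proof.
move=> fi; elim: s => [|i s IH].
  by rewrite big_nil -[RHS](@cint0 R); apply: eq_cint => x; rewrite big_nil.
rewrite big_cons -IH -cintD//; last exact: cI_sum.
by apply: eq_cint => x; rewrite big_cons.
Qed.

Lemma cnorm_sum (I : Type) (s : seq I) (f : I -> C) :
  cnorm (\sum_(i <- s) f i) <= \sum_(i <- s) cnorm (f i).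
Proof.
elim: s => [|i s IH]; first by rewrite !big_nil cnorm0.
by rewrite !big_cons (le_trans (cnormD _ _))// lerD2l.
Qed.

Lemma sin_atan (x : R) : sin (atan x) = x * (Num.sqrt (1 + x ^+ 2))^-1.
Proof.
have := atanK x; rewrite /tan => h.
have c0 : cos (atan x) != 0.
  by rewrite cos_atan invr_eq0 gt_eqF// sqrtr_gt0 ltr_pwDl ?sqr_ge0.
by rewrite -{2}h mulrAC -cos_atan -mulrA mulfV// mulr1.
Qed.

(** The origin of the square root and the arctangent in the asymptotics: dividing a residue by
    [alpha + i t_n] divides its modulus and shifts its phase. *)
Lemma polar (a t : R) : 0 < a ->
  RtoC (Num.sqrt (a ^+ 2 + t ^+ 2)) * cexpi (atan (t / a)) = Complex a t.
Proof.
move=> a0; have an : a != 0 by rewrite gt_eqF.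
have p1 : 0 < 1 + (t / a) ^+ 2 by rewrite ltr_pwDl ?sqr_ge0.
have e : Num.sqrt (a ^+ 2 + t ^+ 2) = a * Num.sqrt (1 + (t / a) ^+ 2).
  have -> : a ^+ 2 + t ^+ 2 = a ^+ 2 * (1 + (t / a) ^+ 2) by field.
  by rewrite sqrtrM ?sqr_ge0// sqrtr_sqr gtr0_norm.
have sn : Num.sqrt (1 + (t / a) ^+ 2) != 0 by rewrite gt_eqF// sqrtr_gt0.
apply: complex_eq; rewrite !ReImE /= mul0r ?subr0 ?addr0 e.
  by rewrite cos_atan -mulrA mulfV// mulr1.
by rewrite sin_atan; field; rewrite sn an.
Qed.

Variables (alpha r0 : R) (N : nat) (r theta t : 'I_N -> R).
Hypothesis alpha0 : 0 < alpha.

Definition main_term (x : R) : R := r0 / alpha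
  + 2 * \sum_(n < N) r n * cos (t n * x + theta n - atan (t n / alpha)) / Num.sqrt (alpha ^+ 2 + t n ^+ 2).

(** The transform of [S] is [L s / s], whence the residue of the pole at [alpha + i t_n] divided by
    the value of [s] there. *)
Definition cplus (n : 'I_N) : C := RtoC (r n) * (cexpi (theta n) / Complex alpha (t n)).
Definition cminus (n : 'I_N) : C := RtoC (r n) * (cexpi (- theta n) / Complex alpha (- t n)).

Lemma main_termE x : RtoC (main_term x) = RtoC (r0 / alpha)
  + \sum_(n < N) (cplus n * cexpi (t n * x) + cminus n * cexpi (- t n * x)).
Proof.
rewrite /main_term RtoCD mulr_sumr; congr (_ + _).
have RtoC_sum (I : Type) (s : seq I) (f : I -> R) : RtoC (\sum_(i <- s) f i) = \sum_(i <- s) (RtoC (f i) : C).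
  by elim: s => [|i s IH]; rewrite ?big_nil ?RtoC0// !big_cons RtoCD IH.
rewrite RtoC_sum; apply: eq_bigr => n _.
set rho := Num.sqrt _; set b := atan _; set ph := t n * x + theta n - b.
have rho0 : rho != 0 by rewrite gt_eqF// sqrtr_gt0 ltr_pwDl ?sqr_ge0// exprn_gt0.
have e2 : RtoC (cos ph *+ 2) = cexpi ph + cexpi (- ph).
  by apply: complex_eq; rewrite !ReImE /= ?cosN ?sinN ?subrr// mulr2n.
have ip : (Complex alpha (t n))^-1 = RtoC rho^-1 * cexpi (- b).
  rewrite -(polar (t n) alpha0) -/rho -/b invfM -RtoCV; congr (_ * _).
  have cb : cexpi b != 0.
    by apply/eqP => h; have := cnorm_cexpi b; rewrite h cnorm0 => /esym/eqP; rewrite oner_eq0.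
  by apply: (mulIf cb); rewrite mulVf// cexpiNM.
have im : (Complex alpha (- t n))^-1 = RtoC rho^-1 * cexpi b.
  rewrite -(polar (- t n) alpha0) sqrrN -/rho mulNr atanN -/b invfM -RtoCV; congr (_ * _).
  have cb : cexpi (- b) != 0.
    by apply/eqP => h; have := cnorm_cexpi (- b); rewrite h cnorm0 => /esym/eqP; rewrite oner_eq0.
  by apply: (mulIf cb); rewrite mulVf// mulrC cexpiNM.
have -> : 2 * (r n * cos ph / rho) = r n * rho^-1 * (cos ph *+ 2) by rewrite mulr2n; ring.
rewrite !RtoCM e2 /cplus /cminus ip im /ph.
have -> : t n * x + theta n - b = theta n + - b + t n * x by ring.
have -> : - (theta n + - b + t n * x) = - theta n + b + - t n * x by ring.
rewrite !cexpiD; ring.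
Qed.

Lemma main_term_bounded : exists2 M, 0 <= M & forall x, `|main_term x| <= M.
Proof.
exists (cnorm (RtoC (r0 / alpha)) + \sum_(n < N) (cnorm (cplus n) + cnorm (cminus n))).
  by rewrite addr_ge0 ?cnorm_ge0// sumr_ge0// => n _; rewrite addr_ge0 ?cnorm_ge0.
move=> x; rewrite -cnorm_RtoC main_termE (le_trans (cnormD _ _))// lerD2l.
rewrite (le_trans (cnorm_sum _ _))// ler_sum// => n _.
by rewrite (le_trans (cnormD _ _))// !cnormM !cnorm_cexpi !mulr1.
Qed.

Lemma cos_lipschitz (a b : R) : `|cos a - cos b| <= `|a - b|.
Proof.
have h := @lipschitz0 R (fun u => cos (u + b)) (fun u => - sin (u + b)) 1.
have := h _ _ (a - b); rewrite subrK add0r mul1r; apply.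
  move=> x; have := @is_derive1_comp R (@cos R) (fun u => u + b) x _ 1 (is_derive_cos _) _.
  rewrite mulr1; apply.
  by have := @is_derive_shift _ x (1 : R) b.
move=> x; rewrite normrN ler_norml; have := sin_geN1 (x + b); have := sin_le1 (x + b).
by move=> -> ->.
Qed.

(** Serves twice: for the continuity of the main term, and for its share in the slow decrease of the
    remainder. *)
Lemma main_term_lipschitz : exists2 D, 0 <= D & forall x y, `|main_term x - main_term y| <= D * `|x - y|.
Proof.
exists (2 * \sum_(n < N) `|r n| * `|t n| / Num.sqrt (alpha ^+ 2 + t n ^+ 2)).
  by rewrite mulr_ge0// sumr_ge0// => n _; rewrite mulr_ge0 ?invr_ge0 ?sqrtr_ge0// mulr_ge0.
move=> x y; rewrite /main_term opprD addrACA subrr add0r -mulrBr normrM ger0_norm//.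
rewrite -mulrA ler_wpM2l// -sumrB (le_trans (ler_norm_sum _ _ _))// mulr_suml ler_sum// => n _.
have i0 : 0 <= (Num.sqrt (alpha ^+ 2 + t n ^+ 2))^-1 by rewrite invr_ge0 sqrtr_ge0.
rewrite -mulrBl -mulrBr !normrM (ger0_norm i0).
have -> : `|r n| * `|t n| / Num.sqrt (alpha ^+ 2 + t n ^+ 2) * `|x - y| =
  `|r n| * (`|t n| * `|x - y|) / Num.sqrt (alpha ^+ 2 + t n ^+ 2) by ring.
rewrite ler_wpM2r// ler_wpM2l// (le_trans (cos_lipschitz _ _))//.
by rewrite -normrM le_eqVlt; apply/orP; left; apply/eqP; congr `|_|; ring.
Qed.

Lemma continuous_main_term : continuous main_term.
Proof.
have [D D0 hD] := main_term_lipschitz.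
move=> x; apply/cvgrPdist_lt => e e0; near=> y.
rewrite (le_lt_trans (hD x y))//.
have h : `|x - y| < e / (D + 1).
  by near: y; exists (e / (D + 1)) => //=; rewrite divr_gt0// ltr_wpDl.
have := h; rewrite ltr_pdivlMr ?ltr_wpDl// mulrDr mulr1 mulrC; have := normr_ge0 (x - y); lra.
Unshelve. all: by end_near.
Qed.

Lemma measurable_main_term : measurable_fun setT main_term.
Proof. by apply: continuous_measurable_fun; exact: continuous_main_term. Qed.

(** The value of the main term at [0]: each fraction [1 / (s - pole)] in its transform, multiplied
    by [s], leaves its coefficient as a constant. *)
Definition cconst : C := RtoC (r0 / alpha) + \sum_(n < N) (cplus n + cminus n).

Lemma ez_modulate (a b c u : R) : cexpi (c * u) * ez a b u = ez a (c + b) u.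
Proof. by rewrite /ez mulrCA -cexpiD -mulrDl. Qed.

Lemma stp_ez_cI (e b : R) : 0 < e -> cI (fun u => RtoC (stp 0 u) * ez (- e) b u).
Proof.
move=> e0; have [c c0 hc] := exp_wt e0.
apply: (@cI_W _ _ c).
  by apply: cM_M; [apply: cM_RtoC; exact: measurable_stp|exact: cM_ez].
move=> v; rewrite cnormM cnorm_RtoC cnorm_ez /stp.
have [v0|v0] := ltP 0 v; last by rewrite normr0 mul0r mulr_ge0 ?wt_ge0.
by rewrite normr1 mul1r mulNr hc// ltW.
Qed.

Lemma laplace_main_term (e b : R) : 0 < e ->
  Complex (alpha + e) b * cint (fun u => RtoC (stp 0 u * main_term u) * ez (- e) (- b) u) =
  RtoC r0 / Complex e b
  + \sum_(n < N) RtoC (r n) * (cexpi (theta n) / Complex e (b - t n) + cexpi (- theta n) / Complex e (b + t n))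
  + cconst.
Proof.
move=> e0.
have en (d : R) : Complex e d != 0 by apply: Complex_neq0; rewrite gt_eqF.
have ie (d : R) : - (Complex (- e) d)^-1 = (Complex e (- d))^-1.
  by rewrite -invrN; congr (_^-1); apply: complex_eq; rewrite !ReImE /= ?opprK.
have an (d : R) : Complex alpha d != 0 by apply: Complex_neq0; rewrite gt_eqF.
have i n : cI (fun u => cplus n * (RtoC (stp 0 u) * ez (- e) (t n - b) u)
    + cminus n * (RtoC (stp 0 u) * ez (- e) (- t n - b) u)).
  by apply: cI_D; apply: cI_Z; exact: stp_ez_cI.
have -> : cint (fun u => RtoC (stp 0 u * main_term u) * ez (- e) (- b) u) =
  RtoC (r0 / alpha) / Complex e b
  + \sum_(n < N) (cplus n / Complex e (b - t n) + cminus n / Complex e (b + t n)).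
  have -> : (fun u => RtoC (stp 0 u * main_term u) * ez (- e) (- b) u) =
    (fun u => RtoC (r0 / alpha) * (RtoC (stp 0 u) * ez (- e) (- b) u) +
      \sum_(n < N) (cplus n * (RtoC (stp 0 u) * ez (- e) (t n - b) u)
        + cminus n * (RtoC (stp 0 u) * ez (- e) (- t n - b) u))).
    apply/funext => u; rewrite RtoCM main_termE mulrDr mulrDl; congr (_ + _); first by ring.
    rewrite mulr_sumr mulr_suml; apply: eq_bigr => n _.
    rewrite -!ez_modulate; ring.
  rewrite cintD; [|by apply: cI_Z; exact: stp_ez_cI|exact: cI_sum].
  rewrite cintZ; last exact: stp_ez_cI.
  rewrite cint_ez_pos// ie opprK cint_sum//; congr (_ + _); apply: eq_bigr => n _.
  rewrite cintD; [|by apply: cI_Z; exact: stp_ez_cI|by apply: cI_Z; exact: stp_ez_cI].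
  rewrite cintZ; last exact: stp_ez_cI.
  rewrite cintZ; last exact: stp_ez_cI.
  by rewrite !cint_ez_pos// !ie !opprD !opprK ![- _ + b]addrC [t n + b]addrC.
rewrite mulrDr /cconst addrACA; congr (_ + _).
  have -> : Complex (alpha + e) b = Complex e b + RtoC alpha.
    by apply: complex_eq; rewrite !ReImE /= ?addr0// addrC.
  have an0 : RtoC alpha != 0 by rewrite RtoC_eq0 gt_eqF.
  rewrite RtoCM RtoCV; field; rewrite an0 en//.
rewrite mulr_sumr -big_split; apply: eq_bigr => n _ /=.
(* [s] is split as [s - pole] plus the pole: the first summand cancels the denominator, the second
   cancels the division inside [cplus] or [cminus]. *)
have e1 : Complex (alpha + e) b = Complex e (b - t n) + Complex alpha (t n).
  by apply: complex_eq; rewrite !ReImE /= ?subrK// addrC.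
have e2 : Complex (alpha + e) b = Complex e (b + t n) + Complex alpha (- t n).
  by apply: complex_eq; rewrite !ReImE /= ?addrK// addrC.
rewrite mulrDr {1}e1 e2 /cplus /cminus.
have := en (b - t n); have := en (b + t n); have := an (t n); have := an (- t n).
move: (Complex e (b - t n)) (Complex e (b + t n)) (Complex alpha (t n)) (Complex alpha (- t n)).
by move=> z1 z2 z3 z4 h4 h3 h2 h1; field; rewrite h1 h2 h3 h4.
Qed.

End MainTerm.

(** * Pairing with test functions near the boundary line *)

Section Pairing.
Context {R : realType}.
Local Notation C := R[i].
Local Notation Re := complex.Re.
Local Notation Im := complex.Im.
Local Notation W := (rint (@wt R)).

Section LaplacePairing.
Variables (a : R -> R) (g : R -> C) (eta c : R).
Hypothesis ma : measurable_fun setT a.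
Hypothesis ac : forall x, `|a x| * expR (- eta * x) <= c * wt x.
Hypothesis gW : cW g.

Let K tau x := g tau * (RtoC (a x) * ez (- eta) (- tau) x).

Let K_cM : cM (fun z : R * R => K z.1 z.2).
Proof.
apply: cM_M; first by apply: cM_comp; [exact: gW.1|exact: measurable_fst].
apply: cM_M.
  by apply: (@cM_comp _ _ _ (fun x => RtoC (a x))); [exact: cM_RtoC|exact: measurable_snd].
apply: cM_M.
  apply: (@cM_comp _ _ _ (fun x => RtoC (expR (- eta * x)))); last exact: measurable_snd.
  exact: hasd_cM (hasd_expR (- eta)).
apply: cM_cexpi; apply: measurable_funM; last exact: measurable_snd.
by apply: measurableT_comp => //; exact: measurable_fst.
Qed.

Let K_bound : exists d, forall tau x, cnorm (K tau x) <= d * (wt tau * wt x).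
Proof.
have [_ [d hd]] := gW; exists (d * c) => tau x.
have -> : d * c * (wt tau * wt x) = (d * wt tau) * (c * wt x) by ring.
rewrite /K cnormM; apply: ler_pM; rewrite ?cnorm_ge0//.
by rewrite (cnormM (RtoC (a x))) cnorm_RtoC cnorm_ez.
Qed.

Lemma laplace_slice tau : cint (K tau) = g tau * cint (fun x => RtoC (a x) * ez (- eta) (- tau) x).
Proof.
rewrite /K cintZ//; apply: (@cI_W _ _ c).
  by apply: cM_M; [exact: cM_RtoC|exact: cM_ez].
by move=> x; rewrite (cnormM (RtoC (a x))) cnorm_RtoC cnorm_ez.
Qed.

Lemma cI_laplace : cI (fun tau => g tau * cint (fun x => RtoC (a x) * ez (- eta) (- tau) x)).
Proof.
have [d hd] := K_bound; have [_ [d' hd']] := gW.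
apply: (@cI_W _ _ (2 * (d' * c) * W)).
  apply: (cM_eq _ (cM_cint_fst K_cM hd)) => tau; exact: laplace_slice.
move=> tau; rewrite cnormM.
have -> : 2 * (d' * c) * W * wt tau = (d' * wt tau) * (2 * c * W) by ring.
apply: ler_pM; rewrite ?cnorm_ge0//; apply: cint_leW.
  by apply: cM_M; [exact: cM_RtoC|exact: cM_ez].
by move=> x; rewrite (cnormM (RtoC (a x))) cnorm_RtoC cnorm_ez.
Qed.

(** By Fubini: the modulus of [ez (- eta) (- tau)] does not involve [tau], so the bound on the
    damped [a] gives a product majorant. *)
Lemma laplace_pairing :
  cint (fun tau => g tau * cint (fun x => RtoC (a x) * ez (- eta) (- tau) x)) =
  cint (fun x => RtoC (a x * expR (- eta * x)) * fourier g x).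
Proof.
have [d hd] := K_bound.
under eq_cint do rewrite -laplace_slice.
rewrite (cint_Fubini K_cM hd); apply: eq_cint => x.
rewrite -cintZ; last exact: cI_fourier.
by apply: eq_cint => tau; rewrite /K /ez RtoCM (mulrC x) -mulNr; ring.
Qed.
End LaplacePairing.

(** The factor [s] of the Laplace formula, moved onto the test function. *)
Definition lin (alpha : R) (f : R -> C) : R -> C := fun tau => Complex alpha tau * f tau.

Lemma smooth_line (alpha : R) : smooth (fun tau : R => Complex alpha tau : C).
Proof.
apply: (@smooth_eq _ (fun tau => RtoC alpha + ci * RtoC tau)).
  by move=> tau; apply: complex_eq; rewrite !ReImE /=; ring.
apply: smooth_D; first exact: smooth_cst.
by apply: smooth_M; [exact: smooth_cst|exact: smooth_id].
Qed.

Lemma Tf_lin alpha f : Tf f -> Tf (lin alpha f).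
Proof. by apply: Tf_M; exact: smooth_line. Qed.

Lemma linD alpha eta f : lin (alpha + eta) f = fun tau => lin alpha f tau + RtoC eta * f tau.
Proof.
apply/funext => tau; rewrite /lin.
have -> : Complex (alpha + eta) tau = Complex alpha tau + RtoC eta.
  by apply: complex_eq; rewrite !ReImE /= ?addr0.
by rewrite mulrDl.
Qed.

Lemma fourier_linD alpha eta f x : Tf f ->
  fourier (lin (alpha + eta) f) x = fourier (lin alpha f) x + RtoC eta * fourier f x.
Proof.
move=> Tff; rewrite linD fourier_D; last by apply: cW_Z; exact: Tf_cW.
  by rewrite fourier_Z//; exact: Tf_cW.
by apply: Tf_cW; exact: Tf_lin.
Qed.

Definition modul (y : R) (f : R -> C) : R -> C := fun tau => cexpi (y * tau) * f tau.

Lemma Tf_modul y f : Tf f -> Tf (modul y f).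
Proof. by apply: Tf_M; exact: smooth_cexpi. Qed.

Variables (alpha : R) (F : C -> C) (cc : C) (ep : R -> R).
Hypothesis mep : measurable_fun setT ep.
Hypothesis epE : forall eta, 0 < eta -> exists2 c, 0 <= c &
  forall x, `|ep x| * expR (- eta * x) <= c * wt x.
Hypothesis FE : forall eta tau, 0 < eta -> F (Complex (alpha + eta) tau) =
  Complex (alpha + eta) tau * cint (fun x => RtoC (ep x) * ez (- eta) (- tau) x) + cc.

Lemma boundary_pairing eta y f : 0 < eta -> Tf f ->
  cint (fun tau => F (Complex (alpha + eta) tau) * modul y f tau) =
  cint (fun x => RtoC (ep x * expR (- eta * x)) * fourier (lin (alpha + eta) f) (x - y))
  + cc * fourier f (- y).
Proof.
move=> eta0 Tff; have [c c0 hc] := epE eta0.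
have Tq := Tf_modul y (Tf_lin (alpha + eta) Tff).
have Tm := Tf_modul y Tff.
transitivity (cint (fun tau => modul y (lin (alpha + eta) f) tau *
    cint (fun x => RtoC (ep x) * ez (- eta) (- tau) x) + cc * modul y f tau)).
  by apply: eq_cint => tau; rewrite FE// /modul /lin; ring.
rewrite cintD; [|exact: cI_laplace mep hc (Tf_cW Tq)|by apply: cI_Z; exact: Tf_cI].
rewrite (laplace_pairing mep hc (Tf_cW Tq)) cintZ; last exact: Tf_cI.
have -> : fourier f (- y) = cint (modul y f).
  rewrite -[- y]add0r -fourier_modulate /fourier.
  by apply: eq_cint => tau; rewrite mul0r oppr0 cexpi0 mul1r.
apply: (f_equal (fun z => z + _)); apply: eq_cint => x.
by rewrite -fourier_modulate.
Qed.

Variable B : R.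
Hypothesis epB : forall x, `|ep x| <= B.
Hypothesis ep0 : forall x, x <= 0 -> ep x = 0.

(** Both the damping and the factor [alpha + eta + it] vary with [eta]; the latter merely adds [eta]
    times the transform of [f]. Boundedness of [ep] makes the majorant independent of [eta]. *)
Lemma boundary_pairing_lim (eta : nat -> R) y f : (forall n, 0 < eta n) ->
  eta n @[n --> \oo] --> (0 : R) -> Tf f ->
  ccvg (fun n => cint (fun tau => F (Complex (alpha + eta n) tau) * modul y f tau))
    (tpair ep (lin alpha f) y + cc * fourier f (- y)).
Proof.
move=> eta0 eta_lim Tff.
have [c c_ge0 hc] := fourier_wt Tff.
have Tq := Tf_lin alpha Tff; have [c' c'_ge0 hc'] := fourier_wt Tq.
have B0 : 0 <= B := le_trans (normr_ge0 _) (epB 0).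
have [M M0 hM] : exists2 M, 0 <= M & forall n, eta n <= M.
  have [M [_ hM]] := cvg_seq_bounded (cvgP _ eta_lim).
  exists (M + 1); last by move=> n; rewrite (le_trans (ler_norm _))// hM// ltrDl.
  by rewrite (le_trans (normr_ge0 (eta 0%N)))// hM// ltrDl.
have shift g d : (forall x : R, cnorm (fourier g x) <= d * wt x) -> 0 <= d -> forall x,
    cnorm (fourier g (x - y)) <= d * (2 * (1 + y ^+ 2)) * wt x.
  move=> h d0 x; rewrite (le_trans (h _))// -mulrA ler_wpM2l//.
  by rewrite (le_trans (wt_shift _ _))// sqrrN.
have -> : tpair ep (lin alpha f) y = cint (fun x => RtoC (ep x) * fourier (lin alpha f) (x - y)).
  rewrite /tpair -[RHS](cint_shift y); first by apply: eq_cint => x; rewrite addrK.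
  apply: (@cI_W _ _ (B * (c' * (2 * (1 + y ^+ 2))))).
    apply: cM_M; first exact: cM_RtoC.
    by apply: cM_comp; [exact: cM_fourier|exact: measurable_funB].
  move=> x; rewrite cnormM cnorm_RtoC -mulrA; apply: ler_pM; rewrite ?cnorm_ge0//.
  exact: shift.
have ex1 n x : 0 < x -> expR (- eta n * x) <= 1.
  by move=> x0; rewrite -expR0 ler_expR mulNr oppr_le0 mulr_ge0// ltW.
(* The damping exceeds [1] only on the negative half-line, where [ep] is zero. *)
have epe n x : `|ep x * expR (- eta n * x)| <= B.
  rewrite normrM (ger0_norm (expR_ge0 _)); have [x0|x0] := ltP 0 x.
    by rewrite -[B]mulr1 ler_pM ?expR_ge0// ex1.
  by rewrite ep0// normr0 mul0r.
have D := @cint_DCT _ (fun n x => RtoC (ep x * expR (- eta n * x)) * fourier (lin (alpha + eta n) f) (x - y))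
   (fun x => RtoC (ep x) * fourier (lin alpha f) (x - y))
   (B * ((c' + M * c) * (2 * (1 + y ^+ 2)))).
have {}D : ccvg (fun n => cint (fun x => RtoC (ep x * expR (- eta n * x)) * fourier (lin (alpha + eta n) f) (x - y)))
   (cint (fun x => RtoC (ep x) * fourier (lin alpha f) (x - y))).
  apply: D.
  - move=> n; apply: cM_M.
      apply: cM_RtoC; apply: measurable_funM => //.
      by apply: measurableT_comp => //; exact: measurable_funM.
    by apply: cM_comp; [apply: cM_fourier; exact: Tf_lin|exact: measurable_funB].
  - apply: cM_M; first exact: cM_RtoC.
    by apply: cM_comp; [exact: cM_fourier|exact: measurable_funB].
  - move=> x.
    have e1 : ep x * expR (- eta n * x) @[n --> \oo] --> ep x.
      rewrite -[X in _ --> X]mulr1; apply: cvgM; first exact: cvg_cst.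
      have h : - eta n * x @[n --> \oo] --> - 0 * x.
        by apply: cvgM; [exact: cvgN|exact: cvg_cst].
      rewrite oppr0 mul0r in h.
      by have := cvg_comp _ _ h (@continuous_expR R 0); rewrite expR0.
    have e1' : ccvg (fun n => RtoC (ep x * expR (- eta n * x))) (RtoC (ep x)).
      by apply/ccvgP; split => //=; exact: cvg_cst.
    have e2 : ccvg (fun n => fourier (lin (alpha + eta n) f) (x - y)) (fourier (lin alpha f) (x - y)).
      rewrite /ccvg; under eq_fun do rewrite fourier_linD// addrAC subrr add0r cnormM cnorm_RtoC.
      have : `|eta n| @[n --> \oo] --> (0 : R) by rewrite -(normr0 R); exact: cvg_norm.
      move=> /cvgM/(_ (cvg_cst (cnorm (fourier f (x - y))))); rewrite mul0r; exact.
    move/ccvgP: e1' => [a1 a2]; move/ccvgP: e2 => [b1 b2].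
    apply/ccvgP; split; rewrite !ReImE.
      under eq_fun do rewrite ReImE; apply: cvgB; exact: cvgM.
    by under eq_fun do rewrite ReImE; apply: cvgD; exact: cvgM.
  - move=> n x; rewrite cnormM cnorm_RtoC -mulrA; apply: ler_pM; rewrite ?cnorm_ge0//.
    rewrite fourier_linD// (le_trans (cnormD _ _))// mulrDl mulrDl lerD//; first exact: shift.
    rewrite cnormM cnorm_RtoC -!mulrA; apply: ler_pM; rewrite ?cnorm_ge0//.
      by rewrite ger0_norm ?hM// ltW.
    by have := shift _ _ hc c_ge0 x; rewrite -!mulrA.
have eN n := boundary_pairing y (eta0 n) Tff.
move: D; rewrite /ccvg; set z := cint (fun x => RtoC (ep x) * _); set w := cc * _.
suff -> : (fun n => cnorm (cint (fun tau => F (Complex (alpha + eta n) tau) * modul y f tau) - (z + w))) =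
  (fun n => cnorm (cint (fun x => RtoC (ep x * expR (- eta n * x)) * fourier (lin (alpha + eta n) f) (x - y)) - z)).
  by [].
apply/funext => n; rewrite eN -/w; apply: f_equal.
by move: (cint _) z w => z1 z2 z3; ring.
Qed.

End Pairing.

Section Remainder.
Context {R : realType}.
Local Notation C := R[i].
Local Notation Re := complex.Re.
Local Notation Im := complex.Im.

Variables (S : R -> R) (alpha : R) (L : C -> C) (N : nat) (r0 : R) (r theta t : 'I_N -> R).
Hypothesis alpha0 : 0 < alpha.
Hypothesis Snd : forall x y : R, 0 <= x -> x <= y -> S x <= S y.
Hypothesis Sneg : forall x : R, x < 0 -> S x = 0.
Hypothesis SL : forall s : C, alpha < Re s -> is_LS S s (L s).

Local Notation m := (main_term alpha r0 r theta t).

Definition remainder (x : R) : R := stp 0 x * (S x * expR (- (alpha * x)) - m x).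

Lemma measurable_remainder : measurable_fun setT remainder.
Proof.
apply: measurable_funM; first exact: measurable_stp.
apply: measurable_funB; last exact: measurable_main_term.
apply: measurable_funM; first exact: (measurable_S Snd Sneg).
by apply: measurableT_comp => //; apply: measurableT_comp => //; exact: measurable_funM.
Qed.

Lemma remainder_exp eta : 0 < eta -> exists2 c, 0 <= c &
  forall x, `|remainder x| * expR (- eta * x) <= c * wt x.
Proof.
move=> eta0.
have ae : alpha < alpha + eta by rewrite ltrDl.
have [c c0 hc] := S_exp_wt alpha0 Snd Sneg SL ae.
have [M M0 hM] := main_term_bounded r0 r theta t alpha0.
have [d d0 hd] := exp_wt eta0.
exists (c + M * d); first by rewrite addr_ge0// mulr_ge0.
move=> x; rewrite /remainder; have [x0|x0] := ltP 0 x; last first.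
  by rewrite /stp ltNge x0 mul0r normr0 mul0r mulr_ge0 ?wt_ge0// addr_ge0// mulr_ge0.
have s1 : stp 0 x = 1 by rewrite /stp x0.
have := hc 0 x; rewrite s1 !mul1r cnormM cnorm_RtoC cnorm_ez => h.
have h2 : M * expR (- eta * x) <= M * d * wt x.
  by rewrite -mulrA ler_wpM2l// mulNr hd// ltW.
have e : expR (- (alpha + eta) * x) = expR (- (alpha * x)) * expR (- eta * x).
  by rewrite -expRD; congr expR; ring.
rewrite e mulrA in h.
have h3 : `|S x * expR (- (alpha * x)) - m x| <= `|S x| * expR (- (alpha * x)) + M.
  by rewrite (le_trans (ler_normB _ _))// normrM (ger0_norm (expR_ge0 _)) lerD2l.
have h4 := ler_wpM2r (expR_ge0 (- eta * x)) h3.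
rewrite mulrDl in h4; rewrite mulrDl; lra.
Qed.

Lemma remainder_formula eta tau : 0 < eta ->
  LS_remainder L alpha r0 r theta t (Complex (alpha + eta) tau) =
  Complex (alpha + eta) tau * cint (fun x => RtoC (remainder x) * ez (- eta) (- tau) x)
  + cconst alpha r0 r theta t.
Proof.
move=> eta0; have ae : alpha < alpha + eta by rewrite ltrDl.
have [c c0 hc] := remainder_exp eta0.
rewrite /LS_remainder (laplace_transform alpha0 Snd Sneg SL)//=.
have i1 : cI (fun x => RtoC (remainder x) * ez (- eta) (- tau) x).
  apply: (@cI_W _ _ c).
    by apply: cM_M; [apply: cM_RtoC; exact: measurable_remainder|exact: cM_ez].
  by move=> x; rewrite (cnormM (RtoC (remainder x))) cnorm_RtoC cnorm_ez.
have [M M0 hM] := main_term_bounded r0 r theta t alpha0.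
have [d d0 hd] := exp_wt eta0.
have i2 : cI (fun x => RtoC (stp 0 x * m x) * ez (- eta) (- tau) x).
  apply: (@cI_W _ _ (M * d)).
    apply: cM_M; last exact: cM_ez.
    by apply: cM_RtoC; apply: measurable_funM; [exact: measurable_stp|exact: measurable_main_term].
  move=> x; rewrite (cnormM (RtoC (stp 0 x * m x))) cnorm_RtoC cnorm_ez /stp.
  have [x0|x0] := ltP 0 x; last by rewrite mul0r normr0 mul0r !mulr_ge0 ?wt_ge0.
  by rewrite mul1r -mulrA ler_pM ?expR_ge0// mulNr hd// ltW.
have -> : cint (fun u => RtoC (stp 0 u * S u) * ez (- (alpha + eta)) (- tau) u) =
  cint (fun x => RtoC (remainder x) * ez (- eta) (- tau) x)
  + cint (fun x => RtoC (stp 0 x * m x) * ez (- eta) (- tau) x).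
  rewrite -cintD//; apply: eq_cint => x; rewrite -mulrDl -RtoCD /remainder.
  have -> : ez (- (alpha + eta)) (- tau) x = RtoC (expR (- (alpha * x))) * ez (- eta) (- tau) x.
    by rewrite /ez [RHS]mulrA -RtoCM -expRD; congr (RtoC (expR _) * _); ring.
  rewrite [LHS]mulrA -RtoCM; apply: (f_equal (fun z => RtoC z * _)); ring.
rewrite mulrDr (@laplace_main_term R alpha r0 N r theta t alpha0 eta tau eta0).
have -> : Complex (alpha + eta) tau - RtoC alpha = Complex eta tau.
  by apply: complex_eq; rewrite !ReImE /=; ring.
have -> : \sum_(n < N) RtoC (r n) * (cexpi (theta n) / (Complex (alpha + eta) tau - Complex alpha (t n))
    + cexpi (- theta n) / (Complex (alpha + eta) tau - Complex alpha (- t n))) =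
  \sum_(n < N) RtoC (r n) * (cexpi (theta n) / Complex eta (tau - t n)
    + cexpi (- theta n) / Complex eta (tau + t n)).
  apply: eq_bigr => n _; have [e1 e2] : Complex (alpha + eta) tau - Complex alpha (t n) = Complex eta (tau - t n)
      /\ Complex (alpha + eta) tau - Complex alpha (- t n) = Complex eta (tau + t n).
    by split; apply: complex_eq; rewrite !ReImE /=; ring.
  by rewrite e1 e2.
move: (_ * cint _) (RtoC r0 / _) (\sum_(n < N) _) (cconst _ _ _ _ _) => z1 z2 z3 z4; ring.
Qed.

End Remainder.

(** * From boundary behaviour to asymptotics *)

Section BoundaryLocal.
Context {R : realType}.
Local Notation C := R[i].
Local Notation Re := complex.Re.
Local Notation Im := complex.Im.

Lemma invn1_cvg0 : (n.+1%:R^-1 : R) @[n --> \oo] --> (0 : R).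
Proof. exact: cvg_harmonic. Qed.

Lemma Tf_near (t0 d : R) (f : R -> C) : smooth f -> (forall x, d <= `|x - t0| -> f x = 0) -> Tf f.
Proof.
move=> sf hf; split=> //; exists (`|t0| + d) => x hx; apply: hf.
by have := ler_normB x (x - t0); rewrite opprB addrCA subrr addr0 => h; have := ler_normD (x - t0) t0; rewrite subrK; lra.
Qed.

Lemma lpf_local (F : C -> C) (alpha : R) (U : set R) (t0 : R) :
  lpf_boundary F alpha U -> U t0 -> exists2 d, 0 < d & exists P, pseudofunction P /\
    forall f, smooth f -> (forall x, d <= `|x - t0| -> f x = 0) ->
    forall eta : nat -> R, (forall n, 0 < eta n) -> eta n @[n --> \oo] --> (0 : R) ->
    ccvg (fun n => cint (fun tau => F (Complex (alpha + eta n) tau) * f tau)) (P f).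
Proof.
move=> [g [[_ gloc] gF]] Ut0; have [V [oV Vt0 VU [P [psP gP]]]] := gloc _ Ut0.
have /nbhs_ballP[r /= r0 rV] := open_nbhs_nbhs (conj oV Vt0).
exists (r / 2); first by rewrite divr_gt0.
exists P; split=> // f sf f0 eta eta0 etal.
have cf : csmooth f by apply/csmoothE.
have KV : `[t0 - r / 2, t0 + r / 2] `<=` V.
  move=> x /=; rewrite in_itv /= => /andP[h1 h2]; apply: rV; rewrite /ball /= ltr_norml.
  by apply/andP; split; lra.
have fK x : ~ `[t0 - r / 2, t0 + r / 2]%classic x -> f x = 0.
  move=> nx; apply: f0; rewrite leNgt; apply/negP => h; apply: nx.
  by move: h; rewrite ltr_norml /= in_itv /= => /andP[h1 h2]; apply/andP; split; lra.
have tV : test_fun V f by split=> //; exists `[t0 - r / 2, t0 + r / 2]%classic; split=> //; exact: segment_compact.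
have tU : test_fun U f.
  by split=> //; exists `[t0 - r / 2, t0 + r / 2]%classic; split=> //; [exact: segment_compact|exact: subset_trans VU].
rewrite -(gP f tV); apply/cvgrPdist_lt => e e0.
have [d [d0 hd]] := gF f tU e e0; near=> n.
rewrite sub0r normrN ger0_norm ?cnorm_ge0//; apply: hd.
rewrite ltrDl eta0 /= ltrD2l.
near: n; move/cvgrPdist_lt : etal => /(_ d d0); apply: filterS => n /=.
by rewrite sub0r normrN gtr0_norm.
Unshelve. all: by end_near.
Qed.

Lemma rint_ge0 (f : R -> R) : (forall x, 0 <= f x) -> 0 <= rint f.
Proof. by move=> f0; rewrite /rint /Rintegral fine_ge0// integral_ge0// => x _; rewrite lee_fin. Qed.

Variable alpha : R.
Hypothesis alpha0 : 0 < alpha.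

Definition unlin (p : R -> C) : R -> C := fun tau => (Complex alpha tau)^-1 * p tau.

Lemma lin_unlin p : lin alpha (unlin p) = p.
Proof.
apply/funext => tau; rewrite /lin /unlin mulrA mulfV ?mul1r//.
by apply: Complex_neq0; rewrite gt_eqF.
Qed.

Lemma Tf_unlin p : Tf p -> Tf (unlin p).
Proof. by apply: Tf_M; exact: smooth_inv_line. Qed.

(** [(alpha + it)^-1] is the transform of [exp(-alpha v)] on [v > 0], so dividing by [alpha + it]
    averages translates of [k] with positive weights. *)
Lemma fourier_unlin_ge0 p (k : R -> R) : Tf p -> (forall x, fourier p x = RtoC (k x)) ->
  (forall x, 0 <= k x) -> exists kf : R -> R,
    (forall x, fourier (unlin p) x = RtoC (kf x)) /\ (forall x, 0 <= kf x).
Proof.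
move=> Tp pk k0; exists (fun x => rint (fun v => (stp 0 v * expR (- alpha * v)) * k (v + x))); split=> x.
  have [c c0 hc] := exp_wt alpha0.
  have ac v : `|stp 0 v| * expR (- alpha * v) <= c * wt v.
    rewrite /stp; have [v0|v0] := ltP 0 v; last by rewrite normr0 mul0r mulr_ge0 ?wt_ge0.
    by rewrite normr1 mul1r mulNr hc// ltW.
  have := laplace_pairing (measurable_stp 0) ac (Tf_cW (Tf_modul (- x) Tp)).
  under [in X in _ = X -> _]eq_cint do rewrite fourier_modulate opprK pk -RtoCM.
  rewrite cint_RtoC => <-; apply: eq_cint => tau; rewrite cint_ez_pos// /modul /unlin.
  have -> : - (Complex (- alpha) (- tau))^-1 = (Complex alpha tau)^-1.
    by rewrite -invrN; congr (_^-1); apply: complex_eq; rewrite !ReImE /= ?opprK.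
  rewrite mulNr; ring.
by apply: rint_ge0 => v; rewrite !mulr_ge0 ?expR_ge0// /stp ler0n.
Qed.

Lemma positive_window p (k : R -> R) : Tf p -> (forall x, fourier p x = RtoC (k x)) -> 0 < k 0 ->
  exists2 h : R, 0 < h & forall x, 0 < x -> x <= h -> k 0 / 2 <= k x.
Proof.
move=> Tp pk k0.
have kc : {for 0, continuous k}.
  have [+ _] := hasd_continuous (hasd_fourier_Tf Tp).
  by under eq_fun do rewrite pk; move=> /(_ 0).
have k2 : 0 < k 0 / 2 by rewrite divr_gt0.
move/cvgrPdist_lt : kc => /(_ _ k2)/nbhs_ballP[h /= h0 hh].
exists (h / 2); first by rewrite divr_gt0.
move=> x x0 xh; have := hh x; rewrite /ball /= sub0r normrN gtr0_norm// => /(_ ltac:(lra)).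
by rewrite ltr_norml => /andP[_]; lra.
Qed.

Lemma wt_cvgy0 : wt y @[y --> +oo] --> (0 : R).
Proof.
apply/cvgrPdist_lt => e e0; near=> y.
have y0 : e^-1 + 1 <= y by near: y; apply: nbhs_pinfty_ge; rewrite num_real.
have e1 : 0 < e^-1 by rewrite invr_gt0.
rewrite sub0r normrN ger0_norm ?wt_ge0// /wt -[e]invrK ltf_pV2 ?posrE//; last first.
  by rewrite ltr_pwDl ?sqr_ge0.
nra.
Unshelve. all: by end_near.
Qed.

End BoundaryLocal.

(** * Boundedness of the remainder *)

Section ForwardBound.
Context {R : realType}.
Local Notation C := R[i].
Local Notation Re := complex.Re.
Local Notation Im := complex.Im.
Local Notation W := (rint (@wt R)).

Variables (S : R -> R) (alpha : R) (L : C -> C) (N : nat) (r0 : R) (r theta t : 'I_N -> R).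
Hypothesis alpha0 : 0 < alpha.
Hypothesis Snd : forall x y : R, 0 <= x -> x <= y -> S x <= S y.
Hypothesis Sneg : forall x : R, x < 0 -> S x = 0.
Hypothesis SL : forall s : C, alpha < Re s -> is_LS S s (L s).

Local Notation m := (main_term alpha r0 r theta t).
Local Notation ep := (remainder S alpha r0 r theta t).
Local Notation cc := (cconst alpha r0 r theta t).
Local Notation F := (LS_remainder L alpha r0 r theta t).

Let mep : measurable_fun setT ep := measurable_remainder alpha r0 r theta t Snd Sneg.
Let epE := remainder_exp r0 r theta t alpha0 Snd Sneg SL.
Let FE := remainder_formula r0 r theta t alpha0 Snd Sneg SL.

Lemma S_lower x : 0 <= x -> 0 <= S x + `|S 0|.
Proof. by move=> x0; have := Snd (lexx 0) x0; have := ler_norm (- S 0); rewrite normrN; lra. Qed.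

Lemma remainder_lower (M x eta : R) : (forall x, `|m x| <= M) -> 0 < eta -> 0 < x ->
  - (M + `|S 0|) <= ep x * expR (- eta * x).
Proof.
move=> hM eta0 x0; have s1 : stp 0 x = 1 by rewrite /stp x0.
have M0 : 0 <= M := le_trans (normr_ge0 _) (hM 0).
have ex : expR (- eta * x) <= 1 by rewrite -expR0 ler_expR mulNr oppr_le0 mulr_ge0// ltW.
have ax : expR (- (alpha * x)) <= 1 by rewrite -expR0 ler_expR oppr_le0 mulr_ge0// ltW.
have h1 : - (M + `|S 0|) <= ep x.
  rewrite /remainder s1 mul1r; have := S_lower (ltW x0); have := hM x; rewrite ler_norml => /andP[_ h] h2.
  have : - (`|S 0|) <= S x * expR (- (alpha * x)).
    have := expR_ge0 (- (alpha * x)); have := normr_ge0 (S 0); nra.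
  lra.
have := expR_ge0 (- eta * x); have := normr_ge0 (S 0); nra.
Qed.

(** Monotonicity replaces [S x] by [S y] to the right of [y], and [eta * (y + h) <= 1] keeps the
    damping above [expR (- 1)]. Adding [|S 0|] makes [S] nonnegative, so that lower bounds of the
    exponentials can be multiplied in. *)
Lemma remainder_ge (M x y h eta : R) : (forall x, `|m x| <= M) -> 0 < eta -> 0 < y -> y < x -> x <= y + h ->
  eta * (y + h) <= 1 ->
  (S y + `|S 0|) * expR (- (alpha * (y + h))) * expR (- 1) - (M + `|S 0|) <= ep x * expR (- eta * x).
Proof.
move=> hM eta0 y0 yx xh eh; have x0 : 0 < x by lra.
have s1 : stp 0 x = 1 by rewrite /stp x0.
have M0 : 0 <= M := le_trans (normr_ge0 _) (hM 0).
have ex : expR (- eta * x) <= 1 by rewrite -expR0 ler_expR mulNr oppr_le0 mulr_ge0// ltW.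
have ex1 : expR (- 1) <= expR (- eta * x).
  rewrite ler_expR mulNr lerN2; apply: le_trans eh; rewrite ler_wpM2l// ltW//.
have ax : expR (- (alpha * x)) <= 1 by rewrite -expR0 ler_expR oppr_le0 mulr_ge0// ltW.
have ax1 : expR (- (alpha * (y + h))) <= expR (- (alpha * x)).
  by rewrite ler_expR lerN2 ler_wpM2l// ltW.
have sy := S_lower (ltW y0); have := Snd (ltW y0) (ltW yx).
have h1 : (S x + `|S 0|) * expR (- (alpha * x)) - (M + `|S 0|) <= ep x.
  rewrite /remainder s1 mul1r; have := hM x; rewrite ler_norml => /andP[_ h2].
  have := normr_ge0 (S 0); nra.
move=> sxy.
have h2 : (S y + `|S 0|) * expR (- (alpha * (y + h))) <= (S x + `|S 0|) * expR (- (alpha * x)).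
  by apply: ler_pM => //; lra.
have h3 : (S y + `|S 0|) * expR (- (alpha * (y + h))) * expR (- 1) <=
    (S x + `|S 0|) * expR (- (alpha * x)) * expR (- eta * x).
  by apply: ler_pM => //; rewrite mulr_ge0 ?expR_ge0.
have h4 : ((S x + `|S 0|) * expR (- (alpha * x)) - (M + `|S 0|)) * expR (- eta * x) <= ep x * expR (- eta * x).
  by rewrite ler_wpM2r// expR_ge0.
have := normr_ge0 (S 0); have := expR_ge0 (- eta * x); nra.
Qed.

(** For each large [y] a positive [eta] is fixed, small in terms of [y]. The pairing is bounded
    above through the pseudofunction. It is bounded below by positivity of the kernel:
    [remainder_ge] applies on the window []y, y + h]] and [remainder_lower] at other positive
    points. Comparison bounds [S y] from above. *)
Lemma remainder_bounded (U : set R) : lpf_boundary F alpha U -> U 0 ->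
  exists2 B, 0 <= B & forall x, `|ep x| <= B.
Proof.
move=> FU U0; have [d d0 [P [psP hP]]] := lpf_local FU U0.
have [p [k [Tp psupp pk k_ge0 k0]]] := positive_kernel d0.
have [kf [fk kf_ge0]] := fourier_unlin_ge0 alpha0 Tp pk k_ge0.
set f := unlin alpha p in fk.
have Tff : Tf f by exact: Tf_unlin.
have [M M0 hM] := main_term_bounded r0 r theta t alpha0.
have [c1 c10 hc1] := fourier_wt Tp; have [c2 c20 hc2] := fourier_wt Tff.
have [D D0 hD] := Tf_bounded_fourier Tff.
have kw x : k x <= c1 * wt x by have := hc1 x; rewrite pk cnorm_RtoC ger0_norm.
have kfw x : kf x <= c2 * wt x by have := hc2 x; rewrite fk cnorm_RtoC ger0_norm.
have [h h0 hk] := positive_window Tp pk k0.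
have /cvgrPdist_lt/(_ _ ltr01)[Y [_ hY]] := pseudofunction_vanish psP Tff.
pose M' : R := M + `|S 0|; have M'0 : 0 <= M' by rewrite /M' addr_ge0.
(* The [2] adds two tolerances [1]: distance to the boundary value, and size of the boundary value
   for [y > Y]. The last term is the loss caused by the lower bound [- M'] of the damped
   remainder. *)
pose C1 := 2 + cnorm cc * D + M' * (c1 + c2) * W.
have bound y : Y < y -> 0 < y ->
    (S y + `|S 0|) * expR (- (alpha * (y + h))) * expR (- 1) * (k 0 / 2) * h <= C1.
  move=> Yy y0.
  have mf0 x : d <= `|x - 0| -> modul y f x = 0.
    by move=> hx; rewrite /modul /f /unlin psupp ?mulr0//; move: hx; rewrite subr0.
  have := hP (modul y f) (Tf_modul y Tff).1 mf0 (fun n => n.+1%:R^-1) _ invn1_cvg0.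
  move=> /(_ ltac:(by move=> n; rewrite invr_gt0 ltr0n)).
  move/cvgrPdist_lt/(_ _ ltr01) => [n1 _ hn1].
  have yh0 : 0 < (y + h)^-1 by rewrite invr_gt0 addr_gt0.
  have /cvgrPdist_lt/(_ _ yh0)[n2 _ hn2] := @invn1_cvg0 R.
  (* [n1] gives closeness to the boundary value, [n2] the condition [eta * (y + h) <= 1]. *)
  pose n := maxn n1 n2; pose eta : R := n.+1%:R^-1.
  have eta0 : 0 < eta by rewrite invr_gt0 ltr0n.
  have eta1 : eta <= 1 by rewrite invf_le1 ?ltr0n// ler1n.
  have eh : eta * (y + h) <= 1.
    have := hn2 n; rewrite /= leq_max leqnn orbT => /(_ isT).
    rewrite sub0r normrN gtr0_norm// -/eta => /ltW.
    by rewrite -[_ ^-1]mul1r ler_pdivlMr ?addr_gt0.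
  have := hn1 n; rewrite /= leq_max leqnn => /(_ isT).
  rewrite sub0r normrN ger0_norm ?cnorm_ge0// -/eta => a1.
  have := hY y Yy; rewrite /= sub0r normrN ger0_norm ?cnorm_ge0// => a2.
  have := boundary_pairing mep epE FE y eta0 Tff.
  set A := cint (fun tau => _ * modul y f tau) in a1 *.
  have -> : cint (fun x => RtoC (ep x * expR (- eta * x)) * fourier (lin (alpha + eta) f) (x - y)) =
     RtoC (rint (fun x => ep x * expR (- eta * x) * (k (x - y) + eta * kf (x - y)))).
    rewrite -cint_RtoC; apply: eq_cint => x; rewrite fourier_linD// lin_unlin// pk fk.
    by rewrite -RtoCM -RtoCD -RtoCM.
  set J := rint _ => AJ.
  have a3 : J <= 2 + cnorm cc * D.
    have e1 : RtoC J = (A - P (modul y f)) + (P (modul y f) - cc * fourier f (- y)).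
      by rewrite AJ; ring.
    have a4 : cnorm (cc * fourier f (- y)) <= cnorm cc * D by rewrite cnormM ler_wpM2l ?cnorm_ge0.
    have := cnormD (A - P (modul y f)) (P (modul y f) - cc * fourier f (- y)).
    have := cnormB (P (modul y f)) (cc * fourier f (- y)).
    rewrite -e1 cnorm_RtoC; have := ler_norm J; rewrite /modul in a2 *; lra.
  pose A1 := (S y + `|S 0|) * expR (- (alpha * (y + h))) * expR (- 1).
  have A10 : 0 <= A1 by rewrite /A1; apply: mulr_ge0; [apply: mulr_ge0; [exact: S_lower (ltW y0)|exact: expR_ge0]|exact: expR_ge0].
  have a5 : rint (fun x => A1 * (k 0 / 2) * chi y (y + h) x + (- (M' * (c1 + c2))) * wt (1 * x + - y)) <= J.
    have [ce ce0 hce] := epE eta0.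
    apply: le_rint.
    - apply: rID; first by apply: rIZ; exact: rI_chi.
      by apply: rIZ; apply: rI_affine; [exact: oner_neq0|exact: rI_wt].
    - apply: (@rI_dom _ _ (ce * (c1 + c2))).
        apply: measurable_funM.
          apply: measurable_funM; first exact: mep.
          by apply: measurableT_comp => //; exact: measurable_funM.
        have mk (q : R -> R) (g : R -> C) : Tf g -> (forall x : R, fourier g x = RtoC (q x)) -> measurable_fun setT (fun x : R => q (x - y)).
          move=> Tg gq; have [+ _] := cM_affine 1 (- y) (cM_fourier Tg).
          by under eq_fun do rewrite gq mul1r /=.
        apply: measurable_funD; first exact: mk Tp pk.
        by apply: measurable_funM => //; exact: mk Tff fk.
      move=> x; rewrite normrM normrM (ger0_norm (expR_ge0 _)).
      rewrite [leRHS](_ : _ = ce * wt x * (c1 + c2)); last by ring.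
      apply: ler_pM; [by apply: mulr_ge0; rewrite ?expR_ge0|exact: normr_ge0|exact: hce|].
      rewrite ger0_norm ?addr_ge0 ?mulr_ge0 ?(ltW eta0)//.
      apply: lerD; first by rewrite (le_trans (kw _))// ler_piMr ?wt_le1.
      rewrite -[c2]mul1r; apply: ler_pM => //; first exact: ltW.
      by rewrite (le_trans (kfw _))// ler_piMr ?wt_le1.
    - move=> x; rewrite mul1r.
      have K0 : 0 <= k (x - y) + eta * kf (x - y) by rewrite addr_ge0// mulr_ge0// ltW.
      have K1 : k (x - y) + eta * kf (x - y) <= (c1 + c2) * wt (x - y).
        rewrite mulrDl lerD//; apply: le_trans (kfw _); rewrite ler_piMl//.
      have K2 : k (x - y) <= k (x - y) + eta * kf (x - y) by rewrite lerDl mulr_ge0// ltW.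
      have w0 := wt_ge0 (x - y).
      rewrite /chi; case: (boolP (_ && _)) => [/andP[yx xh]|_].
        have g1 := remainder_ge hM eta0 y0 yx xh eh; rewrite -/A1 -/M' in g1.
        have g2 : k 0 / 2 <= k (x - y) by apply: hk; lra.
        rewrite mulr1.
        have g3 := ler_wpM2r K0 g1; apply: le_trans g3; rewrite mulrBl.
        have g4 : A1 * (k 0 / 2) <= A1 * (k (x - y) + eta * kf (x - y)) by rewrite ler_wpM2l//; lra.
        have g5 := ler_wpM2l M'0 K1; rewrite mulNr -(mulrA M'); exact: lerB.
      rewrite mulr0 add0r.
      have [x0|x0] := ltP 0 x; last first.
        by rewrite /remainder /stp ltNge x0 !mul0r mulNr oppr_le0 !mulr_ge0 ?addr_ge0.
      have g1 := remainder_lower hM eta0 x0; rewrite -/M' in g1.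
      have g3 := ler_wpM2r K0 g1; apply: le_trans g3.
      have g5 := ler_wpM2l M'0 K1; rewrite mulNr -(mulrA M') mulNr lerN2; exact: g5.
  move: a5; rewrite rintD; [|by apply: rIZ; exact: rI_chi|by apply: rIZ; apply: rI_affine; [exact: oner_neq0|exact: rI_wt]].
  rewrite rintZ; last exact: rI_chi.
  rewrite rintZ; last by apply: rI_affine; [exact: oner_neq0|exact: rI_wt].
  rewrite rint_chi; last by rewrite lerDl ltW.
  have := @rint_affine R 1 (- y) (@wt R) (oner_neq0 _) (@rI_wt R); rewrite normr1 mul1r => ->.
  have -> : y + h - y = h by ring.
  rewrite -/A1 mulNr lerBlDr => a6; apply: (le_trans a6).
  by rewrite /C1 lerD2r.
pose Y1 := Num.max Y 0 + 1.
have Y10 : 0 < Y1 by rewrite /Y1 ltr_wpDl// le_max lexx orbT.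
(* The inequality [bound] solved for [S y], the shift by [h] costing [expR (alpha * h)]. *)
pose C2 := Num.max C1 0 * 2 / k 0 / h * expR 1 * expR (alpha * h).
have C20 : 0 <= C2 by rewrite /C2 !mulr_ge0 ?expR_ge0 ?invr_ge0 ?(ltW h0) ?(ltW k0)// le_max lexx orbT.
have C2E y : Y < y -> 0 < y -> (S y + `|S 0|) * expR (- (alpha * y)) <= C2.
  move=> Yy y0; have := bound y Yy y0.
  have -> : - (alpha * (y + h)) = - (alpha * y) - alpha * h by ring.
  rewrite expRD (expRN (alpha * h)) => b1.
  have b2 : (S y + `|S 0|) * (expR (- (alpha * y)) / expR (alpha * h)) * expR (- 1) * (k 0 / 2) * h <= Num.max C1 0.
    by rewrite (le_trans b1)// le_max lexx.
  rewrite /C2.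
  have -> : (S y + `|S 0|) * expR (- (alpha * y)) =
    (S y + `|S 0|) * (expR (- (alpha * y)) / expR (alpha * h)) * expR (- 1) * (k 0 / 2) * h * (2 / k 0 / h * expR 1 * expR (alpha * h)).
    rewrite [expR (-1)]expRN; field.
    by rewrite !gt_eqF ?expR_gt0.
  rewrite [leRHS](_ : _ = Num.max C1 0 * (2 / k 0 / h * expR 1 * expR (alpha * h))); last by ring.
  by apply: ler_wpM2r b2; rewrite !mulr_ge0 ?expR_ge0 ?invr_ge0 ?(ltW h0) ?(ltW k0).
exists (C2 + (`|S Y1| + `|S 0|) + `|S 0| + M); first by rewrite !addr_ge0.
move=> x; rewrite /remainder /stp; have [x0|x0] := ltP 0 x; last by rewrite mul0r normr0 !addr_ge0.
rewrite mul1r (le_trans (ler_normB _ _))//; apply: lerD; last exact: hM.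
have ax : expR (- (alpha * x)) <= 1 by rewrite -expR0 ler_expR oppr_le0 mulr_ge0// ltW.
have e0 := expR_ge0 (- (alpha * x)).
have Sx : `|S x| <= (S x + `|S 0|) + `|S 0|.
  have := S_lower (ltW x0); have := normr_ge0 (S 0); move=> b1 b2; rewrite ler_norml; apply/andP; split; lra.
have hb : (S x + `|S 0|) * expR (- (alpha * x)) <= C2 + (`|S Y1| + `|S 0|).
  have [xY|xY] := leP x Y1; last first.
    have := C2E x; have : Y < x by apply: le_lt_trans xY; rewrite /Y1 (@le_trans _ _ (Num.max Y 0)) ?le_max ?lexx// lerDl.
    by move=> b1 /(_ b1 x0) b2; rewrite (le_trans b2)// lerDl addr_ge0.
  have b1 := @Snd x Y1 (ltW x0) xY; have b2 := ler_norm (S Y1); have b3 := S_lower (ltW x0).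
  rewrite (@le_trans _ _ (S x + `|S 0|)) ?ler_piMr//; lra.
rewrite normrM (ger0_norm e0); have := ler_wpM2r e0 Sx; rewrite mulrDl.
have : `|S 0| * expR (- (alpha * x)) <= `|S 0| by rewrite ler_piMr.
lra.
Qed.

End ForwardBound.

(** * Goodness of all test functions for the remainder *)

Section ForwardGood.
Context {R : realType}.
Local Notation C := R[i].
Local Notation Re := complex.Re.
Local Notation Im := complex.Im.
Local Notation mu := (@lebesgue_measure R).

Lemma cvgy_dominated (u v : R -> R) : (forall y, 0 <= u y) -> (forall y, u y <= v y) ->
  v y @[y --> +oo] --> (0 : R) -> u y @[y --> +oo] --> (0 : R).
Proof.
move=> u0 uv v0; apply: (@squeeze_cvgr _ _ _ _ (fun=> 0) v) => //; last exact: cvg_cst.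
by near=> y; rewrite u0 uv.
Unshelve. all: by end_near.
Qed.

Lemma cint_chi_cexpi (w x : R) : w != 0 -> 0 < x ->
  cnorm (cint (fun v => RtoC (chi 0 x v) * cexpi (w * v))) <= 2 / `|w|.
Proof.
move=> w0 x0.
have d0 : RtoC w * ci != 0 :> C.
  apply/eqP => h; have := cnormM (RtoC w) ci; rewrite h cnorm0 cnorm_RtoC cnorm_ci mulr1.
  by move/esym/eqP; rewrite normr_eq0 (negPf w0).
have h1 := hasd_Z (RtoC w * ci)^-1 (hasd_cexpi_lin w).
have h1' : hasd (fun v : R => (RtoC w * ci)^-1 * cexpi (w * v)) (fun v => cexpi (w * v)).
  by apply: hasd_eq h1 => // v; rewrite mulrA mulVf// mul1r.
rewrite (cint_chi_FTC (ltW x0) h1' (hasd_cexpi_lin w)).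
rewrite (le_trans (cnormB _ _))// !cnormM !cnorm_cexpi cnormV cnormM cnorm_RtoC cnorm_ci !mulr1.
by rewrite -mulr2n mulr_natl.
Qed.

(** Reflecting and conjugating a test function conjugates its transform, and [ep] is real. *)
Lemma locgood_opp (ep : R -> R) (B : R) (s : R) : measurable_fun setT ep -> (forall x, `|ep x| <= B) ->
  locgood ep (- s) -> locgood ep s.
Proof.
move=> mep epB [d d0 hd]; exists d => // f sf f0.
have Tff := Tf_near sf f0.
pose g (x : R) := cconj (f (- x)).
have sg : smooth g.
  have := smooth_cconj (smooth_affine (-1) 0 sf).
  by apply: smooth_eq => x; rewrite /g mulN1r addr0.
have g0 (x : R) : d <= `|x - - s| -> g x = 0.
  by move=> hx; rewrite /g f0 ?cconj0// -opprD normrN -[s]opprK.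
have fg x : fourier g x = cconj (fourier f x).
  have [mf [c hc]] := Tf_cW Tff.
  rewrite /fourier -cint_cconj; last exact: cI_fourier (Tf_cW Tff).
  rewrite -[RHS]cint_reflect; last first.
    apply: (@cI_W _ _ c); first by apply: cM_cconj; exact: cM_fourier_integrand.
    by move=> u; rewrite cnorm_cconj cnorm_cexpiM.
  by apply: eq_cint => u; rewrite cconjM cconj_cexpi !mulrN !opprK.
have e : (fun y => cnorm (tpair ep g y)) = (fun y => cnorm (tpair ep f y)).
  apply/funext => y; rewrite -[RHS]cnorm_cconj /tpair -cint_cconj; last exact: (tpair_cI mep epB y Tff).
  by congr cnorm; apply: eq_cint => x; rewrite fg cconjM cconj_RtoC.
by rewrite /good -e; exact: hd g sg g0.
Qed.

Variables (S : R -> R) (alpha : R) (L : C -> C) (N : nat) (r0 : R) (r theta t : 'I_N -> R).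
Hypothesis alpha0 : 0 < alpha.
Hypothesis Snd : forall x y : R, 0 <= x -> x <= y -> S x <= S y.
Hypothesis Sneg : forall x : R, x < 0 -> S x = 0.
Hypothesis SL : forall s : C, alpha < Re s -> is_LS S s (L s).

Local Notation m := (main_term alpha r0 r theta t).
Local Notation ep := (remainder S alpha r0 r theta t).
Local Notation cc := (cconst alpha r0 r theta t).
Local Notation F := (LS_remainder L alpha r0 r theta t).

Let mep : measurable_fun setT ep := measurable_remainder alpha r0 r theta t Snd Sneg.
Let epE := remainder_exp r0 r theta t alpha0 Snd Sneg SL.
Let FE := remainder_formula r0 r theta t alpha0 Snd Sneg SL.

Lemma remainder_eq0 x : x <= 0 -> ep x = 0.
Proof. by move=> x0; rewrite /remainder /stp ltNge x0 mul0r. Qed.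

Variable B : R.
Hypothesis epB : forall x, `|ep x| <= B.

(** The boundary formula is applied to [unlin alpha f], whose image under [lin] is [f]; the additive
    constant contributes a Fourier transform, which decays. *)
Lemma remainder_locgood (U : set R) t0 : lpf_boundary F alpha U -> U t0 -> locgood ep t0.
Proof.
move=> FU Ut0; have [d d0 [P [psP hP]]] := lpf_local FU Ut0.
exists d => // f sf f0; have Tff := Tf_near sf f0.
have Tg := Tf_unlin alpha0 Tff; have [c c0 hc] := fourier_wt Tg.
have e y : tpair ep f y + cc * fourier (unlin alpha f) (- y) = P (modul y (unlin alpha f)).
  have eta0 n : (0 : R) < n.+1%:R^-1 by rewrite invr_gt0 ltr0n.
  apply: (@ccvg_unique R (fun n => cint (fun tau => F (Complex (alpha + n.+1%:R^-1) tau) * modul y (unlin alpha f) tau))).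
    have := boundary_pairing_lim mep epE FE epB remainder_eq0 y eta0 (@invn1_cvg0 R) Tg.
    by rewrite lin_unlin.
  apply: hP => //; last exact: invn1_cvg0.
    exact: (Tf_modul y Tg).1.
  by move=> x hx; rewrite /modul /unlin f0// !mulr0.
have van := pseudofunction_vanish psP Tg.
apply: (@cvgy_dominated _ (fun y => cnorm (P (modul y (unlin alpha f))) + cnorm cc * (c * wt y))).
- by move=> y; exact: cnorm_ge0.
- move=> y; rewrite (_ : tpair ep f y = P (modul y (unlin alpha f)) - cc * fourier (unlin alpha f) (- y)).
    rewrite (le_trans (cnormB _ _))// lerD2l cnormM ler_wpM2l ?cnorm_ge0// (le_trans (hc _))//.
    by rewrite /wt sqrrN.
  by rewrite -e addrK.
rewrite -[X in _ --> X]addr0; apply: cvgD => //.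
rewrite -[X in _ --> X](mulr0 (cnorm cc)); apply: cvgM; first exact: cvg_cst.
by rewrite -[X in _ --> X](mulr0 c); apply: cvgM; [exact: cvg_cst|exact: wt_cvgy0].
Qed.

(** The excluded points are the frequencies of the main term; at a nonzero frequency distance [w], a
    truncated integral of [exp(iwv)] is at most [2 / |w|]. *)
Lemma fourier_main_term u : u != 0 -> (forall n, u != t n) -> (forall n, u != - t n) ->
  exists2 D, 0 <= D & forall x, 0 < x ->
    cnorm (cint (fun v => RtoC (chi 0 x v * m v) * cexpi (- (u * v)))) <= D.
Proof.
move=> u0 ut unt.
pose b (w : R) := 2 / `|w|.
exists (cnorm (RtoC (r0 / alpha) : C) * b (- u)
  + \sum_(n < N) (cnorm (cplus alpha r theta t n) * b (t n - u) + cnorm (cminus alpha r theta t n) * b (- t n - u))).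
  rewrite addr_ge0 ?mulr_ge0 ?cnorm_ge0 ?divr_ge0//; apply: sumr_ge0 => n _.
  by rewrite addr_ge0 ?mulr_ge0 ?cnorm_ge0 ?divr_ge0.
move=> x x0.
have ci1 (w : R) : cI (fun v => RtoC (chi 0 x v) * cexpi (w * v)).
  apply: (@chi_dom _ 0 x 1) => // [|v _ _]; last by rewrite cnorm_cexpi.
  by apply: cM_cexpi; exact: measurable_funM.
have ci2 n : cI (fun v => cplus alpha r theta t n * (RtoC (chi 0 x v) * cexpi ((t n - u) * v))
   + cminus alpha r theta t n * (RtoC (chi 0 x v) * cexpi ((- t n - u) * v))).
  by apply: cI_D; apply: cI_Z.
have -> : (fun v => RtoC (chi 0 x v * m v) * cexpi (- (u * v))) =
  (fun v => RtoC (r0 / alpha) * (RtoC (chi 0 x v) * cexpi (- u * v))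
    + \sum_(n < N) (cplus alpha r theta t n * (RtoC (chi 0 x v) * cexpi ((t n - u) * v))
      + cminus alpha r theta t n * (RtoC (chi 0 x v) * cexpi ((- t n - u) * v)))).
  apply/funext => v; rewrite RtoCM main_termE// mulrDr mulrDl mulNr; congr (_ + _); first by ring.
  rewrite mulr_sumr mulr_suml; apply: eq_bigr => n _.
  have -> : (t n - u) * v = t n * v + - (u * v) by ring.
  have -> : (- t n - u) * v = - t n * v + - (u * v) by ring.
  by rewrite !cexpiD; ring.
rewrite cintD; [|exact: cI_Z|exact: cI_sum].
rewrite cintZ// cint_sum// (le_trans (cnormD _ _))// cnormM; apply: lerD.
  by rewrite ler_wpM2l ?cnorm_ge0// cint_chi_cexpi// oppr_eq0.
rewrite (le_trans (cnorm_sum _ _))//; apply: ler_sum => n _.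
rewrite cintD; [|exact: cI_Z|exact: cI_Z]; rewrite !cintZ// (le_trans (cnormD _ _))//.
rewrite (cnormM (cplus _ _ _ _ n)) (cnormM (cminus _ _ _ _ n)).
apply: lerD; apply: ler_wpM2l; rewrite ?cnorm_ge0//; apply: cint_chi_cexpi => //.
  by rewrite subr_eq0 eq_sym.
by rewrite subr_eq0 eq_sym.
Qed.

(** Parts turns (III) into a bound on the truncated transform of [S]: the boundary term
    [S(x) exp(-alpha x)] is bounded because [ep] is, and the factor [alpha + iu] has modulus at
    least [alpha]. The main term is then subtracted. *)
Lemma remainder_bounded_at u M0 : u != 0 -> (forall n, u != t n) -> (forall n, u != - t n) ->
  (forall x : R, 0 < x -> exists I : C,
     is_RS (fun v => cexp (- (Complex alpha u * RtoC v))) S 0 x I /\ cnorm I < M0) ->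
  exists M, bounded_at ep u M.
Proof.
move=> u0 ut unt hI; have [D D0 hD] := fourier_main_term u0 ut unt.
have [Mm Mm0 hMm] := main_term_bounded r0 r theta t alpha0.
exists ((M0 + (B + Mm) + `|S 0|) / alpha + D) => x x0.
have [I [I1 I2]] := hI x x0.
have IE := RS_exp_parts Snd Sneg x0 I1; rewrite /= ez0 mul1r in IE.
set J := cint _ in IE.
have aC : alpha <= cnorm (Complex alpha u).
  by have := cnorm_Re (Complex alpha u); rewrite /= ger0_norm// ltW.
have Sx : cnorm (ez (- alpha) (- u) x * RtoC (S x)) <= B + Mm.
  rewrite cnormM cnorm_ez cnorm_RtoC -(ger0_norm (expR_ge0 _)) -normrM.
  have e1 : expR (- alpha * x) * S x = ep x + m x.
    by rewrite /remainder /stp x0 mul1r subrK mulrC mulNr.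
  by rewrite e1 (le_trans (ler_normD _ _))// lerD.
have hJ : cnorm J <= (M0 + (B + Mm) + `|S 0|) / alpha.
  rewrite ler_pdivlMr//; apply: (@le_trans _ _ (cnorm (Complex alpha u * J))).
    by rewrite cnormM mulrC ler_wpM2r ?cnorm_ge0.
  have -> : Complex alpha u * J = I - ez (- alpha) (- u) x * RtoC (S x) + RtoC (S 0).
    by rewrite IE; ring.
  rewrite (le_trans (cnormD _ _))// cnorm_RtoC lerD2r (le_trans (cnormB _ _))// lerD// ltW//.
have m1 : cI (fun v => RtoC (chi 0 x v * S v) * ez (- alpha) (- u) v).
  have [c c0 hc] := S_growth alpha0 Snd Sneg SL (be := alpha + 1) ltac:(lra).
  have -> : (fun v => RtoC (chi 0 x v * S v) * ez (- alpha) (- u) v) =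
     (fun v => RtoC (chi 0 x v) * (RtoC (S v) * ez (- alpha) (- u) v)).
    by apply/funext => v; rewrite RtoCM mulrA.
  apply: (@chi_dom _ 0 x (c * expR x)).
  - by apply: cM_M; [apply: cM_RtoC; exact: measurable_S Snd Sneg|exact: cM_ez].
  - by rewrite mulr_ge0 ?expR_ge0.
  move=> v v0 vx; rewrite (cnormM (RtoC (S v))) cnorm_RtoC cnorm_ez.
  rewrite (@le_trans _ _ (c * expR ((alpha + 1) * v) * expR (- alpha * v)))//.
    by rewrite ler_wpM2r ?expR_ge0// hc// ltW.
  rewrite -mulrA -expRD ler_wpM2l// ler_expR; lra.
have m2 : cI (fun v => RtoC (chi 0 x v * m v) * cexpi (- (u * v))).
  have -> : (fun v => RtoC (chi 0 x v * m v) * cexpi (- (u * v))) =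
     (fun v => RtoC (chi 0 x v) * (RtoC (m v) * cexpi (- (u * v)))).
    by apply/funext => v; rewrite RtoCM mulrA.
  apply: (@chi_dom _ 0 x Mm) => //; last by move=> v _ _; rewrite cnormM cnorm_cexpi mulr1 cnorm_RtoC.
  by apply: cM_M; [apply: cM_RtoC; exact: measurable_main_term|exact: cM_ker].
have -> : fourier (fun v => RtoC (chi 0 x v * ep v)) u = J - cint (fun v => RtoC (chi 0 x v * m v) * cexpi (- (u * v))).
  rewrite /J -cintB//; apply: eq_cint => v; rewrite /ez mulrA -RtoCM !mulNr -mulrBl -RtoCB mulrC.
  apply: (f_equal (fun z => RtoC z * _)); rewrite /chi; case: (boolP (_ && _)) => [/andP[v0 _]|_] /=; last by rewrite !mul0r subr0.
  by rewrite /remainder /stp v0 /=; ring.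
by rewrite (le_trans (cnormB _ _))// lerD// hD.
Qed.

Lemma remainder_good (E : set R) : closed E -> mu E = 0%E -> lpf_boundary F alpha (~` E) ->
  ~ E 0 -> (forall n, ~ E (t n)) ->
  (forall u : R, E u -> exists M : R, 0 < M /\
     forall x : R, 0 < x -> exists I : C,
       is_RS (fun v => cexp (- (Complex alpha u * RtoC v))) S 0 x I /\ cnorm I < M) ->
  forall f, Tf f -> good ep f.
Proof.
move=> cE E0 FE' E00 Et EI.
have [psi [kp [Tpsi psi0 psiE _ kp0]]] := @positive_kernel R 1 ltr01.
(* [- t n] may belong to [E], but not to this symmetric part; a point of [E] outside it has its
   opposite outside [E] and is handled by [locgood_opp]. *)
pose E' := E `&` [set x | E (- x)].
have cE' : closed E'.
  apply: closedI => //; apply: (@closed_comp _ _ (fun x : R => - x)) cE => x _.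
  by apply: continuousN; exact: cvg_id.
apply: (good_everywhere mep epB remainder_eq0 Tpsi psi0 psiE kp0 (E := E')) => //.
- apply/eqP; rewrite eq_le measure_ge0 andbT -E0 le_measure ?inE//.
  + exact: closed_measurable.
  + exact: closed_measurable.
  + by move=> x [].
- move=> s nEs.
  have [Es|nE] := pselect (E s).
    apply: (locgood_opp mep epB); apply: remainder_locgood FE' _ => Ens.
    by apply: nEs; split=> //=.
  exact: remainder_locgood FE' _.
move=> u [Eu /= Enu]; have [M [_ hM]] := EI u Eu.
apply: remainder_bounded_at hM => //.
- by apply/eqP => u0; apply: E00; rewrite -u0.
- by move=> n; apply/eqP => un; apply: (Et n); rewrite -un.
- by move=> n; apply/eqP => un; apply: (Et n); rewrite -[t n]opprK -un.
Qed.

End ForwardGood.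

(** * A Tauberian argument for slowly decreasing functions *)

Section SlowlyDecreasing.
Context {R : realType}.
Local Notation C := R[i].
Local Notation W := (rint (@wt R)).

Variables (ep : R -> R) (B D : R).
Hypothesis mep : measurable_fun setT ep.
Hypothesis epB : forall x, `|ep x| <= B.
Hypothesis D0 : 0 <= D.
Hypothesis slow : forall y x : R, 0 < y -> y <= x -> ep y - D * (x - y) <= ep x.

Variables (p : R -> C) (k : R -> R) (c : R).
Hypothesis Tp : Tf p.
Hypothesis pk : forall x, fourier p x = RtoC (k x).
Hypothesis k_ge0 : forall x, 0 <= k x.
Hypothesis kc : forall x, k x <= c * wt x ^+ 2.

Let c_ge0 : 0 <= c.
Proof. by have := kc 0; rewrite /wt expr0n addr0 invr1 expr1n mulr1; exact: le_trans. Qed.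

Let mk : measurable_fun setT k.
Proof. by have [+ _] := cM_fourier Tp; under eq_fun do rewrite pk. Qed.

Let kwt x : k x <= c * wt x.
Proof.
rewrite (le_trans (kc x))// ler_wpM2l// expr2 ler_piMr ?wt_ge0 ?wt_le1//.
Qed.

Let rIk : rI k.
Proof. by apply: (@rI_dom _ _ c) => // x; rewrite ger0_norm. Qed.

(** If [sg * ep] stays above [e] on the window, its average against the nonnegative kernel
    [k (d * x)] is nearly [e] times the mass of [k]; the loss comes from the tail. The sign [sg]
    covers upper and lower deviations together. *)
Lemma kernel_average (sg y h e d : R) : `|sg| = 1 -> 0 < d -> 0 <= h -> 0 <= e ->
  (forall x, `|x| <= h -> e <= sg * ep (x + y)) ->
  e * rint k - (e + B) * c * wt (d * h) * W <= d * cnorm (tpair ep (dilate d 0 p) y).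
Proof.
move=> sg1 d0 h0 e0 win; have B0 : 0 <= B := le_trans (normr_ge0 _) (epB 0).
have dn : d != 0 by rewrite gt_eqF.
pose J := rint (fun x => ep (x + y) * k (d * x)).
have -> : tpair ep (dilate d 0 p) y = RtoC J.
  rewrite /J -cint_RtoC; apply: eq_cint => x.
  by rewrite fourier_dilate// mul0r oppr0 cexpi0 mul1r pk -RtoCM.
have rIkd : rI (fun x => k (d * x)).
  by have := rI_affine 0 dn rIk; under eq_fun do rewrite addr0.
have rIwd : rI (fun x => wt (d * x)).
  by have := rI_affine 0 dn (@rI_wt R); under eq_fun do rewrite addr0.
have kdE : d * rint (fun x => k (d * x)) = rint k.
  by rewrite -(rint_affine 0 dn rIk) gtr0_norm//; under [in RHS]eq_fun do rewrite addr0.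
have wdE : d * rint (fun x => wt (d * x)) = W.
  by rewrite -(rint_affine 0 dn (@rI_wt R)) gtr0_norm//; under [in RHS]eq_fun do rewrite addr0.
have mepy : measurable_fun setT (fun x : R => ep (x + y)).
  by have := measurable_affine 1 y mep; under eq_fun do rewrite mul1r.
have rIJ : rI (fun x => ep (x + y) * k (d * x)).
  have [bw hbw] : exists b, forall x, wt (d * x) <= b * wt x.
    exists (1 + (d^-1) ^+ 2) => x; rewrite /wt -ler_pdivrMr ?invr_gt0 ?ltr_pwDl ?sqr_ge0//.
    rewrite invrK mulrC ler_pdivrMr ?ltr_pwDl ?sqr_ge0//.
    have -> : (d * x) ^+ 2 = d ^+ 2 * x ^+ 2 by ring.
    have -> : (1 + d^-1 ^+ 2) * (1 + d ^+ 2 * x ^+ 2) = 1 + x ^+ 2 + (d^-1 ^+ 2 + d ^+ 2 * x ^+ 2) by field.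
    by rewrite lerDl addr_ge0 ?sqr_ge0// mulr_ge0 ?sqr_ge0.
  apply: (@rI_dom _ _ (B * (c * bw))).
    apply: measurable_funM => //.
    by have := measurable_affine d 0 mk; under eq_fun do rewrite addr0.
  move=> x; rewrite normrM -mulrA; apply: ler_pM => //; rewrite ger0_norm// (le_trans (kwt _))//.
  by rewrite -mulrA ler_wpM2l.
have le1 : rint (fun x => e * k (d * x) + (- ((e + B) * c * wt (d * h))) * wt (d * x)) <=
    rint (fun x => sg * (ep (x + y) * k (d * x))).
  apply: le_rint.
  - by apply: rID; apply: rIZ.
  - exact: rIZ.
  move=> x; rewrite mulrA.
  have [xh|xh] := leP `|x| h.
    have h1 := ler_wpM2r (k_ge0 (d * x)) (win x xh).
    by rewrite (le_trans _ h1)// gerDl mulNr oppr_le0 !mulr_ge0 ?wt_ge0// addr_ge0.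
  (* Outside the window one factor [wt] is evaluated at its edge, giving smallness, and the other
     remains for integration. *)
  have h2 : k (d * x) <= c * wt (d * h) * wt (d * x).
    rewrite (le_trans (kc _))// -mulrA ler_wpM2l// expr2 ler_wpM2r ?wt_ge0//.
    rewrite /wt lef_pV2 ?posrE ?ltr_pwDl ?sqr_ge0// lerD2l -[leRHS]real_normK ?num_real//.
    by rewrite ler_pXn2r ?nnegrE ?mulr_ge0 ?(ltW d0)// normrM gtr0_norm// ler_wpM2l ?(ltW d0)// ltW.
  have h3 : - B <= sg * ep (x + y).
    by rewrite -[leRHS]opprK lerN2 (le_trans (ler_norm _))// normrN normrM sg1 mul1r.
  have h4 := ler_wpM2r (k_ge0 (d * x)) h3; apply: le_trans h4.
  have h5 := ler_wpM2l (addr_ge0 e0 B0) h2.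
  have -> : - ((e + B) * c * wt (d * h)) * wt (d * x) = - ((e + B) * (c * wt (d * h) * wt (d * x))) by ring.
  by rewrite lerBlDr mulNr -lerBlDl opprK -mulrDl.
rewrite rintD in le1; [|exact: rIZ|exact: rIZ].
rewrite !rintZ// in le1.
have h6 : sg * J <= cnorm (RtoC J).
  by rewrite cnorm_RtoC (le_trans (ler_norm _))// normrM sg1 mul1r.
have h7 := ler_wpM2l (ltW d0) (le_trans le1 h6).
apply: le_trans h7; rewrite mulrDr.
have -> : d * (e * rint (fun x => k (d * x))) = e * (d * rint (fun x => k (d * x))) by ring.
have -> : d * (- ((e + B) * c * wt (d * h)) * rint (fun x => wt (d * x))) =
  - ((e + B) * c * wt (d * h) * (d * rint (fun x => wt (d * x)))) by ring.
by rewrite kdE wdE.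
Qed.

Hypothesis k0 : 0 < k 0.
Hypothesis all_good : forall f, Tf f -> good ep f.

Lemma rint_kernel_gt0 : 0 < rint k.
Proof.
have [h h0 hk] := positive_window Tp pk k0.
have := @le_rint R (fun x => k 0 / 2 * chi 0 h x) k _ rIk.
rewrite rintZ; last exact: rI_chi.
rewrite rint_chi; last exact: ltW.
rewrite subr0 => /(_ (rIZ _ (rI_chi _ _))) hh.
apply: lt_le_trans (hh _); first by rewrite mulr_gt0// divr_gt0.
move=> x; rewrite /chi; case: (boolP (_ && _)) => [/andP[x0 xh]|_] /=; last by rewrite mulr0.
by rewrite mulr1 hk.
Qed.

(** A value above [e] forces [ep >= e / 2] on an interval to its right, a value below [- e] forces
    [ep <= - e / 2] on one to its left. Far out, either contradicts the decay of the pairing with a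
    fixed kernel concentrated on such an interval. *)
Lemma slowly_decreasing_cvg0 : ep x @[x --> +oo] --> (0 : R).
Proof.
have B0 : 0 <= B := le_trans (normr_ge0 _) (epB 0).
have I0 := rint_kernel_gt0; have W0 := @rint_wt_gt0 R.
apply/cvgrPdist_le => e e0.
(* Over the full window, of length [2 * h], slow decrease loses at most [e / 2]. *)
pose h := e / (4 * (D + 1)).
have D1 : 0 < D + 1 by rewrite ltr_wpDl.
have h0 : 0 < h by rewrite divr_gt0// mulr_gt0.
have hD : D * (2 * h) <= e / 2.
  have -> : D * (2 * h) = e / 2 * (D / (D + 1)) by rewrite /h; field; rewrite gt_eqF.
  by rewrite ler_piMr ?divr_ge0 ?(ltW e0)// ler_pdivrMr// mul1r lerDl.
pose K := (e / 2 + B) * c * W.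
have K0 : 0 <= K by rewrite !mulr_ge0 ?addr_ge0 ?divr_ge0 ?(ltW e0) ?(ltW W0).
(* With [d * h = z] and [wt z < dl], the tail in [kernel_average] takes less than half of the main
   part [e / 2 * rint k]; the threshold [T0] on the pairing takes the other half. *)
pose dl := e / 4 * rint k / (K + 1).
have dl0 : 0 < dl by rewrite divr_gt0 ?mulr_gt0 ?ltr_wpDl.
have /cvgrPdist_lt/(_ _ dl0)[z1 [_ hz1]] := @wt_cvgy0 R.
pose z := Num.max z1 0 + 1.
have z0 : 0 < z by rewrite ltr_wpDl// le_max lexx orbT.
have wz : wt z < dl.
  have := hz1 z; rewrite /= sub0r normrN ger0_norm ?wt_ge0//; apply.
  by rewrite /z (@le_lt_trans _ _ (Num.max z1 0)) ?le_max ?lexx// ltrDl.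
pose d := z / h; have d0 : 0 < d by rewrite divr_gt0.
have dh : d * h = z by rewrite /d divfK// gt_eqF.
have T0 : 0 < d^-1 * (e / 4 * rint k) by rewrite !mulr_gt0// ?invr_gt0// divr_gt0.
have /cvgrPdist_lt/(_ _ T0)[Y [_ hY]] := all_good (Tf_dilate 0 d0 Tp).
have key sg y : `|sg| = 1 -> Y < y -> ~ (forall x, `|x| <= h -> e / 2 <= sg * ep (x + y)).
  move=> sg1 Yy win.
  have := kernel_average sg1 d0 (ltW h0) _ win; rewrite dh => /(_ ltac:(by rewrite divr_ge0// ltW)) hA.
  have := hY y Yy; rewrite /= sub0r normrN ger0_norm ?cnorm_ge0// => hB.
  have : d * cnorm (tpair ep (dilate d 0 p) y) < e / 4 * rint k.
    by rewrite -ltr_pdivlMl.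
  have hC : (e / 2 + B) * c * wt z * W < e / 4 * rint k.
    have -> : (e / 2 + B) * c * wt z * W = K * wt z by rewrite /K; ring.
    have := wz; rewrite /dl ltr_pdivlMr ?ltr_wpDl// => hh.
    by rewrite (le_lt_trans _ hh)// mulrC ler_wpM2l ?wt_ge0// lerDl.
  by move: hA; lra.
near=> y.
have yY : Y + h < y by near: y; apply: nbhs_pinfty_gt; rewrite num_real.
have y2 : 2 * h < y by near: y; apply: nbhs_pinfty_gt; rewrite num_real.
rewrite sub0r normrN ler_norml; apply/andP; split; rewrite leNgt; apply/negP => bad.
  apply: (key (-1) (y - h)); [by rewrite normrN1|lra|].
  move=> x; rewrite ler_norml => /andP[x1 x2].
  have := @slow (x + (y - h)) y ltac:(lra) ltac:(lra).
  have : D * (y - (x + (y - h))) <= D * (2 * h) by rewrite ler_wpM2l//; lra.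
  rewrite mulN1r; lra.
apply: (key 1 (y + h)); [by rewrite normr1|lra|].
move=> x; rewrite ler_norml => /andP[x1 x2].
have := @slow y (x + (y + h)) ltac:(lra) ltac:(lra).
have : D * (x + (y + h) - y) <= D * (2 * h) by rewrite ler_wpM2l//; lra.
rewrite mul1r; lra.
Unshelve. all: by end_near.
Qed.

End SlowlyDecreasing.

Section Forward.
Context {R : realType}.
Local Notation C := R[i].
Local Notation Re := complex.Re.
Local Notation mu := (@lebesgue_measure R).

Variables (S : R -> R) (alpha : R) (L : C -> C) (N : nat) (r0 : R) (r theta t : 'I_N -> R).
Hypothesis alpha0 : 0 < alpha.
Hypothesis Snd : forall x y : R, 0 <= x -> x <= y -> S x <= S y.
Hypothesis Sneg : forall x : R, x < 0 -> S x = 0.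
Hypothesis SL : forall s : C, alpha < Re s -> is_LS S s (L s).

Local Notation m := (main_term alpha r0 r theta t).
Local Notation ep := (remainder S alpha r0 r theta t).
Local Notation F := (LS_remainder L alpha r0 r theta t).

(** As [S] does not decrease, [S(x) exp(-alpha x)] falls no faster than its exponential factor,
    whose rate is [alpha] times a bounded size; the main term is Lipschitz. *)
Lemma remainder_slow (B : R) : (forall x, `|ep x| <= B) -> exists2 D, 0 <= D &
  forall y x : R, 0 < y -> y <= x -> ep y - D * (x - y) <= ep x.
Proof.
move=> epB; have B0 : 0 <= B := le_trans (normr_ge0 _) (epB 0).
have [M M0 hM] := main_term_bounded r0 r theta t alpha0.
have [D D0 hD] := main_term_lipschitz alpha r0 r theta t.
exists ((B + M) * alpha + D); first by rewrite addr_ge0// mulr_ge0 ?addr_ge0// ltW.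
move=> y x y0 yx; have x0 := lt_le_trans y0 yx.
have h1' : m x - m y <= D * (x - y).
  by have := hD x y; rewrite (ger0_norm (_ : 0 <= x - y)) ?subr_ge0//; apply: le_trans; exact: ler_norm.
pose u := alpha * (x - y); have u0 : 0 <= u by rewrite mulr_ge0 ?subr_ge0// ltW.
pose T := S y * expR (- (alpha * y)).
have hT : `|T| <= B + M.
  have -> : T = ep y + m y by rewrite /remainder /stp y0 mul1r subrK.
  by rewrite (le_trans (ler_normD _ _))// lerD.
have eu : 1 - u <= expR (- u) by have := expR_ge1Dx (- u).
have eu1 : expR (- u) <= 1 by rewrite -expR0 ler_expR oppr_le0.
have h2 : T * expR (- u) <= S x * expR (- (alpha * x)).
  rewrite /T -mulrA -expRD /u.
  have -> : - (alpha * y) + - (alpha * (x - y)) = - (alpha * x) by ring.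
  by rewrite ler_wpM2r ?expR_ge0// Snd// ltW.
have h3 : T - (B + M) * u <= T * expR (- u).
  rewrite -subr_ge0.
  have -> : T * expR (- u) - (T - (B + M) * u) = (B + M) * u - T * (1 - expR (- u)) by ring.
  rewrite subr_ge0 (le_trans (ler_norm _))// normrM.
  by apply: ler_pM => //; rewrite ger0_norm; lra.
rewrite /remainder /stp x0 y0 !mul1r -/T mulrDl -mulrA -/u.
have := h2; lra.
Qed.

Lemma asymptotics_of_boundary (E : set R) : closed E -> mu E = 0%E -> lpf_boundary F alpha (~` E) ->
  ~ E 0 -> (forall n, ~ E (t n)) ->
  (forall u : R, E u -> exists M : R, 0 < M /\
     forall x : R, 0 < x -> exists I : C,
       is_RS (fun v => cexp (- (Complex alpha u * RtoC v))) S 0 x I /\ cnorm I < M) ->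
  S_asymptotics S alpha r0 r theta t.
Proof.
move=> cE E0 FE E00 Et EI.
have [B B0 epB] := remainder_bounded alpha0 Snd Sneg SL FE E00.
have gd := remainder_good alpha0 Snd Sneg SL epB cE E0 FE E00 Et EI.
have [D D0 hD] := remainder_slow epB.
have [p [k [Tp _ pk k_ge0 k0]]] := @positive_kernel R 1 ltr01.
have [c c0 hc] := fourier_wt2 Tp.
have kc x : k x <= c * wt x ^+ 2 by have := hc x; rewrite pk cnorm_RtoC ger0_norm.
have ep_cvg := slowly_decreasing_cvg0 (measurable_remainder alpha r0 r theta t Snd Sneg)
  epB D0 hD Tp pk k_ge0 kc k0 gd.
apply: cvg_trans ep_cvg; apply: near_eq_cvg; near=> x.
have x0 : 0 < x by near: x; apply: nbhs_pinfty_gt; rewrite num_real.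
by rewrite /remainder /stp x0 mul1r.
Unshelve. all: by end_near.
Qed.

End Forward.

(** * From asymptotics to boundary behaviour *)

Section Cutoff.
Context {R : realType}.
Local Notation C := R[i].
Local Notation Re := complex.Re.
Local Notation Im := complex.Im.
Local Notation W := (rint (@wt R)).

Lemma smooth_inv (v : R -> R) : (forall x, 0 < v x) -> smooth (fun x => RtoC (v x)) ->
  smooth (fun x => RtoC (v x)^-1 : C).
Proof.
move=> v0 /smoothP[g hg sg].
have gI x : Im (g x) = 0.
  have [_ h] := hg x; have h0 := is_derive_cst (0 : R) x (1 : R).
  by rewrite -(@derive_val _ _ _ _ _ _ _ h) -[RHS](@derive_val _ _ _ _ _ _ _ h0).
have hd : hasd (fun x => RtoC (v x)^-1 : C) (fun x => - (g x * (RtoC (v x)^-1 * RtoC (v x)^-1))).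
  move=> x; have [h _] := hg x; rewrite !ReImE /= gI; split; last first.
    rewrite [X in is_derive _ _ _ X](_ : _ = 0) /=; first exact: is_derive_cst.
    by rewrite !(mul0r, mulr0, addr0, oppr0).
  have [h1 h2] := h; apply: DeriveDef.
    by apply: derivableV => //=; rewrite gt_eqF.
  by rewrite deriveV//= ?gt_eqF// h2 /GRing.scale /=; rewrite mul0r !mulr0 !subr0 expr2 invfM; ring.
move=> n; elim: n => // n IH.
exists (fun x => - (g x * (RtoC (v x)^-1 * RtoC (v x)^-1))) => //.
apply: (@Cn_eq _ _ (fun x => (- 1) * (g x * (RtoC (v x)^-1 * RtoC (v x)^-1)))).
  by move=> x; rewrite mulN1r.
by apply: Cn_M; [exact: Cn_cst|apply: Cn_M => //; exact: Cn_M].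
Qed.

(** The quotient [n / (n + o)], where [n] is positive exactly on [|x| < b] and [o] exactly on
    [|x| > |a|]; as [|a| < b], the denominator never vanishes. *)
Lemma cutoff (a : R) : exists2 ch : R -> C, Tf ch & forall x, `|x| <= a -> ch x = 1.
Proof.
pose b := `|a| + 1.
pose n (x : R) : R := flat 0 (1 * x + b) * flat 0 (-1 * x + b).
pose o (x : R) : R := flat 0 (1 * x + - `|a|) + flat 0 (-1 * x + - `|a|).
have n0 x : 0 <= n x by rewrite mulr_ge0 ?flat0_ge0.
have o0 x : 0 <= o x by rewrite addr_ge0 ?flat0_ge0.
have flat_neg (x : R) : x <= 0 -> flat 0 x = 0 by rewrite /flat leNgt => /negPf ->.
have np x : `|x| < b -> 0 < n x.
  by rewrite ltr_norml => /andP[x1 x2]; rewrite mulr_gt0 ?flat0_gt0//; lra.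
have op x : `|a| < `|x| -> 0 < o x.
  rewrite lter_normr => /orP[h|h].
    by rewrite ltr_pwDl ?flat0_ge0// flat0_gt0//; lra.
  by rewrite ltr_wpDl ?flat0_ge0// flat0_gt0//; lra.
have no x : 0 < n x + o x.
  have [h|h] := ltP `|x| b; first by rewrite ltr_pwDl ?np.
  by rewrite ltr_wpDl// op// (lt_le_trans _ h)// ltrDl.
have sn : smooth (fun x => RtoC (n x) : C).
  apply: (@smooth_eq _ (fun x => RtoC (flat 0 (1 * x + b)) * RtoC (flat 0 (-1 * x + b)))).
    by move=> x; rewrite -RtoCM.
  by apply: smooth_M; apply: (smooth_affine _ _ (smooth_flat 0)).
have so : smooth (fun x => RtoC (o x) : C).
  apply: (@smooth_eq _ (fun x => RtoC (flat 0 (1 * x + - `|a|)) + RtoC (flat 0 (-1 * x + - `|a|)))).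
    by move=> x; rewrite -RtoCD.
  by apply: smooth_D; apply: (smooth_affine _ _ (smooth_flat 0)).
exists (fun x => RtoC (n x + o x)^-1 * RtoC (n x)).
  split.
    apply: smooth_M => //; apply: smooth_inv => //.
    by apply: (@smooth_eq _ (fun x => RtoC (n x) + RtoC (o x))); [move=> x; rewrite -RtoCD|exact: smooth_D].
  exists b => x; rewrite ler_normr => h; have -> : n x = 0.
    case/orP: h => h; rewrite /n.
      by rewrite [X in _ * X]flat_neg ?mulr0//; lra.
    by rewrite [X in X * _]flat_neg ?mul0r//; lra.
  by rewrite RtoC0 mulr0.
move=> x xa; have xa' := le_trans xa (ler_norm a).
have o_0 : o x = 0.
  by move: xa'; rewrite ler_norml => /andP[x1 x2]; rewrite /o !flat_neg ?addr0//; lra.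
have := no x; rewrite o_0 addr0 => nx.
by rewrite -RtoCM mulVf ?gt_eqF// RtoC1.
Qed.

Lemma smooth_derivatives (f : R -> C) : smooth f -> exists f' f'',
  [/\ hasd f f', hasd f' f'', cderivn 1 f = f' & cderivn 2 f = f''].
Proof.
move=> /smoothP[f' h1 /smoothP[f'' h2 _]]; exists f', f''; split=> //=.
  exact: hasd_cderiv.
by rewrite (hasd_cderiv h1) (hasd_cderiv h2).
Qed.

(** Two integrations by parts bound [x^2] times the transform, so derivatives up to order [2]
    suffice for an integrable majorant. *)
Lemma fourier_cutoff_bound (psi : R -> C) : Tf psi -> exists2 c, 0 <= c &
  forall (f : R -> C) (M : R), smooth f ->
    (forall (j : nat) (x : R), (j <= 2)%N -> cnorm (cderivn j f x) <= M) ->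
    forall x, cnorm (fourier (fun t => psi t * f t) x) <= c * M * wt x.
Proof.
move=> Tpsi; have W0 := @rint_wt_gt0 R.
have [psi' h1 T1] := Tf_derive Tpsi; have [psi'' h2 T2] := Tf_derive T1.
have [m0 [c0 b0]] := Tf_cW Tpsi; have [m1 [c1 b1]] := Tf_cW T1; have [m2 [c2 b2]] := Tf_cW T2.
have p0 := wt_bound_ge0 b0; have p1 := wt_bound_ge0 b1; have p2 := wt_bound_ge0 b2.
exists (2 * (c0 + (c2 + 2 * c1 + c0)) * W).
  by rewrite !mulr_ge0 ?addr_ge0 ?mulr_ge0// ltW.
move=> f M sf fM x.
have [f' [f'' [d1 d2 e1 e2]]] := smooth_derivatives sf.
have M0 u : cnorm (f u) <= M := fM 0%N u isT.
have M1 u : cnorm (f' u) <= M by rewrite -e1; exact: fM.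
have M2 u : cnorm (f'' u) <= M by rewrite -e2; exact: fM.
have Mge0 : 0 <= M := le_trans (cnorm_ge0 _) (M0 0).
have Tp : Tf (fun t => psi t * f t).
  by under eq_fun do rewrite mulrC; exact: Tf_M.
have hd1 := hasd_M h1 d1.
have hd2 : hasd (fun t => psi' t * f t + psi t * f' t)
    (fun t => (psi'' t * f t + psi' t * f' t) + (psi' t * f' t + psi t * f'' t)).
  by apply: hasd_D; exact: hasd_M.
have Td1 : Tf (fun t => psi' t * f t + psi t * f' t).
  by have [g hg Tg] := Tf_derive Tp; rewrite -(hasd_cderiv hd1) (hasd_cderiv hg).
have Td2 : Tf (fun t => (psi'' t * f t + psi' t * f' t) + (psi' t * f' t + psi t * f'' t)).
  by have [g hg Tg] := Tf_derive Td1; rewrite -(hasd_cderiv hd2) (hasd_cderiv hg).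
have mb (g k : R -> C) (d : R) : (forall u, cnorm (g u) <= d * wt u) -> (forall u, cnorm (k u) <= M) ->
    forall u, cnorm (g u * k u) <= d * M * wt u.
  by move=> gd kM u; rewrite cnormM mulrAC; apply: ler_pM; rewrite ?cnorm_ge0.
have q0 := fourier_le x (Tf_cM Tp) (mb _ _ _ b0 M0).
have q2 : cnorm (fourier (fun t => (psi'' t * f t + psi' t * f' t) + (psi' t * f' t + psi t * f'' t)) x)
    <= 2 * ((c2 + 2 * c1 + c0) * M) * W.
  apply: (fourier_le x (Tf_cM Td2)) => u.
  have := mb _ _ _ b2 M0 u; have := mb _ _ _ b1 M1 u; have := mb _ _ _ b0 M2 u => u1 u2 u3.
  rewrite (le_trans (cnormD _ _))//.
  rewrite (@le_trans _ _ ((c2 * M * wt u + c1 * M * wt u) + (c1 * M * wt u + c0 * M * wt u)))//.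
    by apply: lerD; rewrite (le_trans (cnormD _ _))// lerD.
  by rewrite le_eqVlt; apply/orP; left; apply/eqP; ring.
move: q2; rewrite (fourier_derive x Td1 hd2) (fourier_derive x Tp hd1) !cnormM cnorm_ci !mul1r cnorm_RtoC.
move: q0; set z := cnorm _ => q0; rewrite mulrA -expr2 real_normK ?num_real// => q2.
rewrite /wt ler_pdivlMr ?ltr_pwDl ?sqr_ge0// mulrDr mulr1 (mulrC z).
rewrite (_ : 2 * (c0 + (c2 + 2 * c1 + c0)) * W * M = 2 * (c0 * M) * W + 2 * ((c2 + 2 * c1 + c0) * M) * W); last by ring.
exact: lerD.
Qed.

Lemma fourier_mul_fourier (psi phi : R -> C) x : Tf psi -> cW phi ->
  fourier (fun t => psi t * fourier phi t) x = cint (fun u => phi u * fourier psi (x + u)).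
Proof.
move=> Tpsi [mphi [c hc]]; have [mpsi [d hd]] := Tf_cW Tpsi.
pose K t u := cexpi (- (x * t)) * psi t * (cexpi (- (t * u)) * phi u).
have mK : cM (fun z : R * R => K z.1 z.2).
  apply: cM_M.
    by apply: (@cM_comp _ _ _ (fun t => cexpi (- (x * t)) * psi t)); [exact: cM_fourier_integrand|exact: measurable_fst].
  apply: cM_M; last by apply: cM_comp => //; exact: measurable_snd.
  apply: cM_cexpi; apply: measurableT_comp => //; apply: measurable_funM.
    exact: measurable_fst.
  exact: measurable_snd.
have bK t u : cnorm (K t u) <= d * c * (wt t * wt u).
  rewrite /K -mulrA cnorm_cexpiM cnormM cnorm_cexpiM.
  rewrite (_ : d * c * (wt t * wt u) = d * wt t * (c * wt u)); last by ring.
  by apply: ler_pM; rewrite ?cnorm_ge0.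
transitivity (cint (fun t => cint (fun u => K t u))).
  apply: eq_cint => t; rewrite /K mulrA -cintZ//; apply: cI_fourier; split=> //; by exists c.
rewrite (cint_Fubini mK bK); apply: eq_cint => u.
rewrite /fourier -cintZ; last exact: cI_fourier (Tf_cW Tpsi).
apply: eq_cint => t; rewrite /K.
have -> : - ((x + u) * t) = - (x * t) + - (t * u) by ring.
by rewrite cexpiD; ring.
Qed.

End Cutoff.

(** * The boundary distribution of a remainder tending to zero *)

Section ConverseBoundary.
Context {R : realType}.
Local Notation C := R[i].
Local Notation Re := complex.Re.
Local Notation Im := complex.Im.
Local Notation W := (rint (@wt R)).

Variables (alpha : R) (F : C -> C) (cc : C) (ep : R -> R) (B : R).
Hypothesis mep : measurable_fun setT ep.
Hypothesis epE : forall eta, 0 < eta -> exists2 c, 0 <= c &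
  forall x, `|ep x| * expR (- eta * x) <= c * wt x.
Hypothesis FE : forall eta tau, 0 < eta -> F (Complex (alpha + eta) tau) =
  Complex (alpha + eta) tau * cint (fun x => RtoC (ep x) * ez (- eta) (- tau) x) + cc.
Hypothesis epB : forall x, `|ep x| <= B.
Hypothesis ep0 : forall x, x <= 0 -> ep x = 0.
Hypothesis ep_cvg : ep x @[x --> +oo] --> (0 : R).

Let B0 : 0 <= B := le_trans (normr_ge0 _) (epB 0).

Definition bvalue (f : R -> C) : C := tpair ep (lin alpha f) 0 + cc * fourier f 0.

Lemma bvalue_linear (f g : R -> C) (a : C) : Tf f -> Tf g ->
  bvalue (fun x => a * f x + g x) = a * bvalue f + bvalue g.
Proof.
move=> Tff Tg; have Tlf := Tf_lin alpha Tff; have Tlg := Tf_lin alpha Tg.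
have wf := Tf_cW Tff; have wg := Tf_cW Tg; have wlf := Tf_cW Tlf; have wlg := Tf_cW Tlg.
have fl (h k : R -> C) x : cW h -> cW k ->
    fourier (fun u => a * h u + k u) x = a * fourier h x + fourier k x.
  by move=> wh wk; rewrite (fourier_D _ (cW_Z a wh) wk) (fourier_Z _ _ wh).
have e1 : tpair ep (lin alpha (fun x => a * f x + g x)) 0 =
    a * tpair ep (lin alpha f) 0 + tpair ep (lin alpha g) 0.
  have i1 := tpair_cI mep epB 0 Tlf; have i2 := tpair_cI mep epB 0 Tlg.
  have -> : lin alpha (fun x => a * f x + g x) = (fun x => a * lin alpha f x + lin alpha g x).
    by apply/funext => u; rewrite /lin; ring.
  rewrite /tpair -(cintZ a i1) -(cintD (cI_Z a i1) i2); apply: eq_cint => x.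
  rewrite (fl _ _ _ wlf wlg); move: (RtoC _) (fourier _ _) (fourier _ _) => z1 z2 z3; ring.
rewrite /bvalue e1 (fl _ _ _ wf wg).
move: (tpair _ _ _) (tpair _ _ _) (fourier _ _) (fourier _ _) => z1 z2 z3 z4; ring.
Qed.

Lemma lin_mul (ch f : R -> C) : lin alpha (fun t => ch t * f t) = fun t => lin alpha ch t * f t.
Proof. by apply/funext => t; rewrite /lin mulrA. Qed.

Lemma Tf_Mr (ch f : R -> C) : Tf ch -> smooth f -> Tf (fun t => ch t * f t).
Proof. by move=> Tch sf; under eq_fun do rewrite mulrC; exact: Tf_M. Qed.

Lemma tpair_bound (f : R -> C) (c y : R) : cM (fourier f) -> (forall x, cnorm (fourier f x) <= c * wt x) ->
  cnorm (tpair ep f y) <= 2 * (B * c) * W.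
Proof.
move=> mf hf; apply: cint_leW; first by apply: cM_M => //; exact: cM_ep.
exact: tpair_integrand.
Qed.

(** One estimate for two purposes: continuity of [bvalue] as a distribution, and temperedness of its
    product with a cutoff. *)
Lemma bvalue_cutoff (ch : R -> C) : Tf ch -> exists2 c, 0 <= c &
  forall (f : R -> C) (M : R), smooth f ->
    (forall (j : nat) (x : R), (j <= 2)%N -> cnorm (cderivn j f x) <= M) ->
    cnorm (bvalue (fun t => ch t * f t)) <= c * M.
Proof.
move=> Tch; have [c1 c10 h1] := fourier_cutoff_bound (Tf_lin alpha Tch).
have [c2 c20 h2] := fourier_cutoff_bound Tch; have W0 := @rint_wt_gt0 R.
exists (2 * (B * c1) * W + cnorm cc * c2).
  by rewrite addr_ge0 ?mulr_ge0 ?cnorm_ge0// ltW.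
move=> f M sf fM; have M0 : 0 <= M := le_trans (cnorm_ge0 _) (fM 0%N 0 isT).
rewrite /bvalue lin_mul (le_trans (cnormD _ _))// mulrDl; apply: lerD.
  have := @tpair_bound (fun t => lin alpha ch t * f t) (c1 * M) 0 _ (h1 f M sf fM).
  move=> /(_ (cM_fourier (Tf_Mr (Tf_lin alpha Tch) sf))) h.
  by rewrite (le_trans h)// le_eqVlt; apply/orP; left; apply/eqP; ring.
rewrite cnormM -mulrA ler_wpM2l ?cnorm_ge0// (le_trans (h2 f M sf fM 0))//.
by rewrite ler_piMr ?mulr_ge0 ?wt_le1.
Qed.

Lemma bvalue_distribution : Defs.distribution setT bvalue.
Proof.
split=> [f g a /Tf_test Tff /Tf_test Tg|K cK _]; first exact: bvalue_linear.
have [M [_ KM]] := compact_bounded cK.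
have [ch Tch ch1] := cutoff (M + 1).
have [c c0 hc] := bvalue_cutoff Tch.
exists c, 2%N => f Mf /Tf_test[sf _] fK fM.
have -> : f = (fun t => ch t * f t); last exact: hc.
apply/funext => t; have [Kt|Kt] := pselect (K t); last by rewrite fK// mulr0.
by rewrite ch1 ?mul1r//; apply: KM => //; rewrite ltrDl.
Qed.

(** A failure of the one-sided limit would produce a sequence tending to [alpha], against
    [boundary_pairing_lim]. *)
Lemma bvalue_cvg f : Tf f -> forall e : R, 0 < e -> exists d : R, 0 < d /\
  forall sigma : R, alpha < sigma < alpha + d ->
    cnorm (cint (fun t => F (Complex sigma t) * f t) - bvalue f) < e.
Proof.
move=> Tff e e0; apply: contrapT => nex.
have : forall n : nat, exists sigma : R, alpha < sigma < alpha + n.+1%:R^-1 /\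
    e <= cnorm (cint (fun t => F (Complex sigma t) * f t) - bvalue f).
  move=> n; apply: contrapT => nn; apply: nex; exists n.+1%:R^-1.
  split=> [|sigma hs]; first by rewrite invr_gt0 ltr0n.
  by rewrite ltNge; apply/negP => h; apply: nn; exists sigma.
move=> /choice[sg hsg]; pose eta n := sg n - alpha.
have eta0 n : 0 < eta n by have [/andP[+ _] _] := hsg n; rewrite subr_gt0.
have etal : eta n @[n --> \oo] --> (0 : R).
  apply: (@squeeze_cvgr _ _ _ _ (fun=> 0) (fun n => n.+1%:R^-1)); [|exact: cvg_cst|exact: invn1_cvg0].
  by near=> n; have [/andP[h1 h2] _] := hsg n; rewrite (ltW (eta0 n))/= /eta lerBlDl ltW.
have := boundary_pairing_lim mep epE FE epB ep0 0 eta0 etal Tff.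
rewrite oppr0 -/(bvalue f) => /cvgrPdist_lt/(_ _ e0)[n _ hn].
have := hn n (leqnn n); rewrite /= sub0r normrN ger0_norm ?cnorm_ge0//.
have [_] := hsg n.
have -> : modul 0 f = f by apply/funext => u; rewrite /modul mul0r cexpi0 mul1r.
have -> : alpha + eta n = sg n by rewrite /eta; ring.
by move=> h1 h2; have := le_lt_trans h1 h2; rewrite ltxx.
Unshelve. all: by end_near.
Qed.

(** The Fourier transform of [ch] times the boundary distribution [bvalue]. *)
Definition bkernel (ch : R -> C) (u : R) : C := tpair ep (lin alpha ch) (- u) + cc * fourier ch u.

Lemma cM_tpairN (f : R -> C) : Tf f -> cM (fun u : R => tpair ep f (- u)).
Proof.
move=> Tff; have [d d0 hd] := fourier_wt Tff.
(* The factor [wt u] creates the decay in [u] that the measurability lemma asks for; it is divided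
   out at the end. *)
pose K x u := RtoC (wt u) * (RtoC (ep (x - u)) * fourier f x).
have mK : cM (fun z : R * R => K z.1 z.2).
  apply: cM_M.
    by apply: (@cM_comp _ _ _ (fun u => RtoC (wt u))); [apply: cM_RtoC; exact: measurable_wt|exact: measurable_snd].
  apply: cM_M; last by apply: cM_comp; [exact: cM_fourier|exact: measurable_fst].
  apply: (@cM_comp _ _ _ (fun u => RtoC (ep u))); first exact: cM_RtoC.
  by apply: measurable_funB; [exact: measurable_fst|exact: measurable_snd].
have bK x u : cnorm (K x u) <= (B * d) * (wt x * wt u).
  rewrite /K !cnormM !cnorm_RtoC ger0_norm ?wt_ge0// mulrC [B * d * _]mulrA ler_wpM2r ?wt_ge0//.
  by rewrite -mulrA; apply: ler_pM; rewrite ?cnorm_ge0.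
have mq : cM (fun u : R => RtoC (1 + u ^+ 2) : C).
  by apply: cM_RtoC; apply: measurable_funD => //; exact: measurable_funX.
have h := cM_M mq (cM_cint_snd mK bK).
apply: (cM_eq _ h) => u; rewrite cintZ; last exact: (tpair_cI mep epB (- u) Tff).
by rewrite mulrA -RtoCM [_ * wt u]mulrC wtE mul1r.
Qed.

Lemma cM_bkernel (ch : R -> C) : Tf ch -> cM (bkernel ch).
Proof.
move=> Tch; apply: cM_D; first exact: cM_tpairN (Tf_lin alpha Tch).
by apply: cM_M; [exact: cM_cst|exact: cM_fourier].
Qed.

Lemma bvalue_fourier (ch phi : R -> C) : Tf ch -> schwartz phi ->
  bvalue (fun t => ch t * fourier phi t) = cint (fun u => bkernel ch u * phi u).
Proof.
move=> Tch sphi; have [c c0 hc] := schwartz_wt2 sphi.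
have mphi : cM phi by apply: smooth_cM; apply/csmoothE; exact: sphi.1.
have wphi : cW phi.
  split=> //; exists c => u; rewrite (le_trans (hc u))// ler_wpM2l// expr2 ler_piMr ?wt_ge0 ?wt_le1//.
have Tl := Tf_lin alpha Tch.
have [d d0 hd] := fourier_wt Tl; have [d' d'0 hd'] := fourier_wt Tch.
have mfl := cM_fourier Tl; have mfc := cM_fourier Tch.
have [c' hc'] := wphi.2.
pose K x u := RtoC (ep x) * (phi u * fourier (lin alpha ch) (x + u)).
have mK : cM (fun z : R * R => K z.1 z.2).
  apply: cM_M.
    by apply: (@cM_comp _ _ _ (fun x => RtoC (ep x))); [exact: cM_RtoC|exact: measurable_fst].
  apply: cM_M; first by apply: cM_comp => //; exact: measurable_snd.
  apply: cM_comp => //; apply: measurable_funD; [exact: measurable_fst|exact: measurable_snd].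
(* One of the two factors [wt u] pays for Peetre's inequality, which turns [wt (x + u)] into
   [wt x]. *)
have bK x u : cnorm (K x u) <= (B * (c * (2 * d))) * (wt x * wt u).
  rewrite /K cnormM cnorm_RtoC -mulrA; apply: ler_pM; rewrite ?cnorm_ge0// cnormM.
  apply: (@le_trans _ _ ((c * wt u ^+ 2) * (d * (2 * (1 + u ^+ 2) * wt x)))).
    apply: ler_pM; rewrite ?cnorm_ge0// (le_trans (hd _))// ler_wpM2l//; exact: wt_shift.
  have -> : c * wt u ^+ 2 * (d * (2 * (1 + u ^+ 2) * wt x)) =
    c * (2 * d) * (wt x * (wt u * (wt u * (1 + u ^+ 2)))) by ring.
  by rewrite wtE mulr1.
rewrite /bvalue lin_mul.
have -> : tpair ep (fun t => lin alpha ch t * fourier phi t) 0 = cint (fun u => tpair ep (lin alpha ch) (- u) * phi u).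
  transitivity (cint (fun x => cint (fun u => K x u))).
    apply: eq_cint => x; rewrite addr0 fourier_mul_fourier// /K -cintZ//.
    apply: (@cI_W _ _ (c' * d)).
      by apply: cM_M => //; apply: cM_comp => //; exact: measurable_funD.
    move=> u; rewrite cnormM mulrAC; apply: ler_pM; rewrite ?cnorm_ge0//.
    by rewrite (le_trans (hd _))// ler_piMr ?wt_le1.
  rewrite (cint_Fubini mK bK); apply: eq_cint => u.
  rewrite [RHS]mulrC -cintZ; last exact: (tpair_cI mep epB (- u) Tl).
  have i1 : cI (fun x => K x u).
    apply: (@cI_W _ _ (B * (c * (2 * d)) * wt u)); last by move=> x; rewrite mulrAC -mulrA.
    apply: cM_M; first exact: cM_RtoC.
    by apply: cM_M; [exact: cM_cst|apply: cM_comp => //; exact: measurable_funD].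
  rewrite -(cint_shift (- u) i1); apply: eq_cint => x; rewrite /K subrK; ring.
rewrite fourier_mul_fourier//.
under [in X in _ + _ * X]eq_cint do rewrite add0r.
have i2 : cI (fun u => phi u * fourier ch u).
  apply: (@cI_W _ _ (c' * d')); first exact: cM_M.
  move=> u; rewrite cnormM mulrAC; apply: ler_pM; rewrite ?cnorm_ge0//.
  by rewrite (le_trans (hd' _))// ler_piMr ?wt_le1.
have i3 : cI (fun u => tpair ep (lin alpha ch) (- u) * phi u).
  apply: (@cI_W _ _ (2 * (B * d) * W * c')); first by apply: cM_M => //; exact: cM_tpairN.
  by move=> u; rewrite cnormM -mulrA; apply: ler_pM; rewrite ?cnorm_ge0//; exact: tpair_bound.
rewrite -cintZ// -cintD//; last exact: cI_Z.
by apply: eq_cint => u; rewrite /bkernel; ring.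
Qed.

Lemma bkernel_bounded (ch : R -> C) : Tf ch -> exists M, forall u, cnorm (bkernel ch u) <= M.
Proof.
move=> Tch; have Tl := Tf_lin alpha Tch; have [d d0 hd] := fourier_wt Tl.
have [D D0 hD] := Tf_bounded_fourier Tch.
exists (2 * (B * d) * W + cnorm cc * D) => u; rewrite (le_trans (cnormD _ _))//.
apply: lerD; first by apply: tpair_bound => //; exact: cM_fourier.
by rewrite cnormM ler_wpM2l ?cnorm_ge0.
Qed.

Lemma tpair_cvg f : Tf f -> cnorm (tpair ep f y) @[y --> +oo] --> (0 : R).
Proof.
move=> Tff; have [c c0 hc] := fourier_wt Tff.
apply: (@cvgy_DCT _ _ (B * c)).
- by move=> y; apply: cM_M; [exact: cM_ep|exact: cM_fourier].
- by move=> y x; exact: tpair_integrand.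
move=> x; under eq_fun do rewrite cnormM cnorm_RtoC.
have h : `|ep (x + y)| @[y --> +oo] --> (0 : R).
  rewrite -(normr0 R); apply: cvg_norm.
  have xy : x + y @[y --> +oo] --> +oo.
    apply/cvgryPge => A; near=> y; rewrite -lerBlDl.
    by near: y; apply: nbhs_pinfty_ge; rewrite num_real.
  exact: cvg_comp xy ep_cvg.
by have := cvgM h (cvg_cst (cnorm (fourier f x))); rewrite mul0r; exact.
Unshelve. all: by end_near.
Qed.

Lemma tpair_cvgN f : Tf f -> cnorm (tpair ep f (- y)) @[y --> +oo] --> (0 : R).
Proof.
move=> Tff; have [c c0 hc] := fourier_wt Tff.
apply: (@cvgy_DCT _ (fun y x => RtoC (ep (x - y)) * fourier f x) (B * c)).
- by move=> y; apply: cM_M; [exact: cM_ep|exact: cM_fourier].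
- by move=> y x; exact: tpair_integrand.
move=> x; apply: (cvg_near_cst 0); near=> y.
rewrite ep0 ?RtoC0 ?mul0r ?cnorm0// subr_le0.
by near: y; apply: nbhs_pinfty_ge; rewrite num_real.
Unshelve. all: by end_near.
Qed.

Lemma fourier_cvg0 f : Tf f -> cnorm (cc * fourier f y) @[y --> +oo] --> (0 : R) /\
  cnorm (cc * fourier f (- y)) @[y --> +oo] --> (0 : R).
Proof.
move=> Tff; have [c c0 hc] := fourier_wt Tff.
have v : cnorm cc * (c * wt y) @[y --> +oo] --> (0 : R).
  rewrite -[X in _ --> X](mulr0 (cnorm cc)); apply: cvgM; first exact: cvg_cst.
  by rewrite -[X in _ --> X](mulr0 c); apply: cvgM; [exact: cvg_cst|exact: wt_cvgy0].
split; apply: (cvgy_dominated _ _ v) => y; rewrite ?cnorm_ge0//.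
  by rewrite cnormM ler_wpM2l ?cnorm_ge0.
by rewrite cnormM ler_wpM2l ?cnorm_ge0// (le_trans (hc _))// /wt sqrrN.
Qed.

(** At plus infinity the kernel [bkernel ch] samples [ep] on the negative half-line, where it is
    zero; at minus infinity it samples the decay of [ep]. *)
Lemma bvalue_pseudofunction (ch : R -> C) : Tf ch ->
  pseudofunction (fun f => bvalue (fun t => ch t * f t)).
Proof.
move=> Tch; have Tl := Tf_lin alpha Tch; split.
  split=> [f g a [/csmoothE sf _] [/csmoothE sg _]|].
    rewrite -bvalue_linear; [|exact: Tf_Mr|exact: Tf_Mr].
    by congr bvalue; apply/funext => t; ring.
  have [c c0 hc] := bvalue_cutoff Tch; exists c, 2%N => f M [/csmoothE sf _] fM.
  by apply: hc => // j x j2; have := fM j 0%N x j2 isT; rewrite expr0 mul1r.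
have [v1 v2] := fourier_cvg0 Tch.
have [mk1 mk2] := cM_bkernel Tch.
exists (bkernel ch); split; first by split=> //; exact: bkernel_bounded.
split; last by move=> f sf; exact: bvalue_fourier.
  apply: (@cvgy_dominated _ _ (fun y => cnorm (tpair ep (lin alpha ch) (- y)) + cnorm (cc * fourier ch y))).
  - by move=> y; exact: cnorm_ge0.
  - by move=> y; exact: cnormD.
  by rewrite -[X in _ --> X]addr0; apply: cvgD => //; exact: tpair_cvgN.
have h : cnorm (bkernel ch (- y)) @[y --> +oo] --> (0 : R).
  apply: (@cvgy_dominated _ _ (fun y => cnorm (tpair ep (lin alpha ch) y) + cnorm (cc * fourier ch (- y)))).
  - by move=> y; exact: cnorm_ge0.
  - by move=> y; rewrite /bkernel opprK; exact: cnormD.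
  by rewrite -[X in _ --> X]addr0; apply: cvgD => //; exact: tpair_cvg.
have yN : - y @[y --> -oo] --> (+oo : set_system R).
  by apply/cvgryPge => A; near=> y; rewrite lerNr; near: y; apply: nbhs_ninfty_le; rewrite num_real.
have -> : (fun x => cnorm (bkernel ch x)) = (fun y => cnorm (bkernel ch (- y))) \o -%R.
  by apply/funext => y /=; rewrite opprK.
exact: cvg_comp yN h.
Unshelve. all: by end_near.
Qed.

Lemma boundary_lpf : lpf_boundary F alpha setT.
Proof.
exists bvalue; split; last by move=> f /Tf_test; exact: bvalue_cvg.
split; first exact: bvalue_distribution.
move=> t0 _; exists (ball t0 1); split=> //; [exact: ball_open|exact: ballxx|].
(* Equal to [1] on the unit ball around [t0], so multiplication by it fixes the test functions
   supported there. *)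
have [ch Tch ch1] := cutoff (`|t0| + 1).
exists (fun f => bvalue (fun t => ch t * f t)); split; first exact: bvalue_pseudofunction.
move=> f [_ [K [_ KV fK]]]; congr bvalue; apply/funext => t.
have [Kt|Kt] := pselect (K t); last by rewrite fK// mulr0.
rewrite ch1 ?mul1r//; have := KV _ Kt; rewrite /ball /= => h.
by have := ler_normB t0 (t0 - t); rewrite opprB addrC subrK; lra.
Qed.

End ConverseBoundary.

Section Converse.
Context {R : realType}.
Local Notation C := R[i].
Local Notation Re := complex.Re.

Variables (S : R -> R) (alpha : R) (L : C -> C) (N : nat) (r0 : R) (r theta t : 'I_N -> R).
Hypothesis alpha0 : 0 < alpha.
Hypothesis Snd : forall x y : R, 0 <= x -> x <= y -> S x <= S y.
Hypothesis Sneg : forall x : R, x < 0 -> S x = 0.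
Hypothesis SL : forall s : C, alpha < Re s -> is_LS S s (L s).

Local Notation m := (main_term alpha r0 r theta t).
Local Notation ep := (remainder S alpha r0 r theta t).

Lemma asymptotics_remainder_cvg : S_asymptotics S alpha r0 r theta t ->
  ep x @[x --> +oo] --> (0 : R).
Proof.
move=> h; apply: cvg_trans h; apply: near_eq_cvg; near=> x.
have x0 : 0 < x by near: x; apply: nbhs_pinfty_gt; rewrite num_real.
by rewrite /remainder /stp x0 mul1r.
Unshelve. all: by end_near.
Qed.

Lemma asymptotics_remainder_bounded : ep x @[x --> +oo] --> (0 : R) ->
  exists B, forall x, `|ep x| <= B.
Proof.
move=> /cvgrPdist_lt/(_ _ ltr01)[X [_ hX]].
have [M M0 hM] := main_term_bounded r0 r theta t alpha0.
exists (`|S X| + `|S 0| + M + 1) => x.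
have [xX|xX] := ltP X x.
  by have := hX x xX; rewrite sub0r normrN => /ltW; move/le_trans; apply; rewrite lerDr !addr_ge0.
rewrite (@le_trans _ _ (`|S X| + `|S 0| + M)) ?lerDl//.
rewrite /remainder /stp; have [x0|x0] := ltP 0 x; last by rewrite mul0r normr0 !addr_ge0.
rewrite mul1r (le_trans (ler_normB _ _))//; apply: lerD; last exact: hM.
have ax : expR (- (alpha * x)) <= 1 by rewrite -expR0 ler_expR oppr_le0 mulr_ge0// ltW.
rewrite normrM (ger0_norm (expR_ge0 _)) (@le_trans _ _ `|S x|) ?ler_piMr//.
have s1 := Snd (ltW x0) xX; have s2 := Snd (lexx 0) (ltW x0).
have n1 := ler_norm (S X); have n2 := ler_norm (- S 0); rewrite normrN in n2.
by rewrite ler_norml; have := normr_ge0 (S X); have := normr_ge0 (S 0); lra.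
Qed.

Lemma boundary_of_asymptotics : S_asymptotics S alpha r0 r theta t ->
  lpf_boundary (LS_remainder L alpha r0 r theta t) alpha setT.
Proof.
move=> /asymptotics_remainder_cvg h; have [B epB] := asymptotics_remainder_bounded h.
exact: (boundary_lpf (measurable_remainder alpha r0 r theta t Snd Sneg)
  (remainder_exp r0 r theta t alpha0 Snd Sneg SL)
  (remainder_formula r0 r theta t alpha0 Snd Sneg SL) epB (remainder_eq0 _ _ _ _ _ _) h).
Qed.

End Converse.

Theorem theorem5p4 (R : realType) (S : R -> R) (alpha : R) (L : R[i] -> R[i])
  (N : nat) (r0 : R) (r theta t : 'I_N -> R) :
  0 < alpha ->
  (forall x y : R, 0 <= x -> x <= y -> S x <= S y) ->
  (forall x : R, x < 0 -> S x = 0) ->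
  (forall s : R[i], alpha < complex.Re s -> is_LS S s (L s)) ->
  (forall n, 0 < t n) ->
  (forall E : set R, closed E -> (@lebesgue_measure R) E = 0%E ->
     lpf_boundary (LS_remainder L alpha r0 r theta t) alpha (~` E) ->
     ~ E 0 -> (forall n, ~ E (t n)) ->
     (forall u : R, E u -> exists M : R, 0 < M /\
        forall x : R, 0 < x -> exists I : R[i],
          is_RS (fun v => cexp (- (Complex alpha u * RtoC v))) S 0 x I /\ cnorm I < M) ->
     S_asymptotics S alpha r0 r theta t)
  /\
  (S_asymptotics S alpha r0 r theta t ->
     lpf_boundary (LS_remainder L alpha r0 r theta t) alpha setT).
Proof.
move=> alpha0 Snd Sneg SL _; split; last exact: boundary_of_asymptotics.
by move=> E cE E0 FE E00 Et EI; apply: (asymptotics_of_boundary alpha0 Snd Sneg SL cE).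
Qed.
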